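(* Let $S=\Omega/\Gamma$ be a strictly convex projective surface of finite volume with $k\ge1$ cusps, let $B\subset\mathcal{L}$ be the $\Gamma$-invariant set of light-cone representatives associated with a choice of one light-cone representative for each cusp, and let $C$ be the convex hull of $B$. Run the Edge Flipping Algorithm (described in the context) starting from an arbitrary straight ideal triangulation of $S$. If the algorithm terminates, then its output $P$ is the convex hull $C$ of $B$, in the sense that the faces of $P$ are exactly the (two-dimensional polygonal) faces of $C$ (so that projecting the faces of $P$ to $\Omega$ gives the Epstein-Penner decomposition determined by $B$).
   Context: A strictly convex domain $\Omega\subset\mathbb{R}P^2$ is an open set whose closure lies in an affine patch, is convex there, and whose boundary contains no non-degenerate line segment. $S=\Omega/\Gamma$ is the quotient of $\Omega$ by a discrete, finitely generated group $\Gamma<\mathrm{SL}(3,\mathbb{R})$ preserving $\Omega$ and acting freely on it; $S$ has finite volume and is homeomorphic to a closed orientable surface of genus $g$ with $k\ge1$ points removed, of negative Euler characteristic. Fix a lift $\Omega^+\subset\mathbb{S}^2\subset\mathbb{R}^3$ of $\Omega$ to the unit sphere, preserved by $\Gamma$. The light-cone is $\mathcal{L}=\mathbb{R}^+\cdot\partial\Omega^+$. Each cusp $c$ of $S$ corresponds to a $\Gamma$-orbit of parabolic fixed points on $\partial\Omega$; choose an orbit representative $p_c\in\partial\Omega$ and a lift $v_c\in\mathcal{L}$ of $p_c$ (a light-cone representative). The set $B=\{\gamma v_c\mid \gamma\in\Gamma,\ c\text{ a cusp of }S\}$ is discrete, and contains exactly one lift of each parabolic fixed point. Let $C$ be the convex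 hull of $B$ in $\mathbb{R}^3$. By Cooper and Long, the projection of the faces of $\partial C$ to $\Omega$ is a $\Gamma$-invariant cell decomposition of $\Omega$, called an Epstein-Penner decomposition. An ideal triangulation of $S$ is a decomposition of $S$ into ideal triangles by pairwise disjoint, pairwise non-homotopic essential arcs running between cusps; it is straight if each ideal edge is the image of the intersection of $\Omega$ with a projective line. A straight ideal triangulation lifts to a $\Gamma$-invariant triangulation of $\Omega$ by ideal triangles with vertices at parabolic fixed points; the induced $\Gamma$-invariant polyhedron $P$ is the polyhedral surface in $\mathbb{R}^3$ whose faces are the Euclidean triangles $\tilde a\tilde b\tilde c$, one for each ideal triangle $abc$ of this triangulation of $\Omega$, where $\tilde a,\tilde b,\tilde c\in B$ are the lifts of $a,b,c$. The face class of a face $F$ is $\Gamma\cdot F$; there are finitely many face classes. For a face $F$, let $X_F$ be the plane through $F$ (it does not contain the origin). A point $v$ is below $F$ if $v$ and the origin lie in the same component of $\mathbb{R}^3\setminus X_F$. The neighbouring faces of $F$ are the faces sharing an edge with $F$; a neighbouring vertex of $F$ is the vertex of a neighbouring face not on the shared edge. If $F$ has vertices $a,b,c$ and $v$ is the neighbouring vertex across the edge $ab$, the edge flip on $\{v,F\}$ replaces the faces $\{a,b,c\}$ and $\{a,b,v\}$ by $\{c,v,a\}$ and $\{c,b,v\}$, performed $\Gamma$-equivariantly (so two face classes are replaced by two other face classes); it is admissible if $v$ is below $F$. Edge Flipping Algorithm. Input: a straight ideal triangulation of $S$; let $P$ be the induced $\Gamma$-invariant polyhedron. (1) Go through the face classes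 of $P$ and, for each, the neighbouring vertices $v$ of a representative $F$; if some $v$ is below $F$, perform the edge flip on $\{v,F\}$, replacing $P$ by the resulting $\Gamma$-invariant polyhedron, and restart step (1). If there are no admissible edge flips for any face class, go to step (2). (2) Cleanup: for each edge class $e$ of $P$, if the two faces sharing $e$ are coplanar, remove $e$ ($\Gamma$-equivariantly) and merge the two faces. Return $P$. *)

(* Defs.v *)
From HB Require Import structures.
From Stdlib Require Import Relation_Operators.
From mathcomp Require Import all_boot all_order all_algebra generic_quotient.
From mathcomp Require Import all_classical all_reals all_analysis.

Set Implicit Arguments.
Unset Strict Implicit.
Unset Printing Implicit Defensive.

Import Order.TTheory GRing.Theory Num.Theory.
Import numFieldNormedType.Exports.

Local Open Scope classical_set_scope.
Local Open Scope ring_scope.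

Section Topology.
Local Open Scope quotient_scope.

Definition equiv_closure (T : Type) (r : T -> T -> Prop) : rel T :=
  fun x y => `[< clos_refl_sym_trans T r x y >].

Lemma equiv_closure_equiv (T : choiceType) (r : T -> T -> Prop) :
  equiv_class_of (equiv_closure r).
Proof.
split.
- by move=> x; apply/asboolP; exact: rst_refl.
- by move=> x y; apply/idP/idP => /asboolP h; apply/asboolP; exact: rst_sym.
- by move=> y x z /asboolP h1 /asboolP h2; apply/asboolP; exact: rst_trans h1 h2.
Qed.

Definition quotient_space (T : topologicalType) (r : T -> T -> Prop) :
    topologicalType :=
  quotient_topology {eq_quot EquivRelPack (equiv_closure_equiv r)}.

Definition homeomorphic (X Y : topologicalType) : Prop :=
  exists (f : X -> Y) (h : Y -> X),
    [/\ continuous f, continuous h, cancel f h & cancel h f].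

End Topology.

Section ClosedSurface.
Context (R : realType).

Definition closed_disc : set (R * R) := [set p | p.1 ^+ 2 + p.2 ^+ 2 <= 1].

Definition circle_pt (s : R) : R * R := (cos (2 * pi * s), sin (2 * pi * s)).

(* The boundary word is a a^-1 for g = 0 and the product of the g commutators
   a b a^-1 b^-1, read along 4g arcs of equal length, for g > 0. *)
Definition disc_gluing (g : nat) (p q : R * R) : Prop :=
  if g is 0 then exists s : R, p = circle_pt s /\ q = circle_pt (- s)
  else exists (i : nat) (s : R), [/\ (i < g)%N, 0 <= s <= 1 &
    (p = circle_pt ((4 * i%:R + s) / (4 * g%:R)) /\
     q = circle_pt ((4 * i%:R + 3 - s) / (4 * g%:R))) \/
    (p = circle_pt ((4 * i%:R + 1 + s) / (4 * g%:R)) /\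
     q = circle_pt ((4 * i%:R + 4 - s) / (4 * g%:R)))].

Definition closed_surface (g : nat) : topologicalType :=
  quotient_space (T := set_type closed_disc)
    (fun x y => disc_gluing g (set_val x) (set_val y)).

End ClosedSurface.

Section Euclidean.
Context (R : realType).
Local Notation V := 'cV[R]_3.

Definition lform (l : 'rV[R]_3) (x : V) : R := (l *m x) 0 0.

(* The norm of the library on matrices is the maximum norm, so the Euclidean
   one is written out. *)
Definition euclid_norm (x : V) : R := Num.sqrt (\sum_i x i 0 ^+ 2).

Definition unit_sphere : set V := [set x | euclid_norm x = 1].

Definition normalize (x : V) : V := (euclid_norm x)^-1 *: x.

Definition convex_hull (A : set V) : set V := smallest (@convex_set R V) A.

Definition affine_plane (l : 'rV[R]_3) (d : R) : set V :=
  [set x | lform l x = d].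

Definition coplanar (A : set V) : Prop :=
  exists l d, l != 0 /\ A `<=` affine_plane l d.

Definition collinear (A : set V) : Prop :=
  exists a u : V, A `<=` [set a + t *: u | t in [set: R]].

(* Only the support planes whose contact set is two-dimensional are kept. *)
Definition polygonal_faces (C : set V) : set (set V) :=
  [set f | exists l d, [/\ l != 0, forall x, C x -> d <= lform l x,
     f = C `&` affine_plane l d & ~ collinear f]].

End Euclidean.

(* A subset of RP^2 is encoded by its preimage in R^3 minus the origin, a set
   of nonzero vectors stable under nonzero scaling. As RP^2 carries the quotient
   topology, the subset is open iff its preimage is, and the preimage of its
   closure is the closure of the preimage with the origin removed. *)
Section ProjectivePlane.
Context (R : realType).
Local Notation V := 'cV[R]_3.

Definition projective_set (Omega : set V) : Prop :=
  (forall x, Omega x -> x != 0) /\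
  (forall (t : R) x, t != 0 -> Omega x -> Omega (t *: x)).

(* The affine patch of l is the complement of the projective line l = 0,
   with the affine structure of the plane l = 1. *)
Definition closure_in_patch (l : 'rV[R]_3) (Omega : set V) : Prop :=
  forall x, closure Omega x -> x != 0 -> lform l x != 0.

Definition strictly_convex_domain (Omega : set V) : Prop :=
  [/\ projective_set Omega, open Omega &
    exists l, [/\ closure_in_patch l Omega,
      @convex_set R V (Omega `&` affine_plane l 1) &
      forall x y, x != y ->
        ~ convex_hull [set x; y] `<=`
            (closure Omega `\` Omega) `&` affine_plane l 1]].

End ProjectivePlane.

Section BusemannVolume.
Context (R : realType).
Local Notation V := 'cV[R]_3.

Definition chart (M : 'M[R]_3) (p : R * R) : V :=
  M *m (\col_i [tuple p.1; p.2; 1]`_i).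

Definition chart_domain (M : 'M[R]_3) (Omega : set V) : set (R * R) :=
  [set p | Omega (chart M p)].

Definition exit_time (D : set (R * R)) (p u : R * R) : R :=
  sup [set t : R | 0 <= t /\ D (p.1 + t * u.1, p.2 + t * u.2)].

(* The Finsler norm of the Hilbert metric. For u = 0 the set of times is
   unbounded, so exit_time is 0 by convention, and so is the norm. *)
Definition hilbert_norm (D : set (R * R)) (p u : R * R) : R :=
  ((exit_time D p u)^-1 + (exit_time D p (- u.1, - u.2))^-1) / 2.

Definition plane_measure := (@lebesgue_measure R \x @lebesgue_measure R)%E.

Definition busemann_density (D : set (R * R)) (p : R * R) : R :=
  pi / fine (plane_measure [set u | hilbert_norm D p u < 1]).

Definition busemann_volume (D : set (R * R)) (E : set (R * R)) : \bar R :=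
  (\int[plane_measure]_(p in E) (busemann_density D p)%:E)%E.

End BusemannVolume.

Section ConvexProjectiveSurface.
Context (R : realType).
Local Notation V := 'cV[R]_3.

Definition is_subgroup (G : set 'M[R]_3) : Prop :=
  [/\ G 1%:M, forall m n, G m -> G n -> G (m *m n) &
     forall m, G m -> m \in unitmx /\ G (invmx m)].

Variables (Omega : set V) (Gamma : set 'M[R]_3).

Definition discrete_fg_subgroup_SL3 : Prop :=
  [/\ is_subgroup Gamma, forall m, Gamma m -> \det m = 1,
     Gamma `<=` isolated Gamma &
     exists s : seq 'M[R]_3, Gamma = smallest is_subgroup [set` s]].

Definition same_orbit (x y : V) : Prop :=
  exists m t, [/\ Gamma m, t != 0 & y = t *: (m *m x)].

Definition preserves : Prop :=
  forall m x, Gamma m -> Omega x -> Omega (m *m x).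

Definition acts_freely : Prop :=
  forall m x (t : R), Gamma m -> Omega x -> m *m x = t *: x -> m = 1%:M.

Definition quotient_surface : topologicalType :=
  quotient_space (T := set_type Omega)
    (fun x y => same_orbit (set_val x) (set_val y)).

Definition punctured_surface_type (g k : nat) : Prop :=
  exists F : set (closed_surface R g), (F #= `I_k)%card /\
    homeomorphic quotient_surface (set_type (~` F)).

(* The volume of the quotient is the Busemann volume of a Borel set of orbit
   representatives, computed in an affine chart. *)
Definition finite_volume : Prop :=
  exists (M : 'M[R]_3) (E : set (R * R)),
    [/\ M \in unitmx /\ closure_in_patch (row ord_max (invmx M)) Omega,
       measurable E, E `<=` chart_domain M Omega,
       forall x, Omega x -> exists! p, E p /\ same_orbit x (chart M p) &
       (busemann_volume (chart_domain M Omega) E < +oo)%E].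

Record cusped_convex_surface (g k : nat) : Prop := {
  surface_domain : strictly_convex_domain Omega;
  surface_group : discrete_fg_subgroup_SL3;
  surface_preserves : preserves;
  surface_free : acts_freely;
  surface_volume : finite_volume;
  surface_type : punctured_surface_type g k;
  surface_cusped : (0 < k)%N;
  surface_euler : (2 < 2 * g + k)%N }.

End ConvexProjectiveSurface.

Section LightCone.
Context (R : realType).
Local Notation V := 'cV[R]_3.

Definition sphere_act (m : 'M[R]_3) (x : V) : V := normalize (m *m x).

Definition is_lift (Omega Omega_p : set V) : Prop :=
  [/\ Omega_p `<=` @unit_sphere R, connected Omega_p,
     forall x, Omega_p x -> ~ Omega_p (- x) &
     forall x, Omega x <-> exists t y, [/\ t != 0, Omega_p y & x = t *: y]].

Variables (Gamma : set 'M[R]_3) (Omega_p : set V).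

Definition preserves_lift : Prop :=
  forall m x, Gamma m -> Omega_p x -> Omega_p (sphere_act m x).

Definition sphere_boundary : set V := closure Omega_p `\` Omega_p.

Definition light_cone : set V :=
  [set x | exists t y, [/\ 0 < t, sphere_boundary y & x = t *: y]].

Definition jordan_block : 'M[R]_3 :=
  \matrix_(i, j) ((j == i :> nat) || (j == i.+1 :> nat))%:R.

Definition parabolic (m : 'M[R]_3) : Prop :=
  exists2 U, U \in unitmx & m = U *m jordan_block *m invmx U.

Definition parabolic_fixed_point (p : V) : Prop :=
  sphere_boundary p /\
  exists m, [/\ Gamma m, parabolic m & sphere_act m p = p].

(* Cusps are the Gamma-orbits of parabolic fixed points; v selects one of them
   for each c, and the chosen representative p_c is normalize (v c). *)
Definition light_cone_representatives (k : nat) (v : 'I_k -> V) : Prop :=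
  (forall c, light_cone (v c) /\ parabolic_fixed_point (normalize (v c))) /\
  (forall p, parabolic_fixed_point p ->
     exists! c, exists2 m, Gamma m & p = sphere_act m (normalize (v c))).

Definition light_cone_orbits (k : nat) (v : 'I_k -> V) : set V :=
  [set x | exists m c, Gamma m /\ x = m *m v c].

Definition radial_projection (A : set V) : set V :=
  [set x | Omega_p x /\ exists2 t, 0 < t & A (t *: x)].

End LightCone.

Section Triangulation.
Context (R : realType).
Local Notation V := 'cV[R]_3.
Variables (Gamma : set 'M[R]_3) (Omega_p : set V).

(* The ideal triangle, or ideal edge, with vertex set t. *)
Definition ideal_simplex (t : set V) : set V :=
  radial_projection Omega_p (convex_hull t).

(* A straight ideal triangulation of S is given by its lift to Omega; T is the
   set of vertex sets of the lifted triangles. *)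
Record straight_ideal_triangulation (T : set (set V)) : Prop := {
  sit_triangle : forall t, T t -> exists a b c,
    [/\ [/\ a != b, b != c & a != c], t = [set a; b; c] &
       t `<=` parabolic_fixed_point Gamma Omega_p];
  sit_vertices : parabolic_fixed_point Gamma Omega_p `<=` \bigcup_(t in T) t;
  sit_invariant : forall m t, Gamma m -> T t -> T (sphere_act m @` t);
  sit_finite : exists2 F, finite_set F &
    forall t, T t -> exists m t0, [/\ Gamma m, F t0 & t = sphere_act m @` t0];
  sit_cover : Omega_p `<=` \bigcup_(t in T) ideal_simplex t;
  sit_edge_to_edge : forall t t', T t -> T t' ->
    ideal_simplex t `&` ideal_simplex t' `<=` ideal_simplex (t `&` t');
  sit_locally_finite : forall x, Omega_p x -> exists2 U, nbhs x U &
    finite_set [set t | T t /\ ideal_simplex t `&` U !=set0] }.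

(* Polyhedral surfaces with triangular faces are given by the sets of vertices
   of their faces. *)
Definition induced_polyhedron (B : set V) (T : set (set V)) : set (set V) :=
  [set f | exists a b c, [/\ B a, B b, B c, f = [set a; b; c] &
     T [set normalize a; normalize b; normalize c]]].

End Triangulation.

Section EdgeFlipping.
Context (R : realType).
Local Notation V := 'cV[R]_3.
Variable Gamma : set 'M[R]_3.

Definition gamma_class (f : set V) : set (set V) :=
  [set mulmx m @` f | m in Gamma].

Definition plane_through (f : set V) : set V :=
  [set x | forall l d, f `<=` affine_plane l d -> affine_plane l d x].

Definition below (v : V) (f : set V) : Prop :=
  connected_component (~` plane_through f) 0 v.

Definition edge_flip (P P' : set (set V)) : Prop :=
  exists a b c v : V,
    [/\ P [set a; b; c], P [set a; b; v], v != c, below v [set a; b; c] &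
       P' = P `\` (gamma_class [set a; b; c] `|` gamma_class [set a; b; v])
            `|` (gamma_class [set c; v; a] `|` gamma_class [set c; b; v])].

Definition edges (P : set (set V)) : set (set V) :=
  [set e | exists a b f, [/\ P f, a != b, f a, f b & e = [set a; b]]].

(* During the cleanup a face is the set of its points. *)
Definition solid_faces (P : set (set V)) : set (set V) :=
  [set convex_hull f | f in P].

Definition shares_edge (e G G' : set V) : Prop :=
  convex_hull e `<=` G `&` G'.

Definition merge_relation (Q : set (set V)) (e G G' : set V) : Prop :=
  [/\ Q G, Q G' & exists2 e', gamma_class e e' & shares_edge e' G G'].

Definition merged_face (Q : set (set V)) (e G : set V) : set V :=
  \bigcup_(G' in clos_refl_sym_trans _ (merge_relation Q e) G) G'.

Definition cleanup_step (Q : set (set V)) (e : set V) : set (set V) :=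
  if `[< exists G G', [/\ Q G, Q G', G <> G', shares_edge e G G' &
            coplanar (G `|` G')] >]
  then [set merged_face Q e G | G in Q] else Q.

Definition edge_class_representatives (P : set (set V)) (n : nat)
    (e : 'I_n -> set V) : Prop :=
  (forall i, edges P (e i)) /\
  (forall e0, edges P e0 -> exists! i, gamma_class (e i) e0).

Definition cleanup (P Q : set (set V)) : Prop :=
  exists n (e : 'I_n -> set V), edge_class_representatives P e /\
    Q = foldl cleanup_step (solid_faces P) [seq e i | i <- enum 'I_n].

(* Every order in which admissible flips may be found is allowed. *)
Definition edge_flipping_output (P0 Q : set (set V)) : Prop :=
  exists P, [/\ clos_refl_trans _ edge_flip P0 P,
    forall P', ~ edge_flip P P' & cleanup P Q].

End EdgeFlipping.

Definition epstein_penner_decomposition (R : realType)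
    (Omega_p B : set 'cV[R]_3) : set (set 'cV[R]_3) :=
  [set radial_projection Omega_p f | f in polygonal_faces (convex_hull B)].

(* Main.v *)
(* Lift everything to the convex cone K over Omega: a face of the polyhedron is
   the level set 1 of a linear form (its height), and the heights glue to a
   piecewise linear function h on K. A flip keeps the cones over the faces a
   Gamma-invariant locally finite triangulation of K, because the quadrilateral of
   a flip is convex (strict convexity) and is not folded onto itself by Gamma.
   When no flip is admissible, h is concave across every edge, hence along every
   segment of K, so h is the minimum of the heights and every vertex in B lies on
   or above every face plane. The face planes are therefore support planes of the
   hull C of B, and the contact set of such a plane is the union of the coplanar
   faces; near a cusp, where infinitely many faces accumulate, this uses that the
   edges at the cusp separate the surface. Conversely a support plane of C meeting
   it in a polygon has positive level, as parabolic orbits escape towards their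
   fixed point, so it touches C where h = 1 and is a face plane. The cleanup merges
   exactly the coplanar faces, which are linked along segments of the contact set.
   Since the lifts of a parabolic fixed point must be unique for all this, one
   also needs that the stabiliser of such a point in the discrete group Gamma has
   eigenvalue 1 there: any other eigenvalue would make conjugates of a parabolic
   element accumulate at the identity. *)

Require Import Defs.
From Stdlib Require Import Relation_Operators.
From mathcomp Require Import all_boot all_order all_algebra.
From mathcomp Require Import all_classical all_reals all_analysis.
From mathcomp Require Import ring lra.

Set Implicit Arguments.
Unset Strict Implicit.
Unset Printing Implicit Defensive.

Import Order.TTheory GRing.Theory Num.Theory.
Import numFieldNormedType.Exports.

Local Open Scope classical_set_scope.
Local Open Scope ring_scope.

(** The heights are never glued into an actual function; only the linear forms of single faces are
    compared. Local finiteness is asked along lines only ([tr_locfin]): the faces met just before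
    and just after a point of [K] already contain that point. This is exactly what an induction over
    the real interval consumes, so no list of the faces crossed by a segment is formed. Two faces
    are compared only where they touch inside the open cone, hence along a common edge, and there
    the slopes along the segment can only drop. The vertices span boundary rays of [K], where local
    finiteness fails, so facts about them are derived from nearby interior points. For the
    eigenvalue at a cusp the obstacle is that conjugation by a stabiliser element contracts only if
    its eigenvalues are ordered along the invariant flag; this order is extracted from strict
    convexity, applied to the commutator with a parabolic. *)

Section LinearAlgebra.
Context (R : realType).
Local Notation V := 'cV[R]_3.
Implicit Types (a b c x y z u v w : V) (l : 'rV[R]_3) (m : 'M[R]_3).

Lemma lformD l x y : lform l (x + y) = lform l x + lform l y.
Proof. by rewrite /lform mulmxDr mxE. Qed.

Lemma lformZ l s x : lform l (s *: x) = s * lform l x.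
Proof. by rewrite /lform -scalemxAr mxE. Qed.

Lemma lformN l x : lform l (- x) = - lform l x.
Proof. by rewrite /lform mulmxN mxE. Qed.

Lemma lform_addl l l' x : lform (l + l') x = lform l x + lform l' x.
Proof. by rewrite /lform mulmxDl mxE. Qed.

Lemma lform_scalel s l x : lform (s *: l) x = s * lform l x.
Proof. by rewrite /lform -scalemxAl mxE. Qed.

Lemma lformM l m x : lform l (m *m x) = lform (l *m m) x.
Proof. by rewrite /lform mulmxA. Qed.

Definition lformE := (lformD, lformN, lformZ).

Lemma I3_cases (P : 'I_3 -> Prop) : P 0 -> P 1 -> P ord_max -> forall i, P i.
Proof.
move=> p0 p1 p2 [[|[|[|i]]] ilt] //.
- by rewrite (_ : Ordinal ilt = 0) //; apply: val_inj.
- by rewrite (_ : Ordinal ilt = 1) //; apply: val_inj.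
- by rewrite (_ : Ordinal ilt = ord_max) //; apply: val_inj.
Qed.

Lemma sum_I3 (F : 'I_3 -> R) : \sum_i F i = F 0 + F 1 + F ord_max.
Proof.
rewrite !big_ord_recr big_ord0 /= add0r.
by congr (F _ + F _ + F _); apply: val_inj.
Qed.

(** The determinant with columns [a], [b], [c], written out in coordinates so that [ring] decides
    identities between such determinants. *)
Definition det3 a b c : R :=
  a 0 0 * (b 1 0 * c ord_max 0 - b ord_max 0 * c 1 0)
  - a 1 0 * (b 0 0 * c ord_max 0 - b ord_max 0 * c 0 0)
  + a ord_max 0 * (b 0 0 * c 1 0 - b 1 0 * c 0 0).

Lemma cramer3 a b c x :
  det3 a b c *: x = det3 x b c *: a + det3 a x c *: b + det3 a b x *: c.
Proof.
apply/colP; apply: I3_cases; rewrite !mxE /det3; ring.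
Qed.

Lemma det_mx3 m : \det m = det3 (col 0 m) (col 1 m) (col ord_max m).
Proof.
rewrite (expand_det_row m 0) sum_I3 /cofactor.
rewrite !(expand_det_row _ ord0) !big_ord_recr !big_ord0 /= /cofactor !det_mx11.
rewrite /det3 !mxE /=.
(* The cofactor expansions leave ordinals built by [lift]; indexing the entries by natural numbers
   makes equal entries syntactically equal. *)
pose f p q := m (inord p) (inord q).
have mE i j : m i j = f (i : nat) (j : nat) by rewrite /f !inord_val.
rewrite !mE /= /bump /= ?modn_small //= ?addn0 ?add0n ?addn1 ?add1n.
rewrite !expr0 ?expr1 ?expr2; ring.
Qed.

Lemma mulmx_cols m a :
  m *m a = a 0 0 *: col 0 m + a 1 0 *: col 1 m + a ord_max 0 *: col ord_max m.
Proof. by apply/colP => j; rewrite !mxE sum_I3; ring. Qed.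

Lemma det3_mul m a b c : det3 (m *m a) (m *m b) (m *m c) = \det m * det3 a b c.
Proof.
rewrite det_mx3 /det3 !mxE !sum_I3; ring.
Qed.
(** The cross product of [b] and [c], as a linear form. *)
Definition crossr b c : 'rV[R]_3 :=
  \row_j det3 (delta_mx j 0) b c.

Lemma crossrE a b c : lform (crossr b c) a = det3 a b c.
Proof. by rewrite /lform mxE sum_I3 !mxE /det3 !mxE /=; ring. Qed.

Lemma det3_coord a b c r s t :
  let w := r *: a + s *: b + t *: c in
  [/\ det3 w b c = r * det3 a b c, det3 a w c = s * det3 a b c &
     det3 a b w = t * det3 a b c].
Proof. by split; rewrite /det3 !mxE; ring. Qed.

Lemma basis_coord a b c x : det3 a b c != 0 ->
  exists r s t, x = r *: a + s *: b + t *: c.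
Proof.
move=> d0; exists (det3 x b c / det3 a b c), (det3 a x c / det3 a b c),
  (det3 a b x / det3 a b c).
apply: (scalerI d0); rewrite cramer3 !scalerDr !scalerA.
by rewrite ![det3 a b c * _]mulrC !divfK.
Qed.

Lemma coord_inj a b c r s t r' s' t' : det3 a b c != 0 ->
  r *: a + s *: b + t *: c = r' *: a + s' *: b + t' *: c ->
  [/\ r = r', s = s' & t = t'].
Proof.
move=> d0 e; have [e1 e2 e3] := det3_coord a b c r s t.
have [f1 f2 f3] := det3_coord a b c r' s' t'.
rewrite e in e1 e2 e3.
by split; apply: (mulIf d0); [rewrite -e1|rewrite -e2|rewrite -e3].
Qed.

Lemma form_exists a b c r s t : det3 a b c != 0 ->
  exists l, [/\ lform l a = r, lform l b = s & lform l c = t].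
Proof.
move=> d0; exists ((det3 a b c)^-1 *:
  (r *: crossr b c + s *: crossr c a + t *: crossr a b)).
rewrite !(lform_scalel, lform_addl, crossrE).
by split; rewrite /det3; rewrite /det3 in d0; field.
Qed.

Lemma form_ext l l' : (forall x, lform l x = lform l' x) -> l = l'.
Proof.
move=> h; apply/rowP => j; have := h (delta_mx j 0).
rewrite /lform !mxE !(bigD1 (P := predT) j) //= !mxE !eqxx !mulr1.
by rewrite !big1 ?addr0 // => i /negPf ij; rewrite mxE ij mulr0.
Qed.

Lemma form_basis_ext a b c l l' : det3 a b c != 0 -> lform l a = lform l' a ->
  lform l b = lform l' b -> lform l c = lform l' c -> l = l'.
Proof.
move=> d0 ea eb ec; apply: form_ext => x.
have [r [s [t ->]]] := basis_coord x d0.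
by rewrite !lformE ea eb ec.
Qed.

Lemma lform_neq0 l : l != 0 -> exists x, lform l x != 0.
Proof.
move=> l0; apply: contrapT => h; move/eqP: l0; apply.
apply: form_ext => x; rewrite [RHS]/lform mul0mx mxE.
by apply: contrapT => /eqP lx; apply: h; exists x.
Qed.

(** If every [det3 a b c] vanished, so would all 2 by 2 minors of [a] and [b], and a nonzero entry
    of [a] would give the factor of proportionality. *)
Lemma nonproportional_det3 a b : a != 0 -> (forall s, b != s *: a) ->
  exists c, det3 a b c != 0.
Proof.
move=> a0 ab; apply: contrapT => h.
have d0 c : det3 a b c = 0.
  by apply: contrapT => /eqP dc; apply: h; exists c.
have [i ai] : exists i, a i 0 != 0.
  apply: contrapT => hi; move/eqP: a0; apply; apply/colP => i.
  by rewrite mxE; apply: contrapT => /eqP ai; apply: hi; exists i.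
have := ab (b i 0 / a i 0); apply/negP; rewrite negbK; apply/eqP.
have dj j := d0 (delta_mx j 0); rewrite /det3 in dj.
have := dj 0; have := dj 1; have := dj ord_max; rewrite !mxE /= => h2 h1 h0.
by apply/colP; move: i ai; apply: I3_cases => ai; apply: I3_cases;
  rewrite !mxE; apply: (mulIf ai); rewrite mulrAC divfK //; lra.
Qed.

(** Once [a], [b] are completed to a basis by some [w], the coefficient of [w] in Cramer's rule for
    [c] is the vanishing determinant. *)
Lemma dependent_span a b c : a != 0 -> (forall s, b != s *: a) ->
  det3 a b c = 0 -> exists r s, c = r *: a + s *: b.
Proof.
move=> a0 ab d; have [w dw] := nonproportional_det3 a0 ab.
exists (det3 c b w / det3 a b w), (det3 a c w / det3 a b w).
apply: (scalerI dw); rewrite cramer3 d scale0r addr0 scalerDr !scalerA.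
by rewrite ![det3 a b w * _]mulrC !divfK.
Qed.

Lemma affine_neg (p q : R) : p < 0 ->
  exists2 e, 0 < e & forall s, `|s| < e -> p + s * q < 0.
Proof.
move=> p0; have q1 : 0 < `|q| + 1 by have := normr_ge0 q; lra.
exists (- p / (`|q| + 1)); first by apply: divr_gt0 => //; lra.
move=> s; rewrite ltr_pdivlMr // => hs.
have : s * q <= `|s| * `|q| by rewrite -normrM ler_norm.
have := normr_ge0 s; lra.
Qed.

Lemma affine_pos (p q : R) : 0 < p ->
  exists2 e, 0 < e & forall s, `|s| < e -> 0 < p + s * q.
Proof.
move=> p0; have [|e e0 he] := @affine_neg (- p) (- q); first lra.
by exists e => // s /he; rewrite mulrN; lra.
Qed.

End LinearAlgebra.

Ltac vring := apply/colP => ?; rewrite !mxE; ring.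

(** * Strictly convex cones *)

Section StrictCone.
Context (R : realType).
Local Notation V := 'cV[R]_3.
Implicit Types (a b c p x y z u v w e : V) (l : 'rV[R]_3) (m g : 'M[R]_3).

(* [K] is the open cone over a strictly convex domain and [D] its boundary
   without the origin. *)
Record strict_cone (K D : set V) (l : 'rV[R]_3) : Prop := {
  sc_scale : forall (s : R) x, 0 < s -> K x -> K (s *: x);
  sc_add : forall x y, K x -> K y -> K (x + y);
  sc_open : forall x v, K x ->
    exists2 e : R, 0 < e & forall s : R, `|s| < e -> K (x + s *: v);
  sc_addD : forall x y, K x -> D y -> K (x + y);
  sc_strict : forall x y, D x -> D y -> (forall s, y != s *: x) -> K (x + y);
  sc_disjoint : forall x, D x -> ~ K x;
  sc_posK : forall x, K x -> 0 < lform l x;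
  sc_posD : forall x, D x -> 0 < lform l x }.

Variables (K D : set V) (l : 'rV[R]_3).
Hypothesis sc : strict_cone K D l.

Lemma D_neq0 x : D x -> x != 0.
Proof.
move=> /(sc_posD sc) h; apply/eqP => x0; move: h.
by rewrite x0 /lform mulmx0 mxE ltxx.
Qed.

Lemma D_scale_notK x (s : R) : D x -> ~ K (s *: x).
Proof.
move=> Dx Ks; have s0 : 0 < s.
  by have := sc_posK sc Ks; rewrite lformZ pmulr_lgt0 // (sc_posD sc).
apply: (sc_disjoint sc Dx).
have := sc_scale sc (s := s^-1) _ Ks; rewrite scalerA mulVf ?gt_eqF // scale1r.
by apply; rewrite invr_gt0.
Qed.

Lemma KD_addZ x y (s : R) : 0 <= s -> K x -> D y -> K (x + s *: y).
Proof.
rewrite le0r => /orP[/eqP ->|s0 Kx Dy]; first by rewrite scale0r addr0.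
have -> : x + s *: y = s *: (s^-1 *: x + y).
  by rewrite scalerDr scalerA divff ?gt_eqF // scale1r.
by apply: (sc_scale sc) => //; apply: (sc_addD sc) => //;
  apply: (sc_scale sc) => //; rewrite invr_gt0.
Qed.

Lemma nonprop_sym x y : D x -> D y -> (forall s, y != s *: x) ->
  forall s, x != s *: y.
Proof.
move=> Dx Dy h s; apply/eqP => e.
have s0 : s != 0.
  by apply/eqP => s0; move: (D_neq0 Dx); rewrite e s0 scale0r eqxx.
by move: (h s^-1); rewrite e scalerA mulVf // scale1r eqxx.
Qed.

(** The smaller coefficient is taken out as a multiple of [x + y]; what is left is a nonnegative
    multiple of a boundary vector. *)
Lemma DD_addZ x y (r s : R) : D x -> D y -> (forall t, y != t *: x) ->
  0 < r -> 0 < s -> K (r *: x + s *: y).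
Proof.
move=> Dx Dy h r0 s0; have Kxy := sc_strict sc Dx Dy h.
have [rs|sr] := leP r s.
  have -> : r *: x + s *: y = r *: (x + y) + (s - r) *: y.
    by vring.
  by apply: KD_addZ => //; [lra|apply: (sc_scale sc)].
have -> : r *: x + s *: y = s *: (x + y) + (r - s) *: x.
  by vring.
by apply: KD_addZ => //; [lra|apply: (sc_scale sc)].
Qed.

(** Once its signs are sorted, a relation between three distinct boundary rays makes one of them a
    positive combination of the two others, which strict convexity puts into [K]; two negative
    coefficients contradict the positivity of [l]. *)
Lemma D_det3 a b c : D a -> D b -> D c ->
  (forall s, b != s *: a) -> (forall s, c != s *: a) -> (forall s, c != s *: b) ->
  det3 a b c != 0.
Proof.
move=> Da Db Dc ab ac bc; apply/eqP => d.
have [r [s e]] := dependent_span (D_neq0 Da) ab d.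
have ca := nonprop_sym Da Dc ac; have cb := nonprop_sym Db Dc bc.
case: (ltgtP r 0) => [r0|r0|r0].
- case: (ltgtP s 0) => [s0|s0|s0].
  + have := sc_posD sc Dc; rewrite e lformD !lformZ.
    by have := sc_posD sc Da; have := sc_posD sc Db; nra.
  + apply: (@D_scale_notK b s) => //.
    have -> : s *: b = 1 *: c + (- r) *: a.
      by rewrite e scale1r scaleNr addrAC addrN add0r.
    by apply: DD_addZ => //; lra.
  + by move: (ac r); rewrite e s0 scale0r addr0 eqxx.
- case: (ltgtP s 0) => [s0|s0|s0].
  + apply: (@D_scale_notK a r) => //.
    have -> : r *: a = 1 *: c + (- s) *: b by rewrite e scale1r scaleNr addrK.
    by apply: DD_addZ => //; lra.
  + by apply: (sc_disjoint sc Dc); rewrite e; apply: DD_addZ.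
  + by move: (ac r); rewrite e s0 scale0r addr0 eqxx.
- by move: (bc s); rewrite e r0 scale0r add0r eqxx.
Qed.

Lemma K_span2 a b x (r s : R) : D a -> D b -> K x -> x = r *: a + s *: b ->
  0 < r /\ 0 < s.
Proof.
move=> Da Db Kx e; split; rewrite ltNge; apply/negP => h.
- apply: (@D_scale_notK b s) => //.
  have -> : s *: b = x + (- r) *: a by rewrite e scaleNr addrAC addrN add0r.
  by apply: KD_addZ => //; lra.
- apply: (@D_scale_notK a r) => //.
  have -> : r *: a = x + (- s) *: b by rewrite e scaleNr addrK.
  by apply: KD_addZ => //; lra.
Qed.

(** The diagonals of an ideal quadrilateral cross: [v + t *: c] lies in [K] as a positive
    combination of two boundary vectors, and also in the plane of [a] and [b]. *)
Lemma opposite_coord a b c v (r s t : R) : D a -> D b -> D c -> D v ->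
  (forall q, v != q *: c) -> v = r *: a + s *: b - t *: c -> 0 < t ->
  0 < r /\ 0 < s.
Proof.
move=> Da Db Dc Dv cv e t0; apply: (@K_span2 a b (v + t *: c)) => //.
  by rewrite addrC -[v]scale1r; apply: DD_addZ.
by rewrite e subrK.
Qed.

End StrictCone.

(** * Parabolic elements and cusps *)

Section Cusps.
Context (R : realType).
Local Notation V := 'cV[R]_3.
Implicit Types (a b c p x v w e : V) (m g h u : 'M[R]_3).

Record cone_group (K D : set V) (Gam : set 'M[R]_3) : Prop := {
  cg_group : is_subgroup Gam;
  cg_det : forall g, Gam g -> \det g = 1;
  cg_K : forall g x, Gam g -> K x -> K (g *m x);
  cg_D : forall g x, Gam g -> D x -> D (g *m x) }.

(** [e3], [e2], [p] is a Jordan chain of [m] for the eigenvalue 1, ending in the eigenvector [p]. *)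
Record parabolic_frame (m : 'M[R]_3) (p e2 e3 : V) : Prop := {
  pf_basis : det3 p e2 e3 != 0;
  pf_1 : m *m p = p;
  pf_2 : m *m e2 = e2 + p;
  pf_3 : m *m e3 = e3 + e2 }.

Lemma linear_pos_slope0 (a b : R) : (forall n : nat, 0 < a + n%:R * b) ->
  (forall n : nat, 0 < a - n%:R * b) -> b = 0.
Proof.
move=> h1 h2; apply: contrapT => /eqP b0.
have [n hn] : exists n : nat, a < n%:R * `|b|.
  exists (Num.bound `|a / `|b| |).
  rewrite -ltr_pdivrMr ?normr_gt0 //.
  exact: le_lt_trans (ler_norm _) (archi_boundP (normr_ge0 _)).
have := h1 n; have := h2 n; case: (ler0P b) hn => _; lra.
Qed.

Lemma quadratic_pos_lead (a b c : R) :
  (forall n : nat, 0 < a + n%:R * b + n%:R * (n%:R - 1) / 2 * c) -> 0 <= c.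
Proof.
move=> h; rewrite leNgt; apply/negP => c0.
(* At [N.+1] the quadratic term is [N.+1] times [N * c / 2], and this choice makes the latter
   smaller than minus the sum of the absolute values of [a] and [b]. *)
pose N := Num.bound `|(`|a| + `|b|) * 2 / - c|.
have hN : (`|a| + `|b|) * 2 / - c < N%:R.
  exact: le_lt_trans (ler_norm _) (archi_boundP (normr_ge0 _)).
rewrite ltr_pdivrMr in hN; last lra.
have := h N.+1; rewrite -natr1.
have N0 : (0 : R) <= N%:R by rewrite ler0n.
have := ler_norm a; have := ler_norm b; have := normr_ge0 a.
set n := N%:R in hN N0 *; nra.
Qed.

Section Frame.
Variables (K D : set V) (l : 'rV[R]_3) (Gam : set 'M[R]_3).
Hypothesis sc : strict_cone K D l.
Hypothesis cg : cone_group K D Gam.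

Lemma Gam1 : Gam 1%:M. Proof. by have [] := cg_group cg. Qed.
Lemma GamM g h : Gam g -> Gam h -> Gam (g *m h).
Proof. by have [_ H _] := cg_group cg; apply: H. Qed.
Lemma GamV g : Gam g -> Gam (invmx g).
Proof. by have [_ _ H] := cg_group cg => /H[]. Qed.
Lemma Gam_unit g : Gam g -> g \in unitmx.
Proof. by have [_ _ H] := cg_group cg => /H[]. Qed.
Lemma mulVx g x : Gam g -> invmx g *m (g *m x) = x.
Proof. by move=> /Gam_unit gu; rewrite mulmxA mulVmx // mul1mx. Qed.
Lemma mul_comb g a b c (r s t : R) :
  g *m (r *: a + s *: b + t *: c) =
  r *: (g *m a) + s *: (g *m b) + t *: (g *m c).
Proof. by rewrite !mulmxDr -!scalemxAr. Qed.

Variables (m : 'M[R]_3) (p e2 e3 : V).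
Hypothesis Gm : Gam m.
Hypothesis Dp : D p.
Hypothesis pf : parabolic_frame m p e2 e3.

(** For an integer [tau] this is the power [tau] of [m] applied to the vector with frame coordinates
    [r], [s], [t]; the quadratic coefficient is the binomial coefficient of [tau] over 2. *)
Definition flow (tau : R) (r s t : R) : V :=
  (r + tau * s + tau * (tau - 1) / 2 * t) *: p + (s + tau * t) *: e2 + t *: e3.

Lemma flow_step tau r s t : m *m flow tau r s t = flow (tau + 1) r s t.
Proof.
rewrite /flow mul_comb (pf_1 pf) (pf_2 pf) (pf_3 pf).
by apply/colP => i; rewrite !mxE; field.
Qed.

Definition flow_good tau := exists2 g, Gam g & g *m p = p /\
  forall r s t, g *m (r *: p + s *: e2 + t *: e3) = flow tau r s t.

Lemma flow_good_pos (n : nat) : flow_good n%:R.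
Proof.
elim: n => [|n [g Gg [gp IH]]].
  exists 1%:M; first exact: Gam1.
  split=> [|r s t]; rewrite mul1mx // /flow.
  by vring.
exists (m *m g); first exact: GamM.
split=> [|r s t]; first by rewrite -mulmxA gp (pf_1 pf).
by rewrite -mulmxA IH flow_step natr1.
Qed.

Lemma flow_good_neg (n : nat) : flow_good (- n%:R).
Proof.
elim: n => [|n [g Gg [gp IH]]].
  by rewrite oppr0; exact: (flow_good_pos 0).
exists (invmx m *m g); first by apply: GamM => //; exact: GamV.
split=> [|r s t]; first by rewrite -mulmxA gp -{1}(pf_1 pf) mulVx.
rewrite -mulmxA IH.
have -> : flow (- n%:R) r s t = m *m flow (- n.+1%:R) r s t.
  by rewrite flow_step -natr1 opprD subrK.
by rewrite mulVx.
Qed.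

Lemma lform_flow (f : 'rV[R]_3) tau r s t : lform f (flow tau r s t) =
  (r * lform f p + s * lform f e2 + t * lform f e3) +
  tau * (s * lform f p + t * lform f e2) + tau * (tau - 1) / 2 * (t * lform f p).
Proof. by rewrite /flow !lformE; field. Qed.

(** The form [l] is positive at the images of [x] under all powers of [m]; these values are
    quadratic in the exponent, with leading coefficient a positive multiple of [t]. *)
Lemma frame_coord_ge0 x r s t : K x \/ D x ->
  x = r *: p + s *: e2 + t *: e3 -> 0 <= t.
Proof.
move=> KDx e.
suff : 0 <= t * lform l p by rewrite pmulr_lge0 // (sc_posD sc).
apply: (@quadratic_pos_lead (r * lform l p + s * lform l e2 + t * lform l e3)
  (s * lform l p + t * lform l e2)) => n; rewrite -lform_flow.
have [g Gg [_ <-]] := flow_good_pos n; rewrite -e.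
case: KDx => h.
- by apply: (sc_posK sc); exact: (cg_K cg).
- by apply: (sc_posD sc); exact: (cg_D cg).
Qed.

Lemma frame_coord_K x r s t : K x -> x = r *: p + s *: e2 + t *: e3 -> 0 < t.
Proof.
move=> Kx e; rewrite lt_neqAle eq_sym (frame_coord_ge0 (or_introl Kx) e) andbT.
(* If [t] vanished, the open cone would also contain points with a negative last coordinate. *)
apply/eqP => t0; have [d d0 hd] := sc_open sc (- e3) Kx.
have Ke : K (x + (d / 2) *: (- e3)).
  by apply: hd; rewrite ger0_norm; lra.
have /(_ r s (- (d / 2))) := frame_coord_ge0 (or_introl Ke).
rewrite e t0 scalerN scaleNr scale0r addr0 => /(_ erefl); lra.
Qed.

Lemma frame_coord_D x r s t : D x -> (forall q, x != q *: p) ->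
  x = r *: p + s *: e2 + t *: e3 -> 0 < t.
Proof.
move=> Dx px e; have /frame_coord_K : K (p + x) by exact: (sc_strict sc).
by apply; rewrite e; instantiate (1 := s); instantiate (1 := 1 + r); vring.
Qed.

Variable (w : V).
Hypothesis Dw : D w.
Hypothesis wp : forall q, w != q *: p.

Lemma g_nonprop g q' : Gam g -> g *m p = q' *: p -> forall q, g *m w != q *: p.
Proof.
move=> Gg gp q; apply/eqP => gw.
have q'0 : q' != 0.
  apply/eqP => q0; have := D_neq0 sc Dp; rewrite -(mulVx p Gg) gp q0 scale0r.
  by rewrite mulmx0 eqxx.
have := wp (q * q'^-1); apply/negP; rewrite negbK.
rewrite -(mulVx w Gg) gw -[X in _ == _ *: X](mulVx p Gg) gp -!scalemxAr scalerA.
by rewrite divfK.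
Qed.

(* The 2-plane of the flag of a regular unipotent is the only support plane at
   its fixed point, so the whole stabiliser respects the flag. *)
Lemma stabilizer_flag g lam : Gam g -> g *m p = lam *: p ->
  exists r1 mu s1 s2 nu, [/\ g *m e2 = r1 *: p + mu *: e2,
    g *m e3 = s1 *: p + s2 *: e2 + nu *: e3 &
    [/\ 0 < lam, 0 < mu, 0 < nu & lam * mu * nu = 1]].
Proof.
move=> Gg gp.
have [r1 [mu [ka eg2]]] := basis_coord (g *m e2) (pf_basis pf).
have [s1 [s2 [nu eg3]]] := basis_coord (g *m e3) (pf_basis pf).
have [r [s [t ew]]] := basis_coord w (pf_basis pf).
have t0 := frame_coord_D Dw wp ew.
(* The last coordinate of [g m^tau w] is positive for every integer [tau] and affine in [tau], so
   its slope [ka * t] must vanish: [g] preserves the plane of [p] and [e2]. *)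
have H tau : flow_good tau -> 0 < (ka * s + nu * t) + tau * (ka * t).
  move=> [h Gh [hp hh]].
  have Ghw : Gam (g *m h) by exact: GamM.
  have Dh : D (g *m h *m w) by exact: (cg_D cg).
  have q : g *m h *m p = lam *: p by rewrite -mulmxA hp gp.
  have -> : (ka * s + nu * t) + tau * (ka * t) = (s + tau * t) * ka + t * nu.
    by ring.
  apply: (@frame_coord_D (g *m h *m w)
    ((r + tau * s + tau * (tau - 1) / 2 * t) * lam + (s + tau * t) * r1 + t * s1)
    ((s + tau * t) * mu + t * s2) _ Dh (g_nonprop Ghw q)).
  by rewrite {1}ew -mulmxA hh /flow mul_comb gp eg2 eg3; vring.
have kat : ka * t = 0.
  apply: (@linear_pos_slope0 (ka * s + nu * t)) => n.
  - by apply: H; exact: flow_good_pos.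
  - by rewrite -mulNr; apply: H; exact: flow_good_neg.
have ka0 : ka = 0 by apply: (mulIf (lt0r_neq0 t0)); rewrite kat mul0r.
have nu0 : 0 < nu.
  have := H _ (flow_good_pos 0); rewrite ka0 !mul0r add0r addr0.
  by rewrite pmulr_lgt0.
have lam0 : 0 < lam.
  have := sc_posD sc (cg_D cg Gg Dp); rewrite gp lformZ pmulr_lgt0 //.
  exact: (sc_posD sc).
have := det3_mul g p e2 e3; rewrite (cg_det cg Gg) mul1r gp eg2 eg3 ka0.
have -> : det3 (lam *: p) (r1 *: p + mu *: e2 + 0 *: e3)
   (s1 *: p + s2 *: e2 + nu *: e3) = lam * mu * nu * det3 p e2 e3.
  by rewrite /det3 !mxE; ring.
move=> /(canRL (mulfK (pf_basis pf))); rewrite divff ?(pf_basis pf) // => prod1.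
exists r1, mu, s1, s2, nu; split => //; first by rewrite scale0r addr0.
split => //.
rewrite ltNge; apply/negP => mu0.
by have ln := mulr_gt0 lam0 nu0; have : lam * mu * nu <= 0; [nra|rewrite prod1; lra].
Qed.

(** Coordinates on the Heisenberg group of matrices that are upper unitriangular in the frame; [x]
    and [y] are the entries next to the diagonal, [z] is the corner. *)
Record unipotent (u : 'M[R]_3) (x y z : R) : Prop := {
  un_1 : u *m p = p;
  un_2 : u *m e2 = e2 + x *: p;
  un_3 : u *m e3 = e3 + y *: e2 + z *: p }.

(* As [u^2 w - 2 u w + w] is [x y] times a positive multiple of the boundary
   point [p], strict convexity forces [x y > 0]. *)
Lemma unipotent_sign u (x y z : R) : Gam u -> unipotent u x y z ->
  0 < x * y \/ [/\ x = 0, y = 0 & z = 0].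
Proof.
move=> Gu [u1 u2 u3]; case: (ltP 0 (x * y)) => xy; [by left|right].
(* If [v] and [u^2 v] were independent, their sum would lie in [K], and adding a nonnegative
   multiple of [p] would put [2 u v] there. So they are proportional, and the unchanged last
   coordinate makes the factor 1. *)
have key v : D v -> (forall q, v != q *: p) -> u *m v = v.
  move=> Dv vp; have [r [s [t ev]]] := basis_coord v (pf_basis pf).
  have t0 := frame_coord_D Dv vp ev.
  have uv : u *m v = (r + s * x + t * z) *: p + (s + t * y) *: e2 + t *: e3.
    by rewrite ev mul_comb u1 u2 u3; vring.
  have uuv : u *m (u *m v) = (r + (s * x + t * z) *+ 2 + t * y * x) *: p +
      (s + (t * y) *+ 2) *: e2 + t *: e3.
    by rewrite uv mul_comb u1 u2 u3; vring.
  have Duv : D (u *m v) by exact: (cg_D cg).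
  have Duuv : D (u *m (u *m v)) by exact: (cg_D cg).
  have xyt : 0 <= - (x * y) * t by nra.
  have eq2 : v + u *m (u *m v) + (- (x * y) * t) *: p = 2 *: (u *m v).
    by rewrite uuv uv {1}ev; vring.
  have [[q eq]|nq] := pselect (exists q, u *m (u *m v) = q *: v); last first.
    exfalso; apply: (D_scale_notK sc (s := 2) Duv); rewrite -eq2.
    apply: (KD_addZ sc) => //; apply: (sc_strict sc) => // q.
    by apply/eqP => e; apply: nq; exists q.
  move: eq; rewrite {1}uuv {1}ev !scalerDr !scalerA.
  case/(coord_inj (pf_basis pf)) => er es et.
  have q1 : q = 1 by apply: (mulIf (lt0r_neq0 t0)); rewrite -et mul1r.
  rewrite q1 !mul1r in er es.
  have y0 : y = 0 by apply: (mulIf (lt0r_neq0 t0)); lra.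
  have xz : s * x + t * z = 0 by move: er; rewrite y0; lra.
  by rewrite uv y0 -[r + _ + _]addrA xz !addr0 mulr0 addr0 -ev.
(* One fixed vector does not determine [u]; its image under [m], with another [e2] coordinate,
   supplies the missing equation. *)
have Dmw : D (m *m w) by exact: (cg_D cg).
have mwp : forall q, m *m w != q *: p.
  by apply: (g_nonprop (q' := 1)) => //; rewrite scale1r (pf_1 pf).
have [r [s [t ew]]] := basis_coord w (pf_basis pf).
have t0 := lt0r_neq0 (frame_coord_D Dw wp ew).
have := key w Dw wp; rewrite {1 2}ew mul_comb u1 u2 u3.
have -> : r *: p + s *: (e2 + x *: p) + t *: (e3 + y *: e2 + z *: p) =
   (r + s * x + t * z) *: p + (s + t * y) *: e2 + t *: e3 by vring.
case/(coord_inj (pf_basis pf)) => a1 a2 _.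
have := key _ Dmw mwp; rewrite ew !mul_comb (pf_1 pf) (pf_2 pf) (pf_3 pf).
rewrite !mulmxDr u1 u2 u3.
have -> : r *: p + s *: (e2 + x *: p + p) +
    t *: (e3 + y *: e2 + z *: p + (e2 + x *: p)) =
   (r + s * x + s + t * z + t * x) *: p + (s + t * y + t) *: e2 + t *: e3 by vring.
have -> : r *: p + s *: (e2 + p) + t *: (e3 + e2) =
   (r + s) *: p + (s + t) *: e2 + t *: e3 by vring.
case/(coord_inj (pf_basis pf)) => b1 _ _.
have x0 : x = 0 by apply: (mulfI t0); lra.
by rewrite x0 in a1 *; split=> //; apply: (mulfI t0); lra.
Qed.

Lemma unipotent_m : unipotent m 1 1 0.
Proof.
by split; rewrite ?(pf_1 pf) ?(pf_2 pf) ?(pf_3 pf) ?scale1r ?scale0r ?addr0.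
Qed.

Lemma unipotent_mul u u' (x y z x' y' z' : R) : unipotent u x y z ->
  unipotent u' x' y' z' ->
  unipotent (u *m u') (x + x') (y + y') (z + z' + y' * x).
Proof.
move=> [a1 a2 a3] [b1 b2 b3]; split; rewrite -mulmxA ?b1 ?b2 ?b3 //.
- by rewrite mulmxDr -scalemxAr a1 a2; vring.
- by rewrite !mulmxDr -!scalemxAr a1 a2 a3; vring.
Qed.

Lemma unipotent_inv u (x y z : R) : Gam u -> unipotent u x y z ->
  unipotent (invmx u) (- x) (- y) (x * y - z).
Proof.
move=> Gu [a1 a2 a3]; split.
- by rewrite -[in LHS]a1 mulVx.
- rewrite -[RHS](mulVx _ Gu); congr (_ *m _).
  by rewrite mulmxDr -scalemxAr a1 a2; vring.
- rewrite -[RHS](mulVx _ Gu); congr (_ *m _).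
  by rewrite !mulmxDr -!scalemxAr a1 a2 a3; vring.
Qed.

Definition flag_map (g : 'M[R]_3) (lam r1 mu s1 s2 nu : R) : Prop :=
  [/\ g *m p = lam *: p, g *m e2 = r1 *: p + mu *: e2 &
     g *m e3 = s1 *: p + s2 *: e2 + nu *: e3].

(** Conjugation scales the entries next to the diagonal by the ratios of consecutive eigenvalues of
    [g], a contraction when the eigenvalues increase along the flag. *)
Lemma unipotent_conj g u (x y z : R) lam r1 mu s1 s2 nu : Gam g ->
  flag_map g lam r1 mu s1 s2 nu -> lam != 0 -> mu != 0 -> nu != 0 ->
  unipotent u x y z ->
  unipotent (g *m u *m invmx g) (lam / mu * x) (mu / nu * y)
    ((lam * z + r1 * y - s2 * (lam / mu * x)) / nu).
Proof.
move=> Gg [g1 g2 g3] l0 m0 n0 [u1 u2 u3].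
have cj v : g *m u *m invmx g *m (g *m v) = g *m (u *m v).
  by rewrite -[in LHS]mulmxA mulVx // mulmxA.
set U := g *m u *m invmx g in cj *.
have U1 : U *m p = p.
  by apply: (scalerI l0); rewrite scalemxAr -g1 cj u1.
have U2 : U *m e2 = e2 + (lam / mu * x) *: p.
  apply: (scalerI m0); rewrite scalemxAr.
  have -> : mu *: e2 = g *m e2 - r1 *: p by rewrite g2 addrAC addrN add0r.
  rewrite mulmxBr cj u2 -scalemxAr U1 mulmxDr -scalemxAr g1 g2.
  by apply/colP => i; rewrite !mxE; field.
split => //; apply: (scalerI n0); rewrite scalemxAr.
have -> : nu *: e3 = g *m e3 - (s1 *: p + s2 *: e2).
  by rewrite g3 [X in X - _]addrC addrK.
rewrite mulmxBr cj u3 !mulmxDr -!scalemxAr U1 U2 g1 g2 g3.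
by apply/colP => i; rewrite !mxE; field; rewrite m0 n0.
Qed.

Lemma mx_basis_ext (M M' : 'M[R]_3) a b c : det3 a b c != 0 ->
  M *m a = M' *m a -> M *m b = M' *m b -> M *m c = M' *m c -> M = M'.
Proof.
move=> d0 ea eb ec; apply/matrixP => i j.
have [r [s [t e]]] := basis_coord (delta_mx j 0) d0.
have : M *m (delta_mx j 0 : V) = M' *m (delta_mx j 0 : V).
  by rewrite e !mul_comb ea eb ec.
by rewrite -!colE => /colP /(_ i); rewrite !mxE.
Qed.

Lemma outer_mulmx (q x : V) (f : 'rV[R]_3) : (q *m f) *m x = lform f x *: q.
Proof. by rewrite -mulmxA [f *m x]mx11_scalar mul_mx_scalar. Qed.

(** The matrix is affine in its three coordinates, so convergence of the coordinates gives
    convergence of the matrices. *)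
Lemma unipotent_expand : exists E F H : 'M[R]_3, forall u (x y z : R),
  unipotent u x y z -> u = 1%:M + x *: E + y *: F + z *: H.
Proof.
have [f2 [f21 f22 f23]] := form_exists 0 1 0 (pf_basis pf).
have [f3 [f31 f32 f33]] := form_exists 0 0 1 (pf_basis pf).
exists (p *m f2), (e2 *m f3), (p *m f3) => u x y z [u1 u2 u3].
by apply: (mx_basis_ext (pf_basis pf)); rewrite !mulmxDl mul1mx -!scalemxAl
  !outer_mulmx ?(f21, f22, f23, f31, f32, f33, u1, u2, u3); vring.
Qed.

(** The elements are the conjugates of [m] by the powers of [g]. At each step the corner entry is
    multiplied by [lam / nu], at most [rho ^+ 2], and receives error terms proportional to [x] and
    [y]. *)
Lemma contraction_orbit g lam r1 mu s1 s2 nu : Gam g ->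
  flag_map g lam r1 mu s1 s2 nu -> 0 < lam -> lam < mu -> mu < nu ->
  exists rho C : R, [/\ 0 < rho, rho < 1 & forall n, exists u (x y z : R),
    [/\ Gam u, unipotent u x y z, 0 < x &
       [/\ `|x| <= rho ^+ n, `|y| <= rho ^+ n & `|z| <= C * rho ^+ n]]].
Proof.
move=> Gg fm l0 lm mn.
have m0 : 0 < mu by lra.
have n0 : 0 < nu by lra.
pose q1 := lam / mu; pose q2 := mu / nu; pose rho := Num.max q1 q2.
have q10 : 0 < q1 by apply: divr_gt0.
have q20 : 0 < q2 by apply: divr_gt0.
have q11 : q1 < 1 by rewrite ltr_pdivrMr // mul1r.
have q21 : q2 < 1 by rewrite ltr_pdivrMr // mul1r.
have q1r : q1 <= rho by rewrite le_max lexx.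
have q2r : q2 <= rho by rewrite le_max lexx orbT.
have r0 : 0 < rho by lra.
have r1' : rho < 1 by rewrite gt_max q11 q21.
pose A := `|r1 / nu| + `|s2 * q1 / nu|.
have A0 : 0 <= A by rewrite addr_ge0.
(* Solves [rho ^+ 2 * C + A = C * rho], the equation that closes the induction on the bound for
   [z]. *)
pose C := A / (rho - rho ^+ 2).
have rr : 0 < rho - rho ^+ 2 by nra.
have C0 : 0 <= C by apply: divr_ge0 => //; lra.
have CA : rho ^+ 2 * C + A = C * rho.
  by rewrite -[A in LHS](divfK (lt0r_neq0 rr)) -/C; ring.
exists rho, C; split => //; elim=> [|n [u [x [y [z [Gu un x0 [hx hy hz]]]]]]].
  exists m, 1, 1, 0; rewrite !expr0 normr1 normr0 mulr1.
  by split => //; exact: unipotent_m.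
exists (g *m u *m invmx g), (q1 * x), (q2 * y),
  ((lam * z + r1 * y - s2 * (q1 * x)) / nu).
split.
- by apply: GamM; [exact: GamM|exact: GamV].
- by apply: unipotent_conj fm _ _ _ un => //; rewrite gt_eqF.
- exact: mulr_gt0.
have nq1 : `|q1 * x| = q1 * `|x| by rewrite normrM (ger0_norm (ltW q10)).
have nq2 : `|q2 * y| = q2 * `|y| by rewrite normrM (ger0_norm (ltW q20)).
rewrite !exprS nq1 nq2.
split; [by apply: ler_pM => //; exact: ltW..|].
have -> : (lam * z + r1 * y - s2 * (q1 * x)) / nu =
    q1 * q2 * z + r1 / nu * y - s2 * q1 / nu * x.
  by rewrite /q1 /q2; field; rewrite !gt_eqF.
apply: (@le_trans _ _ (rho ^+ 2 * (C * rho ^+ n) + A * rho ^+ n)); last first.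
  have -> : C * (rho * rho ^+ n) = (C * rho) * rho ^+ n by ring.
  by rewrite -CA le_eqVlt; apply/orP; left; apply/eqP; ring.
apply: le_trans (ler_normB _ _) _.
rewrite mulrDl addrA; apply: lerD; last by rewrite normrM ler_wpM2l.
apply: le_trans (ler_normD _ _) _; apply: lerD; last by rewrite normrM ler_wpM2l.
rewrite normrM ger0_norm; last by rewrite mulr_ge0 // ltW.
by apply: ler_pM => //; [rewrite mulr_ge0 // ltW|apply: ler_pM => //; exact: ltW].
Qed.

(** The conjugates tend to the identity but differ from it, their entry [x] being positive; so the
    identity would not be isolated in [Gam]. *)
Lemma no_contraction g lam r1 mu s1 s2 nu : Gam `<=` isolated Gam -> Gam g ->
  flag_map g lam r1 mu s1 s2 nu -> 0 < lam -> lam < mu -> ~ mu < nu.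
Proof.
move=> iso Gg fm l0 lm mn.
have [rho [C [r0 r1' H]]] := contraction_orbit Gg fm l0 lm mn.
have [E [F [J expand]]] := unipotent_expand.
pose P n (q : R * R * R) := exists u, [/\ Gam u, unipotent u q.1.1 q.1.2 q.2,
  0 < q.1.1 & [/\ `|q.1.1| <= rho ^+ n, `|q.1.2| <= rho ^+ n &
  `|q.2| <= C * rho ^+ n]].
have /choice[f hf] : forall n, exists q, P n q.
  by move=> n; have [u [x [y [z h]]]] := H n; exists (x, y, z), u.
have rho_cvg : rho ^+ n @[n --> \oo] --> (0 : R).
  by apply: cvg_expr; rewrite gtr0_norm.
have sq (s : nat -> R) (k : R) : (forall n, `|s n| <= k * rho ^+ n) ->
    s n @[n --> \oo] --> (0 : R).
  move=> h; apply/norm_cvg0P.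
  apply: (@squeeze_cvgr _ _ _ _ (fun=> 0) (fun n => k * rho ^+ n)).
  - by near=> n; rewrite normr_ge0 h.
  - exact: cvg_cst.
  - by rewrite -[X in _ --> X](mulr0 k); apply: cvgM => //; exact: cvg_cst.
have x0 : (f n).1.1 @[n --> \oo] --> (0 : R).
  by apply: (sq _ 1) => n; rewrite mul1r; have [u [_ _ _ []]] := hf n.
have y0 : (f n).1.2 @[n --> \oo] --> (0 : R).
  by apply: (sq _ 1) => n; rewrite mul1r; have [u [_ _ _ []]] := hf n.
have z0 : (f n).2 @[n --> \oo] --> (0 : R).
  by apply: (sq _ C) => n; have [u [_ _ _ []]] := hf n.
have cv : 1%:M + (f n).1.1 *: E + (f n).1.2 *: F + (f n).2 *: J @[n --> \oo]
    --> (1%:M : 'M[R]_3).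
  have e1 : (1%:M : 'M[R]_3) = 1%:M + 0 *: E + 0 *: F + 0 *: J.
    by rewrite !scale0r !addr0.
  rewrite [X in _ --> X]e1.
  by do 3!(apply: cvgD; last exact: cvgZr_tmp); exact: cvg_cst.
have [_ [U nU Ueq]] := iso _ (Gam1).
have [n _ /(_ n (leqnn n))] := cv _ nU.
rewrite /=; have [u [Gu un xp _]] := hf n; rewrite -(expand _ _ _ _ un) => Uu.
have : [set 1%:M] u by rewrite -Ueq.
move=> /= u1; have [_ + _] := un; rewrite u1 mul1mx => e.
have : (f n).1.1 *: p = 0 by apply: (addrI e2); rewrite addr0 -e.
move/eqP; rewrite scaler_eq0 (gt_eqF xp) /=; apply/negP; exact: (D_neq0 sc).
Unshelve. all: by end_near.
Qed.

Lemma flag_map_inv g lam r1 mu s1 s2 nu : Gam g -> 0 < lam -> 0 < mu -> 0 < nu ->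
  flag_map g lam r1 mu s1 s2 nu -> exists r1' s1' s2',
  flag_map (invmx g) lam^-1 r1' mu^-1 s1' s2' nu^-1.
Proof.
move=> Gg l0 m0 n0 [g1 g2 g3].
have h1 : invmx g *m p = lam^-1 *: p.
  rewrite -[RHS](mulVx _ Gg); congr (_ *m _).
  by rewrite -scalemxAr g1 scalerA mulVf ?gt_eqF // scale1r.
exists (- (r1 / (lam * mu))), ((r1 * s2 / mu - s1) / (lam * nu)), (- (s2 / (mu * nu))).
split => //; rewrite -[RHS](mulVx _ Gg); congr (_ *m _).
- rewrite mulmxDr -!scalemxAr g1 g2.
  by apply/colP => i; rewrite !mxE; field; rewrite !gt_eqF.
- rewrite !mulmxDr -!scalemxAr g1 g2 g3.
  by apply/colP => i; rewrite !mxE; field; rewrite !gt_eqF.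
Qed.

(** The commutator of [g] and [m] is unipotent with entries [lam / mu - 1] and [mu / nu - 1]. If
    their product is positive, the eigenvalues are strictly monotone along the flag, and [g] or its
    inverse contracts; otherwise all three eigenvalues agree, and their product is 1. *)
Lemma stabilizer_eigenvalue g lam : Gam `<=` isolated Gam -> Gam g ->
  g *m p = lam *: p -> lam = 1.
Proof.
move=> iso Gg gp.
have [r1 [mu [s1 [s2 [nu [g2 g3 [l0 m0 n0 prod1]]]]]]] := stabilizer_flag Gg gp.
have fm : flag_map g lam r1 mu s1 s2 nu by [].
have un := unipotent_mul (unipotent_conj Gg fm (lt0r_neq0 l0) (lt0r_neq0 m0)
  (lt0r_neq0 n0) unipotent_m) (unipotent_inv Gm unipotent_m).
have Gc : Gam (g *m m *m invmx g *m invmx m).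
  by apply: GamM; [apply: GamM; [exact: GamM|exact: GamV]|exact: GamV].
have lmE : lam / mu - 1 = (lam - mu) / mu by field; rewrite gt_eqF.
have mnE : mu / nu - 1 = (mu - nu) / nu by field; rewrite gt_eqF.
have := unipotent_sign Gc un; rewrite !mulr1 lmE mnE => -[h|[h1 h2 _]].
- have {h} : 0 < (lam - mu) * (mu - nu).
    have := mulr_gt0 h (mulr_gt0 m0 n0).
    have -> // : (lam - mu) / mu * ((mu - nu) / nu) * (mu * nu) =
      (lam - mu) * (mu - nu) by field; rewrite !gt_eqF.
  case: (ltgtP lam mu) => [lm|ml|->]; last by rewrite subrr mul0r ltxx.
  + move=> h; have mn : mu < nu by nra.
    by case: (no_contraction iso Gg fm l0 lm mn).
  + move=> h; have nm : nu < mu by nra.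
    have [r1' [s1' [s2' fm']]] := flag_map_inv Gg l0 m0 n0 fm.
    case: (no_contraction iso (GamV Gg) fm'); rewrite ?invr_gt0 //.
    * by rewrite ltf_pV2 ?posrE.
    * by rewrite ltf_pV2 ?posrE.
- have e1 : lam = mu.
    by apply/eqP; move/eqP: h1; rewrite mulf_eq0 invr_eq0 (gt_eqF m0) orbF subr_eq0.
  have e2' : mu = nu.
    by apply/eqP; move/eqP: h2; rewrite mulf_eq0 invr_eq0 (gt_eqF n0) orbF subr_eq0.
  apply/eqP; rewrite -(@pexpr_eq1 _ lam 3) ?ltW //.
  by rewrite -prod1 -e2' -e1 exprS expr2 mulrA.
Qed.

Lemma cusp_support : exists f : 'rV[R]_3, [/\ lform f p = 0,
  forall x, K x -> 0 < lform f x &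
  forall x, D x -> (forall q, x != q *: p) -> 0 < lform f x].
Proof.
have [f [f1 f2 f3]] := form_exists 0 0 1 (pf_basis pf).
have fE x : exists r s, x = r *: p + s *: e2 + lform f x *: e3.
  have [r [s [t e]]] := basis_coord x (pf_basis pf).
  by exists r, s; rewrite {2}e !lformE f1 f2 f3 !mulr0 !add0r mulr1.
exists f; split=> [//|x Kx|x Dx xp]; have [r [s e]] := fE x.
- exact: frame_coord_K e.
- exact: frame_coord_D e.
Qed.

(** Along the powers of [m] the values of [f] are quadratic in the exponent, with leading
    coefficient of the sign of [lform f p]. *)
Lemma cusp_growth (f : 'rV[R]_3) (d : R) : lform f p < 0 ->
  exists2 g, Gam g & lform f (g *m w) < d.
Proof.
move=> fp; apply: contrapT => h.
have [r [s [t e]]] := basis_coord w (pf_basis pf).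
have t0 := frame_coord_D Dw wp e.
suff : 0 <= t * lform f p by rewrite pmulr_rge0 // leNgt fp.
apply: (@quadratic_pos_lead (r * lform f p + s * lform f e2 + t * lform f e3 - d + 1)
  (s * lform f p + t * lform f e2)) => n.
have [g Gg [_ hg]] := flow_good_pos n.
have : d <= lform f (g *m w) by rewrite leNgt; apply/negP => h'; apply: h; exists g.
rewrite e hg lform_flow; lra.
Qed.

(** Powers of [m] and of its inverse push [w] to the two sides around [p], so modulo [p] every [y]
    in [K] ends up between two translates. The sign of [r] remains open. *)
Lemma cusp_sector y : K y -> exists g g' (r s t : R),
  [/\ Gam g, Gam g', g *m p = p & g' *m p = p] /\
  [/\ det3 p (g *m w) (g' *m w) != 0, 0 < s, 0 < t &
     y = r *: p + s *: (g *m w) + t *: (g' *m w)].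
Proof.
move=> Ky.
have [w1 [w2 [w3 ew]]] := basis_coord w (pf_basis pf).
have [y1 [y2 [y3 ey]]] := basis_coord y (pf_basis pf).
have w30 := frame_coord_D Dw wp ew.
have y30 := frame_coord_K Ky ey.
(* The [e2] coordinate left over once the [e3] coordinates are matched. The coefficients solve
   [s + t = y3 / w3] and [t - s = de / (n w3)], and both are positive once [n y3] exceeds the
   absolute value of [de]. *)
pose de := y2 - w2 * (y3 / w3).
have [n n0 hn] : exists2 n, (0 : R) < n%:R & `|de| < n%:R * y3.
  exists (Num.bound `|de / y3|).+1; first by rewrite ltr0n.
  rewrite -ltr_pdivrMr // -[y3 in X in X < _](ger0_norm (ltW y30)) -normf_div.
  by apply: lt_trans (archi_boundP (normr_ge0 _)) _; rewrite ltr_nat.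
have [g Gg [gp hg]] := flow_good_neg n.
have [g' Gg' [gp' hg']] := flow_good_pos n.
pose s := (y3 / w3 - de / (n%:R * w3)) / 2.
pose t := (y3 / w3 + de / (n%:R * w3)) / 2.
have nw : 0 < n%:R * w3 by apply: mulr_gt0.
have sE : s = (n%:R * y3 - de) / (2 * (n%:R * w3)).
  by rewrite /s; field; rewrite !gt_eqF.
have tE : t = (n%:R * y3 + de) / (2 * (n%:R * w3)).
  by rewrite /t; field; rewrite !gt_eqF.
have [h1 h2] : - de < n%:R * y3 /\ de < n%:R * y3.
  by move: hn; rewrite ltr_norml => /andP[]; split; lra.
exists g, g', (y1 - s * (w1 - n%:R * w2 + n%:R * (n%:R + 1) / 2 * w3)
   - t * (w1 + n%:R * w2 + n%:R * (n%:R - 1) / 2 * w3)), s, t.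
split=> //; rewrite {1 2 3 4}ew hg hg'; split.
- have -> : det3 p (flow (- n%:R) w1 w2 w3) (flow n%:R w1 w2 w3) =
    - (2 * n%:R * w3 * w3) * det3 p e2 e3.
    by rewrite /det3 /flow !mxE; field.
  rewrite mulf_neq0 ?(pf_basis pf) // oppr_eq0 gt_eqF //.
  by rewrite !mulr_gt0.
- by rewrite sE; apply: divr_gt0; [lra|apply: mulr_gt0].
- by rewrite tE; apply: divr_gt0; [lra|apply: mulr_gt0].
rewrite {1}ey /flow; apply/colP => i; rewrite !mxE.
have -> : y2 = (s * (w2 - n%:R * w3) + t * (w2 + n%:R * w3)).
  by rewrite /s /t /de; field; rewrite !gt_eqF.
have -> : y3 = (s + t) * w3 by rewrite /s /t; field; rewrite !gt_eqF.
by field.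
Qed.

End Frame.
End Cusps.

Lemma set3CA (T : Type) (a b c : T) : [set a; b; c] = [set b; a; c].
Proof. by rewrite [[set a] `|` _]setUC. Qed.

Lemma set3AC (T : Type) (a b c : T) : [set a; b; c] = [set a; c; b].
Proof. by rewrite -!setUA [[set b] `|` _]setUC. Qed.

Lemma set3_rot (T : Type) (a b c : T) : [set a; b; c] = [set b; c; a].
Proof. by rewrite set3CA set3AC. Qed.

Lemma image_set3 (S T : Type) (f : S -> T) (a b c : S) :
  f @` [set a; b; c] = [set f a; f b; f c].
Proof. by rewrite !image_setU !image_set1. Qed.

(** * Cone hulls *)

Section ConeHull.
Context (R : realType).
Local Notation V := 'cV[R]_3.
Implicit Types (a b c p x y v : V) (t : set V).

Definition is_convex_cone (S : set V) : Prop :=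
  [/\ S 0, forall x y, S x -> S y -> S (x + y) &
     forall (s : R) x, 0 <= s -> S x -> S (s *: x)].

(** The cone over a face depends only on the rays of its vertices, which separates the combinatorics
    of the faces from their heights. *)
Definition cone_hull t : set V := smallest is_convex_cone t.

Lemma cone_hull_cone t : is_convex_cone (cone_hull t).
Proof.
split=> [S [] []//|x y hx hy S hS|s x s0 hx S hS].
- by have [[_ + _] _] := hS; apply; [exact: hx|exact: hy].
- by have [[_ _ +] _] := hS; apply => //; exact: hx.
Qed.

Lemma sub_cone_hull t : t `<=` cone_hull t.
Proof. by move=> x tx S [_]; apply. Qed.

Lemma cone_hull_mono t t' : t `<=` t' -> cone_hull t `<=` cone_hull t'.
Proof.
by move=> tt'; apply: smallest_sub (cone_hull_cone _) (subset_trans tt' (@sub_cone_hull _)).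
Qed.

Lemma cone_hull3 a b c x : cone_hull [set a; b; c] x <->
  exists r s t : R, [/\ 0 <= r, 0 <= s, 0 <= t & x = r *: a + s *: b + t *: c].
Proof.
split.
  apply: (@smallest_sub _ _ [set a; b; c] [set x | exists r s t : R,
    [/\ 0 <= r, 0 <= s, 0 <= t & x = r *: a + s *: b + t *: c]]).
  - split => /=.
    + by exists 0, 0, 0; rewrite !scale0r !addr0.
    + move=> y z [r [s [t [r0 s0 t0 ->]]]] [r' [s' [t' [r0' s0' t0' ->]]]].
      exists (r + r'), (s + s'), (t + t'); split; [exact: addr_ge0..|].
      by vring.
    + move=> q y q0 [r [s [t [r0 s0 t0 ->]]]].
      exists (q * r), (q * s), (q * t); split; [exact: mulr_ge0..|].
      by vring.
  - move=> y [[]|] -> /=.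
    + by exists 1, 0, 0; rewrite scale1r !scale0r !addr0; split.
    + by exists 0, 1, 0; rewrite scale1r !scale0r addr0 add0r; split.
    + by exists 0, 0, 1; rewrite scale1r !scale0r !add0r; split.
move=> [r [s [t [r0 s0 t0 ->]]]].
have [_ hD hZ] := cone_hull_cone [set a; b; c].
by apply: (hD); [apply: (hD)|]; apply: (hZ) => //; apply: sub_cone_hull;
  [left; left|left; right|right].
Qed.

Lemma cone_hull2 a b x : cone_hull [set a; b] x <->
  exists r s : R, [/\ 0 <= r, 0 <= s & x = r *: a + s *: b].
Proof.
have -> : [set a; b] = [set a; b; b] by rewrite -setUA setUid.
rewrite cone_hull3; split.
- move=> [r [s [t [r0 s0 t0 ->]]]]; exists r, (s + t); split => //.
    exact: addr_ge0.
  by vring.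
- by move=> [r [s [r0 s0 ->]]]; exists r, s, 0; rewrite scale0r addr0; split.
Qed.

Lemma cone_hull_form_ge0 (f : 'rV[R]_3) t x : (forall p, t p -> 0 <= lform f p) ->
  cone_hull t x -> 0 <= lform f x.
Proof.
move=> h; apply: (@smallest_sub _ _ t [set x | 0 <= lform f x]) => //.
split => /= [|y z hy hz|s y s0 hy].
- by rewrite /lform mulmx0 mxE.
- by rewrite lformD addr_ge0.
- by rewrite lformZ mulr_ge0.
Qed.

Lemma cone_hull_form_le (f f' : 'rV[R]_3) t x :
  (forall p, t p -> lform f' p <= lform f p) ->
  cone_hull t x -> lform f' x <= lform f x.
Proof.
move=> h; have E p : lform (f + (-1) *: f') p = lform f p - lform f' p.
  by rewrite lform_addl lform_scalel mulN1r.
rewrite -subr_ge0 -E; apply: cone_hull_form_ge0 => p tp.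
by rewrite E subr_ge0 h.
Qed.

Lemma cone_hull_form_eq (f f' : 'rV[R]_3) t x :
  (forall p, t p -> lform f' p = lform f p) ->
  cone_hull t x -> lform f' x = lform f x.
Proof.
move=> h tx; apply/eqP; rewrite eq_le.
by rewrite !(cone_hull_form_le _ tx) // => p /h ->.
Qed.

(** A point outside has a negative coordinate in the basis [a], [b], [c], and this coordinate stays
    negative on a short piece of any line. *)
Lemma cone_hull3_closed a b c x v : det3 a b c != 0 ->
  ~ cone_hull [set a; b; c] x ->
  exists2 e : R, 0 < e & forall s, `|s| < e ->
    ~ cone_hull [set a; b; c] (x + s *: v).
Proof.
move=> d0 nx; have [f1 [f1a f1b f1c]] := form_exists 1 0 0 d0.
have [f2 [f2a f2b f2c]] := form_exists 0 1 0 d0.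
have [f3 [f3a f3b f3c]] := form_exists 0 0 1 d0.
have key (f : 'rV[R]_3) : 0 <= lform f a -> 0 <= lform f b -> 0 <= lform f c ->
    lform f x < 0 -> exists2 e : R, 0 < e & forall s, `|s| < e ->
    ~ cone_hull [set a; b; c] (x + s *: v).
  move=> fa fb fc fx; have [e e0 he] := affine_neg (lform f v) fx.
  exists e => // s /he hs /cone_hull_form_ge0 -/(_ f) h.
  have : 0 <= lform f (x + s *: v) by apply: h => p [[]|] ->.
  by rewrite lformD lformZ leNgt hs.
have [r [s [t ex]]] := basis_coord x d0.
have F1 : lform f1 x = r by rewrite ex !lformE f1a f1b f1c; ring.
have F2 : lform f2 x = s by rewrite ex !lformE f2a f2b f2c; ring.
have F3 : lform f3 x = t by rewrite ex !lformE f3a f3b f3c; ring.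
have [r0|r0] := ltP r 0; first by apply: (key f1); rewrite ?f1a ?f1b ?f1c ?F1.
have [s0|s0] := ltP s 0; first by apply: (key f2); rewrite ?f2a ?f2b ?f2c ?F2.
have [t0|t0] := ltP t 0; first by apply: (key f3); rewrite ?f3a ?f3b ?f3c ?F3.
by case: nx; apply/cone_hull3; exists r, s, t.
Qed.

End ConeHull.

(** * Triangulations of the cone *)

Section Triangulations.
Context (R : realType).
Local Notation V := 'cV[R]_3.
Implicit Types (a b c p x y v w : V) (t : set V) (m g h : 'M[R]_3).

(** All that the combinatorial part uses of the surface. By [cc_ray] no two vertices lie on one ray;
    [cc_two] provides a second vertex for a parabolic to move. *)
Record cusped_cone (K D : set V) (l : 'rV[R]_3) (Gam : set 'M[R]_3)
    (B : set V) : Prop := {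
  cc_cone : strict_cone K D l;
  cc_group : cone_group K D Gam;
  cc_free : forall g x, Gam g -> K x -> g *m x = x -> g = 1%:M;
  cc_BD : B `<=` D;
  cc_inv : forall g b, Gam g -> B b -> B (g *m b);
  cc_ray : forall b b' s, B b -> B b' -> b' = s *: b -> b' = b;
  cc_parabolic : forall b, B b ->
    exists m e2 e3, Gam m /\ parabolic_frame m b e2 e3;
  cc_two : forall b, B b -> exists2 c, B c & c <> b }.

Variables (K D : set V) (l : 'rV[R]_3) (Gam : set 'M[R]_3) (B : set V).
Hypothesis cc : cusped_cone K D l Gam B.
Let sc := cc_cone cc.
Let cg := cc_group cc.

Lemma B_nonprop a b : B a -> B b -> a <> b -> forall s, b != s *: a.
Proof.
by move=> Ba Bb ab s; apply/eqP => e; apply: ab; rewrite (cc_ray cc Ba Bb e).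
Qed.

Lemma B_notK a (s : R) : B a -> ~ K (s *: a).
Proof. by move=> /(cc_BD cc); exact: (D_scale_notK sc). Qed.

Definition vertex_triple a b c : Prop :=
  [/\ B a, B b & B c] /\ [/\ a <> b, b <> c & a <> c].

Lemma triple_swap a b c : vertex_triple a b c -> vertex_triple b a c.
Proof. by move=> [[? ? ?] [? ? ?]]; do 2!split => //; exact: nesym. Qed.

Lemma triple_rot a b c : vertex_triple a b c -> vertex_triple b c a.
Proof. by move=> [[? ? ?] [? ? ?]]; do 2!split => //; exact: nesym. Qed.

Lemma triple_det3 a b c : vertex_triple a b c -> det3 a b c != 0.
Proof.
move=> [[Ba Bb Bc] [ab bc ac]].
by apply: (D_det3 sc); [exact: (cc_BD cc)..| | | ]; exact: B_nonprop.
Qed.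

Lemma triple_mul g a b c : Gam g -> vertex_triple a b c ->
  vertex_triple (g *m a) (g *m b) (g *m c).
Proof.
move=> Gg [[Ba Bb Bc] [ab bc ac]].
have inj x y : g *m x = g *m y -> x = y.
  by move=> e; rewrite -(mulVx cg x Gg) e (mulVx cg).
by split; split; [exact: (cc_inv cc)..| | | ] => /inj.
Qed.

Lemma edge_inK a b (r s : R) : B a -> B b -> a <> b -> 0 < r -> 0 < s ->
  K (r *: a + s *: b).
Proof.
move=> Ba Bb ab; apply: (DD_addZ sc); [exact: (cc_BD cc)..|exact: B_nonprop].
Qed.

Lemma triple_inK a b c (r s t : R) : vertex_triple a b c ->
  0 < r -> 0 < s -> 0 <= t -> K (r *: a + s *: b + t *: c).
Proof.
move=> [[Ba Bb Bc] [ab bc ac]] r0 s0 t0.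
by apply: (KD_addZ sc) => //; [exact: edge_inK|exact: (cc_BD cc)].
Qed.

(** Covering and intersections are controlled inside the open cone only. [tr_locfin] combines local
    finiteness with the closedness of the faces, on one line at a time. *)
Record triangulation (P : set (set V)) : Prop := {
  tr_face : forall t, P t -> exists a b c, vertex_triple a b c /\ t = [set a; b; c];
  tr_vertex : forall b, B b -> exists2 t, P t & t b;
  tr_inv : forall g t, Gam g -> P t -> P (mulmx g @` t);
  tr_cover : forall x, K x -> exists2 t, P t & cone_hull t x;
  tr_meet : forall t t' x, P t -> P t' -> K x -> cone_hull t x ->
    cone_hull t' x -> cone_hull (t `&` t') x;
  tr_locfin : forall x v, K x -> exists2 e : R, 0 < e & forall s t,
    `|s| < e -> P t -> cone_hull t (x + s *: v) -> cone_hull t x }.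

Lemma triple_with t a b : (exists x y z, vertex_triple x y z /\ t = [set x; y; z]) ->
  t a -> t b -> a <> b -> exists2 c, vertex_triple a b c & t = [set a; b; c].
Proof.
move=> [x [y [z [vt ->]]]].
have vt2 := triple_rot vt; have vt3 := triple_rot vt2.
case=> [[]|] -> [[]|] -> // _.
- by exists z.
- by exists y; [apply: triple_swap|rewrite set3AC].
- by exists z; [exact: triple_swap|rewrite set3CA].
- by exists x; [|rewrite set3_rot].
- by exists y; [|rewrite -set3_rot].
- by exists x; [apply: triple_swap|rewrite set3_rot set3CA].
Qed.

Lemma triple_sub t a b c : (exists x y z, vertex_triple x y z /\ t = [set x; y; z]) ->
  vertex_triple a b c -> t a -> t b -> t c -> t = [set a; b; c].
Proof.
move=> tt [_ [ab bc ac]] ta tb tc.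
have [d _ e] := triple_with tt ta tb ab.
by move: tc; rewrite e => -[[ca|cb]|->] //; [case: ac|case: bc].
Qed.

Lemma triple_coord_pos a b c x (r s t : R) : vertex_triple a b c -> K x ->
  0 <= r -> 0 <= s -> 0 <= t -> x = r *: a + s *: b + t *: c ->
  [\/ [/\ 0 < r, 0 < s & 0 < t], [/\ 0 < r, 0 < s & t = 0],
      [/\ 0 < s, 0 < t & r = 0] | [/\ 0 < t, 0 < r & s = 0]].
Proof.
move=> [[Ba Bb Bc] _] Kx; rewrite !le0r.
move=> /orP[/eqP r0|r0] /orP[/eqP s0|s0] /orP[/eqP t0|t0] e.
- by exfalso; apply: (B_notK (s := 0) Ba); rewrite e r0 s0 t0 !scale0r !addr0 in Kx *.
- by exfalso; apply: (B_notK (s := t) Bc); rewrite e r0 s0 !scale0r !add0r in Kx.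
- by exfalso; apply: (B_notK (s := s) Bb); rewrite e r0 t0 !scale0r add0r addr0 in Kx.
- by constructor 3.
- by exfalso; apply: (B_notK (s := r) Ba); rewrite e s0 t0 !scale0r !addr0 in Kx.
- by constructor 4.
- by constructor 2.
- by constructor 1.
Qed.

Section OneTriangulation.
Variable P : set (set V).
Hypothesis tP : triangulation P.

(** The form dual to [a] is positive at [x], but would vanish on the cone over the common vertices
    if [a] were not one of them. *)
Lemma carrier_vertex a b c t x (q r s : R) : P [set a; b; c] ->
  vertex_triple a b c -> P t -> K x -> cone_hull t x -> 0 < q -> 0 <= r ->
  0 <= s -> x = q *: a + r *: b + s *: c -> t a.
Proof.
move=> Pabc vt Pt Kx tx q0 r0 s0 e; apply: contrapT => nta.
have cx : cone_hull [set a; b; c] x.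
  by apply/cone_hull3; exists q, r, s; split => //; exact: ltW.
have := tr_meet tP Pabc Pt Kx cx tx.
have [f [fa fb fc]] := form_exists 1 0 0 (triple_det3 vt).
move=> /(@cone_hull_form_eq _ f 0) h.
have : lform 0 x = lform f x.
  by apply: h => p [[[]|] -> tp]; rewrite ?fb ?fc /lform ?mul0mx ?mxE.
rewrite {2}e !lformE fa fb fc /lform mul0mx mxE; lra.
Qed.

(** An [x] interior to [t] would make all vertices of [t] vertices of [t']. Vertex rays being
    outside [K], [x] is then interior to an edge of [t], whose ends belong to [t']. *)
Lemma common_edge t t' x : P t -> P t' -> t <> t' -> K x -> cone_hull t x ->
  cone_hull t' x -> exists a b c v (r s : R), [/\ t = [set a; b; c], t' = [set a; b; v],
    c <> v, vertex_triple a b c & vertex_triple a b v] /\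
    [/\ 0 < r, 0 < s & x = r *: a + s *: b].
Proof.
move=> Pt Pt' tt' Kx tx t'x.
have edge a b c q r : vertex_triple a b c -> t = [set a; b; c] -> 0 < q -> 0 < r ->
    x = q *: a + r *: b -> exists a b c v (r s : R), [/\ t = [set a; b; c], t' = [set a; b; v],
    c <> v, vertex_triple a b c & vertex_triple a b v] /\
    [/\ 0 < r, 0 < s & x = r *: a + s *: b].
  move=> vt et q0 r0 ex.
  have t'a : t' a.
    rewrite et in Pt; apply: (carrier_vertex Pt vt Pt' Kx t'x q0 (ltW r0) (lexx 0)).
    by rewrite scale0r addr0.
  have t'b : t' b.
    rewrite et set3CA in Pt.
    apply: (carrier_vertex Pt (triple_swap vt) Pt' Kx t'x r0 (ltW q0) (lexx 0)).
    by rewrite scale0r addr0 addrC.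
  have [_ [ab _ _]] := vt.
  have [v vt' et'] := triple_with (tr_face tP Pt') t'a t'b ab.
  exists a, b, c, v, q, r; split => //; split => // cv.
  by apply: tt'; rewrite et et' cv.
have [a [b [c [vt et]]]] := tr_face tP Pt.
have := tx; rewrite {1}et => /cone_hull3 [q [r [s [q0 r0 s0 ex]]]].
case: (triple_coord_pos vt Kx q0 r0 s0 ex).
- move=> [q1 r1 s1]; case: tt'; rewrite et.
  apply/esym/(triple_sub (tr_face tP Pt') vt).
  + by rewrite et in Pt; apply: (carrier_vertex Pt vt Pt' Kx t'x q1 r0 s0 ex).
  + rewrite et set3_rot in Pt.
    apply: (carrier_vertex Pt (triple_rot vt) Pt' Kx t'x r1 s0 q0).
    by rewrite ex -[LHS]addrA addrC.
  + rewrite et -set3_rot in Pt.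
    apply: (carrier_vertex Pt (triple_rot (triple_rot vt)) Pt' Kx t'x s1 q0 r0).
    by rewrite ex -[RHS]addrA addrC.
- move=> [q1 r1 s1]; apply: (edge a b c q r) => //.
  by rewrite ex s1 scale0r addr0.
- move=> [r1 s1 q1]; apply: (edge b c a r s) => //; first exact: triple_rot.
  + by rewrite et set3_rot.
  + by rewrite ex q1 scale0r add0r.
- move=> [s1 q1 r1]; apply: (edge c a b s q) => //; first exact/triple_rot/triple_rot.
  + by rewrite et -set3_rot.
  + by rewrite ex r1 scale0r addr0 addrC.
Qed.

Lemma opposite_vertex a b c v : P [set a; b; c] -> P [set a; b; v] ->
  vertex_triple a b c -> vertex_triple a b v -> c <> v ->
  exists r s t : R, [/\ 0 < r, 0 < s, 0 < t & v = r *: a + s *: b - t *: c].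
Proof.
move=> Pc Pv vc vv cv; have [[Ba Bb Bc] [ab bc ac]] := vc.
have [[_ _ Bv] [_ bv av]] := vv.
have [r [s [t ev]]] := basis_coord v (triple_det3 vc).
have t0 : t < 0.
  have := triple_det3 vv; case: (ltgtP t 0) => // [t0 _|t0]; last first.
    have -> : det3 a b v = t * det3 a b c.
      by rewrite ev; have [_ _ ->] := det3_coord a b c r s t.
    by rewrite t0 mul0r eqxx.
  (* With [v] on the side of [c], the vector [a + b + e t c] for small [e] equals
     [(1 - e r) a + (1 - e s) b + e v] and lies in both faces, so [c] would be a vertex of the
     second one. *)
  exfalso.
  have [e1 e10 h1] := affine_pos (- r) (ltr01 : 0 < (1 : R)).
  have [e2 e20 h2] := affine_pos (- s) (ltr01 : 0 < (1 : R)).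
  pose e := Num.min e1 e2 / 2.
  have e0 : 0 < e by rewrite divr_gt0 // lt_min e10.
  have me1 : Num.min e1 e2 <= e1 by rewrite ge_min lexx.
  have me2 : Num.min e1 e2 <= e2 by rewrite ge_min lexx orbT.
  have {}h1 := h1 e; have {}h2 := h2 e; rewrite gtr0_norm // in h1 h2.
  have {}h1 : 0 < 1 + e * - r by apply: h1; rewrite /e; lra.
  have {}h2 : 0 < 1 + e * - s by apply: h2; rewrite /e; lra.
  have Kx : K (1 *: a + 1 *: b + (e * t) *: c).
    by apply: triple_inK => //; rewrite mulr_ge0 // ltW.
  have : [set a; b; v] c.
    have Pc' := Pc; rewrite -set3_rot in Pc'.
    apply: (carrier_vertex (q := e * t) (r := 1) (s := 1) Pc'
      (triple_rot (triple_rot vc)) Pv Kx) => //.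
    - apply/cone_hull3; exists (1 + e * - r), (1 + e * - s), e.
      by split; [exact: ltW..|]; rewrite ev; vring.
    - exact: mulr_gt0.
    - by rewrite -[RHS]addrA addrC.
  by case=> [[]|] // /esym.
have ev' : v = r *: a + s *: b - (- t) *: c by rewrite scaleNr opprK.
have [r0 s0] := opposite_coord sc (cc_BD cc Ba) (cc_BD cc Bb) (cc_BD cc Bc)
  (cc_BD cc Bv) (B_nonprop Bc Bv cv) ev' ltac:(lra).
by exists r, s, (- t); split => //; lra.
Qed.

(** Three distinct faces cannot be pairwise on opposite sides of the edge: the coefficient of [c] in
    [w] is negative directly, but positive when computed through [v]. *)
Lemma edge_two_faces a b c v w : P [set a; b; c] -> P [set a; b; v] ->
  P [set a; b; w] -> vertex_triple a b c -> vertex_triple a b v ->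
  vertex_triple a b w -> c <> v -> c <> w -> v = w.
Proof.
move=> Pc Pv Pw vc vv vw cv cw; apply: contrapT => vw'.
have [r [s [t [r0 s0 t0 ev]]]] := opposite_vertex Pc Pv vc vv cv.
have [r' [s' [t' [r0' s0' t0' ew]]]] := opposite_vertex Pc Pw vc vw cw.
have [r2 [s2 [t2 [r20 s20 t20 ew2]]]] := opposite_vertex Pv Pw vv vw vw'.
have : (r2 - t2 * r) *: a + (s2 - t2 * s) *: b + (t2 * t) *: c =
    r' *: a + s' *: b + (- t') *: c.
  transitivity w; last by rewrite ew scaleNr.
  by rewrite ew2 ev; vring.
by case/(coord_inj (triple_det3 vc)) => _ _ e; have := mulr_gt0 t20 t0; lra.
Qed.

End OneTriangulation.
End Triangulations.

(** * Edge flips *)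

Section NearZero.
Context (R : realType).

Definition near0 (Q : R -> Prop) : Prop :=
  exists2 e : R, 0 < e & forall s, `|s| < e -> Q s.

Lemma near0_and (Q Q' : R -> Prop) : near0 Q -> near0 Q' ->
  near0 (fun s => Q s /\ Q' s).
Proof.
move=> [e e0 h] [e' e0' h']; exists (Num.min e e'); first by rewrite lt_min e0.
by move=> s; rewrite lt_min => /andP[/h ? /h'].
Qed.

Lemma near0_imp (Q Q' : R -> Prop) : (forall s, Q s -> Q' s) -> near0 Q -> near0 Q'.
Proof. by move=> h [e e0 he]; exists e => // s /he /h. Qed.

Lemma near0_all (Q : R -> Prop) : (forall s, Q s) -> near0 Q.
Proof. by move=> h; exists 1. Qed.

End NearZero.

Section Flip.
Context (R : realType).
Local Notation V := 'cV[R]_3.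
Implicit Types (a b c p x y v w : V) (t : set V) (m g h : 'M[R]_3).
Variables (K D : set V) (l : 'rV[R]_3) (Gam : set 'M[R]_3) (B : set V).
Hypothesis cc : cusped_cone K D l Gam B.
Let sc := cc_cone cc.
Let cg := cc_group cc.
Local Notation triple := (vertex_triple B).

Lemma triple_of_eq a b c x y z : triple x y z -> [set a; b; c] = [set x; y; z] ->
  triple a b c.
Proof.
move=> [[Bx By Bz] [xy yz xz]] e.
have ha : [set x; y; z] a by rewrite -e; left; left.
have hb : [set x; y; z] b by rewrite -e; left; right.
have hc : [set x; y; z] c by rewrite -e; right.
have hx : [set a; b; c] x by rewrite e; left; left.
have hy : [set a; b; c] y by rewrite e; left; right.
have hz : [set a; b; c] z by rewrite e; right.
have BE u : [set x; y; z] u -> B u by case=> [[]|] ->.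
split; first by split; exact: BE.
by split=> q; case: hx => [[]|] /= ?; case: hy => [[]|] /= ?;
  case: hz => [[]|] /= ?; congruence.
Qed.

Lemma Gam_image_inv g t : Gam g -> mulmx (invmx g) @` (mulmx g @` t) = t.
Proof.
move=> Gg; rewrite image_comp; apply/seteqP; split => [_ [x tx <-]|x tx] /=.
  by rewrite (mulVx cg).
by exists x => //=; rewrite (mulVx cg).
Qed.

Lemma Gam_image_mul g h t : mulmx g @` (mulmx h @` t) = mulmx (g *m h) @` t.
Proof.
rewrite image_comp; apply/seteqP.
by split => [_ [x tx <-]|_ [x tx <-]]; exists x => //=; rewrite mulmxA.
Qed.

(* The sum of the three vertices would be a fixed point in the cone. *)
Lemma triple_stabilizer g h a b c : triple a b c -> Gam g -> Gam h ->
  mulmx g @` [set a; b; c] = mulmx h @` [set a; b; c] -> g = h.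
Proof.
move=> vt Gg Gh e; have Gk : Gam (invmx h *m g).
  by apply: (GamM cg) => //; exact: (GamV cg).
have {}e : mulmx (invmx h *m g) @` [set a; b; c] = [set a; b; c].
  by rewrite -Gam_image_mul e Gam_image_inv.
suff k1 : invmx h *m g = 1%:M.
  by rewrite -[RHS]mulmx1 -k1 mulmxA mulmxV ?mul1mx // (Gam_unit cg).
apply: (cc_free cc (x := 1 *: a + 1 *: b + 1 *: c)) => //.
  exact: (triple_inK cc vt).
have vt' := triple_mul cc Gk vt; rewrite mul_comb.
move: e; rewrite image_set3; set a' := _ *m a; set b' := _ *m b; set c' := _ *m c => e.
have ha : [set a; b; c] a' by rewrite -e; left; left.
have hb : [set a; b; c] b' by rewrite -e; left; right.
have hc : [set a; b; c] c' by rewrite -e; right.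
have [_ [ab bc ac]] : triple a' b' c' by [].
rewrite !scale1r; move: ab bc ac.
by case: ha => [[]|] ->; case: hb => [[]|] ->; case: hc => [[]|] -> // *; vring.
Qed.

Lemma lform_continuous (f : 'rV[R]_3) : continuous (fun x : V => lform f x).
Proof.
have -> : (fun x : V => lform f x) =
    (fun x : V => f 0 0 * x 0 0 + f 0 1 * x 1 0 + f 0 ord_max * x ord_max 0).
  by apply/funext => y; rewrite /lform mxE sum_I3.
have h i : continuous (fun y : V => f 0 i * y i 0).
  by move=> x; exact: cvgMl_tmp (@coord_continuous R 3 1 i 0 x).
by move=> x; exact: cvgD (cvgD (h _ x) (h _ x)) (h _ x).
Qed.

Lemma plane_throughP a b c x (f : 'rV[R]_3) : det3 a b c != 0 ->
  lform f a = 1 -> lform f b = 1 -> lform f c = 1 ->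
  plane_through [set a; b; c] x <-> lform f x = 1.
Proof.
move=> d0 fa fb fc; split; first by apply=> y [[]|] ->.
have [r [s [t ->]]] := basis_coord x d0.
rewrite !lformE fa fb fc !mulr1 => e f' d h.
have ha : lform f' a = d by apply: h; left; left.
have hb : lform f' b = d by apply: h; left; right.
have hc : lform f' c = d by apply: h; right.
by rewrite /affine_plane /= !lformE ha hb hc -!mulrDl e mul1r.
Qed.

(** The component of the origin is the half-space [f < 1]: a connected set reaching beyond it meets
    the plane, and within it the segment from the origin avoids the plane. *)
Lemma belowP a b c v (f : 'rV[R]_3) : det3 a b c != 0 ->
  lform f a = 1 -> lform f b = 1 -> lform f c = 1 ->
  below v [set a; b; c] <-> lform f v < 1.
Proof.
move=> d0 fa fb fc; have pl x := plane_throughP x d0 fa fb fc.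
have f0 : lform f 0 = 0 by rewrite /lform mulmx0 mxE.
split.
- move=> [C [C0 Cpl Cc] Cv]; rewrite ltNge; apply/negP => fv.
  have : connected (lform f @` C).
    by apply: connected_continuous_connected Cc _;
      exact/continuous_subspaceT/lform_continuous.
  move/connected_intervalP => Ci.
  have E0 : (lform f @` C) 0 by exists 0.
  have Ev : (lform f @` C) (lform f v) by exists v.
  have [|y Cy fy] := Ci _ _ E0 Ev 1; first by rewrite ler01 fv.
  by apply: (Cpl y Cy); apply/pl.
- move=> fv; exists [set s *: v | s in `[0, 1]%classic]; last first.
    by exists 1; rewrite ?scale1r //= in_itv /= ler01 lexx.
  split.
  + by exists 0; rewrite ?scale0r //= in_itv /= ler01 lexx.
  + move=> _ [s /= + <-] /pl; rewrite in_itv /= lformZ => /andP[s0 s1] e.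
    have se : s = 1 by nra.
    by rewrite se mul1r in e; lra.
  + apply: connected_continuous_connected.
      exact: segment_connected.
    apply: continuous_subspaceT => s; apply: cvgZr_tmp; exact: cvg_id.
Qed.

(* Along the orbit of [c] under a stabiliser of [p] a support form at [p] is a
   positive solution of u_(n+2) = be u_(n+1) - u_n, which oscillates if be < 2. *)
Lemma fan_trace g p c (al be : R) : B p -> B c -> c <> p -> Gam g -> g *m p = p ->
  g *m (g *m c) = al *: p + be *: (g *m c) - c -> 2 <= be.
Proof.
move=> Bp Bc cp Gg gp e; rewrite leNgt; apply/negP => be2.
have [m [e2 [e3 [Gm pf]]]] := cc_parabolic cc Bp.
have [f [fp _ fD]] := cusp_support sc cg Gm (cc_BD cc Bp) pf.
pose X n := iter n (mulmx g) c.
have XS n : X n.+1 = g *m X n by [].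
have BX n : B (X n) by elim: n => [//|n IH] /=; apply: (cc_inv cc).
have Xp n : X n <> p.
  elim: n => [//|n IH] /= h; apply: IH.
  by rewrite -(mulVx cg (X n) Gg) -/(X n) h -{1}gp (mulVx cg).
pose u n := lform f (X n).
have u0 n : 0 < u n.
  by apply: fD; [exact: (cc_BD cc)|apply: (B_nonprop cc) => //; exact/nesym].
have rec n : u n.+2 = be * u n.+1 - u n.
  have XE : X n.+2 = al *: p + be *: X n.+1 - X n.
    elim: n => [|n IH]; first exact: e.
    by rewrite XS IH mulmxBr mulmxDr -!scalemxAr gp -!XS -IH.
  by rewrite /u XE !lformE fp mulr0 add0r.
clearbody u.
(* If [u] never decreased, its increments would drop by at least [(2 - be) * u 0] at each step and
   become negative. *)
have [N hN] : exists N, u N.+1 < u N.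
  apply: contrapT => h; have mono n : u n <= u n.+1.
    by rewrite leNgt; apply/negP => h'; apply: h; exists n.
  have uge n : u 0 <= u n by elim: n => // n IH; exact: le_trans (mono n).
  have dec n : u n.+1 - u n <= u 1 - u 0 - n%:R * ((2 - be) * u 0).
    elim: n => [|n IH]; first by rewrite mul0r subr0 lexx.
    rewrite rec -natr1.
    have : 0 <= (2 - be) * (u n.+1 - u 0) by rewrite mulr_ge0 ?subr_ge0 // ltW.
    lra.
  have k0 : 0 < (2 - be) * u 0 by apply: mulr_gt0 => //; lra.
  have := archi_boundP (normr_ge0 ((u 1 - u 0) / ((2 - be) * u 0))).
  set n := Num.bound _ => hn.
  have : (u 1 - u 0) / ((2 - be) * u 0) < n%:R by exact: le_lt_trans (ler_norm _) hn.
  rewrite ltr_pdivrMr // => h1; have := dec n; have := mono n; lra.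
(* After a decrease the increments stay at or below it, so [u] falls at least linearly and cannot
   remain positive. *)
have dec n : u (N + n)%N.+1 - u (N + n)%N <= u N.+1 - u N.
  elim: n => [|n IH]; first by rewrite addn0 lexx.
  rewrite addnS rec; apply: le_trans IH; have := u0 (N + n).+1; nra.
have lin n : u (N + n)%N <= u N - n%:R * (u N - u N.+1).
  elim: n => [|n IH]; first by rewrite addn0 mul0r subr0 lexx.
  rewrite addnS -natr1; have := dec n; lra.
have k0 : 0 < u N - u N.+1 by lra.
have := archi_boundP (normr_ge0 (u N / (u N - u N.+1))).
set n := Num.bound _ => hn.
have : u N / (u N - u N.+1) < n%:R by exact: le_lt_trans (ler_norm _) hn.
rewrite ltr_pdivrMr // => h1; have := lin n; have := u0 (N + n)%N; lra.
Qed.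

(* The edge removed by an admissible flip does not separate two translates of a
   single face: an element carrying one to the other would fix a vertex of the
   edge, contradicting [fan_trace], or swap its ends. *)
Lemma flip_not_folded a b c v (r s q : R) : triple a b c -> triple a b v ->
  0 < r -> 0 < s -> 0 < q -> v = r *: a + s *: b - q *: c -> r + s - q < 1 ->
  forall g, Gam g -> mulmx g @` [set a; b; c] <> [set a; b; v].
Proof.
move=> vc vv r0 s0 q0 ev low g Gg; rewrite image_set3 => e.
have d0 := triple_det3 cc vc.
have dv : det3 a b v = - q * det3 a b c.
  have -> : v = r *: a + s *: b + (- q) *: c by rewrite ev scaleNr.
  by have [_ _ ->] := det3_coord a b c r s (- q).
have [_ [ab' bc' ac']] := triple_mul cc Gg vc.
have dg : det3 (g *m a) (g *m b) (g *m c) = det3 a b c.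
  by rewrite det3_mul (cg_det cg Gg) mul1r.
have [[Ba Bb Bc] [ab bc ac]] := vc.
have ha : [set a; b; v] (g *m a) by rewrite -e; left; left.
have hb : [set a; b; v] (g *m b) by rewrite -e; left; right.
have hc : [set a; b; v] (g *m c) by rewrite -e; right.
(* [g] preserves determinants, while [det3 a b v] and [det3 a b c] have opposite signs. So [g] maps
   [a], [b], [c] to an odd permutation of [a], [b], [v], and then [q] is 1. *)
have even : det3 a b v != det3 a b c.
  rewrite dv -subr_eq0 -{2}[det3 a b c]mul1r -mulrBl mulf_neq0 //.
  by rewrite lt_eqF //; lra.
have odd : - det3 a b v = det3 a b c -> q = 1.
  by rewrite dv mulNr opprK => h; apply: (mulIf d0); rewrite mul1r.
case: ha => [[ga|ga]|ga]; case: hb => [[gb|gb]|gb]; case: hc => [[gc|gc]|gc];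
  try (by rewrite ga gb in ab'); try (by rewrite gb gc in bc');
  try (by rewrite ga gc in ac'); rewrite ga gb gc in dg.
- by rewrite dg eqxx in even.
- have q1 : q = 1 by apply: odd; rewrite -dg /det3; ring.
  have : 2 <= s.
    apply: (@fan_trace g a c r s) => //; first exact/nesym.
    by rewrite gc gb ev q1 scale1r.
  lra.
- have q1 : q = 1 by apply: odd; rewrite -dg /det3; ring.
  have : g = 1%:M.
    apply: (cc_free cc (x := 1 *: a + 1 *: b)) => //.
      by apply: (edge_inK cc) => //; rewrite ltr01.
    by rewrite mulmxDr -!scalemxAr ga gb addrC.
  by move=> g1; apply: ab; rewrite -ga g1 mul1mx.
- by case/eqP: even; rewrite -dg /det3; ring.
- by case/eqP: even; rewrite -dg /det3; ring.
- have q1 : q = 1 by apply: odd; rewrite -dg /det3; ring.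
  have : 2 <= r.
    apply: (@fan_trace g b c s r) => //; first exact/nesym.
    by rewrite gc ga ev q1 scale1r; congr (_ - _); rewrite addrC.
  lra.
Qed.

End Flip.

(** * The result of an admissible flip is again a triangulation of the cone *)

Section FlipTriangulation.
Context (R : realType).
Local Notation V := 'cV[R]_3.
Implicit Types (a b c p x y v w : V) (t : set V) (m g h : 'M[R]_3).
Variables (K D : set V) (l : 'rV[R]_3) (Gam : set 'M[R]_3) (B : set V).
Hypothesis cc : cusped_cone K D l Gam B.
Let sc := cc_cone cc.
Let cg := cc_group cc.
Local Notation triple := (vertex_triple B).
Local Notation triangulation := (triangulation K Gam B).

Section Quad.
Variable P : set (set V).
Hypothesis tP : triangulation P.

Record quad a b c v : Prop := {
  qd_c : P [set a; b; c];
  qd_v : P [set a; b; v];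
  qd_tc : triple a b c;
  qd_tv : triple a b v;
  qd_neq : c <> v }.

Lemma quad_ab a b c v : quad a b c v -> quad b a c v.
Proof. by case=> h1 h2 /triple_swap h3 /triple_swap h4 h5; split; rewrite // set3CA. Qed.

Lemma quad_cv a b c v : quad a b c v -> quad a b v c.
Proof. by case=> h1 h2 h3 h4 /nesym h5; split. Qed.

Lemma quad_new a b c v : quad a b c v -> triple c v a.
Proof.
by move=> [_ _ [[Ba Bb Bc] [ab bc ac]] [[_ _ Bv] [_ bv av]] cv];
  do 2!split => //; exact: nesym.
Qed.

Lemma quad_coord a b c v : quad a b c v -> exists r s q : R,
  [/\ 0 < r, 0 < s, 0 < q & v = r *: a + s *: b - q *: c].
Proof. by case=> Pc Pv tc tv cv; exact: (opposite_vertex cc tP Pc Pv tc tv cv). Qed.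

Lemma quad_mul g a b c v : Gam g -> quad a b c v ->
  quad (g *m a) (g *m b) (g *m c) (g *m v).
Proof.
move=> Gg [Pc Pv tc tv cv]; split.
- by rewrite -image_set3; exact: (tr_inv tP).
- by rewrite -image_set3; exact: (tr_inv tP).
- exact: (triple_mul cc).
- exact: (triple_mul cc).
- by move=> e; apply: cv; rewrite -(mulVx cg c Gg) e (mulVx cg).
Qed.

(** The sign of [z1 - q * z2], the coordinate along [c], decides on which side of the old edge the
    point lies. *)
Lemma new_sub_old a b c v x : quad a b c v -> cone_hull [set c; v; a] x ->
  cone_hull [set a; b; c] x \/ cone_hull [set a; b; v] x.
Proof.
move=> qd; have [r [s [q [r0 s0 q0 ev]]]] := quad_coord qd.
move=> /cone_hull3[z1 [z2 [z3 [z10 z20 z30 ->]]]].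
have [h|h] := leP (q * z2) z1.
- left; apply/cone_hull3; exists (z2 * r + z3), (z2 * s), (z1 - q * z2).
  split; [by rewrite addr_ge0 // mulr_ge0 // ltW|by rewrite mulr_ge0 // ltW|lra|].
  by rewrite ev; vring.
- right; apply/cone_hull3; exists (z1 / q * r + z3), (z1 / q * s), (z2 - z1 / q).
  have z1q : 0 <= z1 / q by rewrite divr_ge0 // ltW.
  split; [by rewrite addr_ge0 // mulr_ge0 // ltW|by rewrite mulr_ge0 // ltW| |].
    by rewrite subr_ge0 ler_pdivrMr // mulrC ltW.
  have -> : c = q^-1 *: (r *: a + s *: b - v).
    by rewrite ev; apply/colP => i; rewrite !mxE; field; rewrite gt_eqF.
  by vring.
Qed.

(** Comparing [z1 * s] with [z2 * r] decides on which side of the plane of [c] and [v] the point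
    lies. *)
Lemma old_sub_new a b c v x : quad a b c v -> cone_hull [set a; b; c] x ->
  cone_hull [set c; v; a] x \/ cone_hull [set c; v; b] x.
Proof.
move=> qd; have [r [s [q [r0 s0 q0 ev]]]] := quad_coord qd.
move=> /cone_hull3[z1 [z2 [z3 [z10 z20 z30 ->]]]].
have [h|h] := leP (z1 * s) (z2 * r); [right|left]; apply/cone_hull3.
- exists (z1 / r * q + z3), (z1 / r), (z2 - z1 / r * s).
  have z1r : 0 <= z1 / r by rewrite divr_ge0 // ltW.
  split => //; first by rewrite addr_ge0 // mulr_ge0 // ltW.
    by rewrite subr_ge0 mulrAC ler_pdivrMr.
  by rewrite ev; apply/colP => i; rewrite !mxE; field; rewrite gt_eqF.
- exists (z2 / s * q + z3), (z2 / s), (z1 - z2 / s * r).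
  have z1r : 0 <= z2 / s by rewrite divr_ge0 // ltW.
  split => //; first by rewrite addr_ge0 // mulr_ge0 // ltW.
    by rewrite subr_ge0 mulrAC ler_pdivrMr // ltW.
  by rewrite ev; apply/colP => i; rewrite !mxE; field; rewrite gt_eqF.
Qed.

Lemma new_meet a b c v x : quad a b c v -> cone_hull [set c; v; a] x ->
  cone_hull [set c; v; b] x -> cone_hull [set c; v] x.
Proof.
move=> qd; have [r [s [q [r0 s0 q0 ev]]]] := quad_coord qd.
move=> /cone_hull3[z1 [z2 [z3 [z10 z20 z30 ->]]]].
move=> /cone_hull3[y1 [y2 [y3 [y10 y20 y30 e]]]].
have : (z2 * r + z3) *: a + (z2 * s) *: b + (z1 - z2 * q) *: c =
   (y2 * r) *: a + (y2 * s + y3) *: b + (y1 - y2 * q) *: c.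
  transitivity (z1 *: c + z2 *: v + z3 *: a); first by rewrite ev; vring.
  by rewrite e ev; vring.
case/(coord_inj (triple_det3 cc (qd_tc qd))) => e1 e2 _.
have z3E : z3 = (y2 - z2) * r by lra.
have y3E : y3 = (z2 - y2) * s by lra.
have yz : y2 = z2.
  apply/eqP; rewrite eq_le -subr_ge0 -[X in _ && X]subr_ge0.
  by rewrite -(pmulr_lge0 _ s0) -y3E y30 -(pmulr_lge0 _ r0) -z3E z30.
apply/cone_hull2; exists z1, z2; split => //.
by rewrite z3E yz subrr mul0r scale0r addr0.
Qed.

(** The carrier of [x] in an old face is neither that whole face, nor the edge [a b], which already
    has its two faces, nor the edge from [b] to [c] or [v], which the new face meets in a vertex ray
    only. An edge at [a] remains. *)
Lemma outer_edge a b c v t x : quad a b c v -> K x -> cone_hull [set c; v; a] x ->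
  P t -> cone_hull t x -> t <> [set a; b; c] -> t <> [set a; b; v] ->
  exists y k k', [/\ y = c \/ y = v, t y, t a &
    [/\ (0 : R) < k, (0 : R) < k' & x = k *: y + k' *: a]].
Proof.
move=> qd Kx nx Pt tx tc tv.
suff key c1 v1 : quad a b c1 v1 -> cone_hull [set c1; v1; a] x ->
    t <> [set a; b; c1] -> t <> [set a; b; v1] -> cone_hull [set a; b; c1] x ->
    exists k k', [/\ t c1, t a &
    [/\ (0 : R) < k, (0 : R) < k' & x = k *: c1 + k' *: a]].
  case: (new_sub_old qd nx) => h.
  - have [k [k' [h1 h2 h3]]] := key c v qd nx tc tv h.
    by exists c, k, k'; split => //; left.
  - have nx' : cone_hull [set v; c; a] x by rewrite set3CA.
    have [k [k' [h1 h2 h3]]] := key v c (quad_cv qd) nx' tv tc h.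
    by exists v, k, k'; split => //; right.
move=> {qd nx tc tv} qd nx tc tv /cone_hull3 [x1 [x2 [x3 [x10 x20 x30 ex]]]].
have [Pc Pv vc vv cv] := qd; have [_ [ab _ _]] := vc.
have ex2 : x = x2 *: b + x3 *: c1 + x1 *: a by rewrite ex; vring.
have ex3 : x = x3 *: c1 + x1 *: a + x2 *: b by rewrite ex; vring.
have Pc2 := Pc; rewrite set3_rot in Pc2; have Pc3 := Pc2; rewrite set3_rot in Pc3.
have vc2 := triple_rot vc; have vc3 := triple_rot vc2.
have ta (h : 0 < x1) := carrier_vertex cc tP Pc vc Pt Kx tx h x20 x30 ex.
have tb (h : 0 < x2) := carrier_vertex cc tP Pc2 vc2 Pt Kx tx h x30 x10 ex2.
have tc' (h : 0 < x3) := carrier_vertex cc tP Pc3 vc3 Pt Kx tx h x10 x20 ex3.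
case: (triple_coord_pos cc vc Kx x10 x20 x30 ex) => -[h1 h2 h3].
- case: tc; apply: (triple_sub (tr_face tP Pt) vc); auto.
- exfalso; have [w vw ew] := triple_with (tr_face tP Pt) (ta h1) (tb h2) ab.
  apply: tv; rewrite ew in Pt *.
  rewrite (edge_two_faces cc tP Pc Pv Pt vc vv vw cv) // => cw.
  by apply: tc; rewrite ew cw.
- exfalso; have [r [s [q [r0 s0 q0 ev]]]] := quad_coord qd.
  move: nx => /cone_hull3[z1 [z2 [z3 [z10 z20 z30 e]]]].
  have : (z2 * r + z3) *: a + (z2 * s) *: b + (z1 - z2 * q) *: c1 =
      x1 *: a + x2 *: b + x3 *: c1.
    by rewrite -ex e ev; vring.
  case/(coord_inj (triple_det3 cc vc)); rewrite h3 => e1 e2 _.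
  have z2r : 0 <= z2 * r by rewrite mulr_ge0 // ltW.
  have z2E : z2 = 0 by apply: (mulIf (lt0r_neq0 r0)); lra.
  by move: h1; rewrite -e2 z2E mul0r ltxx.
- by exists x3, x1; split; auto; split => //; rewrite ex h3 scale0r addr0 addrC.
Qed.

End Quad.

Lemma face_edge_subset u y a x (S : set V) (k k' : R) :
  (exists a b c, triple a b c /\ u = [set a; b; c]) -> u y -> u a -> y <> a ->
  S `<=` u -> cone_hull S x -> 0 < k -> x = k *: y + k' *: a -> S y.
Proof.
move=> fu uy ua ya Su Sx k0 ex; apply: contrapT => nSy.
have [z vz eu] := triple_with fu uy ua ya.
have [f [fy fa fz]] := form_exists 1 0 0 (triple_det3 cc vz).
have : lform f x = lform 0 x.
  apply: (cone_hull_form_eq _ Sx) => p Sp.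
  rewrite [RHS]/lform mul0mx mxE; move: (Su _ Sp); rewrite eu.
  by case=> [[]|] ep; rewrite ep // in Sp *; case: nSy.
by rewrite {1}ex !lformE fy fa /lform mul0mx mxE; lra.
Qed.

Section FlipStep.
Variable P : set (set V).
Hypothesis tP : triangulation P.
Variables a b c v : V.
Hypothesis qd : quad P a b c v.
Hypothesis unfolded : forall g, Gam g -> mulmx g @` [set a; b; c] <> [set a; b; v].

Definition flipped : set (set V) :=
  P `\` (gamma_class Gam [set a; b; c] `|` gamma_class Gam [set a; b; v])
    `|` (gamma_class Gam [set c; v; a] `|` gamma_class Gam [set c; b; v]).

(* The two faces of a translate of the quadrilateral are exchanged, and so are
   the two ends of the removed edge, so that only one new face per translate has
   to be considered. *)
Definition translate g a1 b1 c1 v1 : Prop := Gam g /\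
  [\/ [/\ a1 = g *m a, b1 = g *m b, c1 = g *m c & v1 = g *m v] |
      [/\ a1 = g *m b, b1 = g *m a, c1 = g *m c & v1 = g *m v]].

Lemma translate_quad g a1 b1 c1 v1 : translate g a1 b1 c1 v1 -> quad P a1 b1 c1 v1.
Proof.
by move=> [Gg [[-> -> -> ->]|[-> -> -> ->]]]; [|apply: quad_ab];
  exact: (quad_mul tP).
Qed.

Lemma translate_olds g a1 b1 c1 v1 : translate g a1 b1 c1 v1 ->
  [set a1; b1; c1] = mulmx g @` [set a; b; c] /\
  [set a1; b1; v1] = mulmx g @` [set a; b; v].
Proof.
by move=> [_ [[-> -> -> ->]|[-> -> -> ->]]]; rewrite !image_set3;
  [|rewrite ![[set g *m b; _; _]]set3CA].
Qed.

Definition new_face t : Prop := exists g a1 b1 c1 v1,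
  translate g a1 b1 c1 v1 /\ t = [set c1; v1; a1].

Definition old_face t : Prop := P t /\ forall g, Gam g ->
  t <> mulmx g @` [set a; b; c] /\ t <> mulmx g @` [set a; b; v].

Lemma flippedP t : flipped t <-> old_face t \/ new_face t.
Proof.
split.
- move=> [[Pt nt]|[[g Gg <-]|[g Gg <-]]].
  + left; split => // g Gg; split => e; apply: nt; [left|right]; by exists g.
  + right; exists g, (g *m a), (g *m b), (g *m c), (g *m v).
    by rewrite image_set3; split => //; split => //; left.
  + right; exists g, (g *m b), (g *m a), (g *m c), (g *m v).
    by rewrite image_set3 set3AC; split => //; split => //; right.
- move=> [[Pt nt]|[g [a1 [b1 [c1 [v1 [[Gg h] ->]]]]]]].
  + by left; split => // -[[g Gg e]|[g Gg e]]; have [h1 h2] := nt g Gg; auto.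
  + right; case: h => -[-> _ -> ->]; [left|right]; exists g => //.
      by rewrite image_set3.
    by rewrite image_set3 set3AC.
Qed.

Lemma removedP t : P t -> ~ old_face t -> exists g a1 b1 c1 v1,
  translate g a1 b1 c1 v1 /\ (t = [set a1; b1; c1] \/ t = [set a1; b1; v1]).
Proof.
move=> Pt nt; apply: contrapT => h; apply: nt; split=> // g Gg; split=> e; apply: h;
  exists g, (g *m a), (g *m b), (g *m c), (g *m v); rewrite e !image_set3;
  (split; first by split => //; left); auto.
Qed.

(** Faces of the same kind are told apart by freeness, faces of different kinds by [unfolded]; so
    distinct translates of the quadrilateral share no face. *)
Lemma olds_distinct g h : Gam g -> Gam h -> g <> h ->
  [/\ mulmx g @` [set a; b; c] <> mulmx h @` [set a; b; c],
      mulmx g @` [set a; b; v] <> mulmx h @` [set a; b; v],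
      mulmx g @` [set a; b; c] <> mulmx h @` [set a; b; v] &
      mulmx g @` [set a; b; v] <> mulmx h @` [set a; b; c]].
Proof.
move=> Gg Gh gh; split.
- by move/(triple_stabilizer cc (qd_tc qd) Gg Gh).
- by move/(triple_stabilizer cc (qd_tv qd) Gg Gh).
- move=> e; apply: (unfolded (g := invmx h *m g)).
    by apply: (GamM cg) => //; exact: (GamV cg).
  by rewrite -(Gam_image_mul _ g) e (Gam_image_inv cc).
- move=> e; apply: (unfolded (g := invmx g *m h)).
    by apply: (GamM cg) => //; exact: (GamV cg).
  by rewrite -(Gam_image_mul _ h) -e (Gam_image_inv cc).
Qed.

Lemma outer_edge_sub g a1 b1 c1 v1 t x : translate g a1 b1 c1 v1 -> K x ->
  cone_hull [set c1; v1; a1] x -> P t -> cone_hull t x ->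
  t <> mulmx g @` [set a; b; c] -> t <> mulmx g @` [set a; b; v] ->
  exists y k k', [/\ [set c1; v1; a1] y, t y, t a1, y <> a1 &
    [/\ (0 : R) < k, (0 : R) < k' & x = k *: y + k' *: a1]].
Proof.
move=> tr Kx nx Pt tx; have [<- <-] := translate_olds tr => n1 n2.
have qd1 := translate_quad tr.
have [y [k [k' [hy ty ta h]]]] := outer_edge tP qd1 Kx nx Pt tx n1 n2.
have [_ [_ va ca]] := quad_new qd1.
by exists y, k, k'; split => //; case: hy => -> //; left; [left|right].
Qed.

(** Within one translate the two halves meet along the new diagonal. For two translates, [x] lies in
    an old face of each, foreign to the other, hence on an outer edge of both; two edges with a
    common interior point have the same ends. *)
Lemma new_new_meet t t' x : new_face t -> new_face t' -> K x -> cone_hull t x ->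
  cone_hull t' x -> cone_hull (t `&` t') x.
Proof.
move=> [g [a1 [b1 [c1 [v1 [tr ->]]]]]] [h [a2 [b2 [c2 [v2 [tr' ->]]]]]] Kx nx nx'.
have [Gg hg] := tr; have [Gh hh] := tr'.
have [gh|gh] := pselect (g = h).
  rewrite -{}gh in hh tr' Gh.
  have [ea|ea] := pselect (a1 = a2).
    have [-> ->] : c1 = c2 /\ v1 = v2.
      by case: hg => -[_ _ -> ->]; case: hh => -[_ _ -> ->].
    by rewrite ea setIid.
  have [eb ec ev] : [/\ b1 = a2, c1 = c2 & v1 = v2].
    by case: hg => -[? ? ? ?]; case: hh => -[? ? ? ?]; subst.
  have := new_meet tP (translate_quad tr) nx.
  rewrite eb ec ev => /(_ nx'); apply: cone_hull_mono => y h'.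
  by split; left.
have [dd1 dd2 dd3 dd4] := olds_distinct Gg Gh gh.
have [ec ev] := translate_olds tr; have [ec' ev'] := translate_olds tr'.
have [Pc Pv _ _ _] := translate_quad tr.
have [Pc' Pv' _ _ _] := translate_quad tr'.
have [u [Pu ux n1 n2]] : exists u, [/\ P u, cone_hull u x,
    u <> mulmx h @` [set a; b; c] & u <> mulmx h @` [set a; b; v]].
  case: (new_sub_old tP (translate_quad tr) nx) => ux.
  - by exists [set a1; b1; c1]; rewrite {3 4}ec.
  - by exists [set a1; b1; v1]; rewrite {3 4}ev.
have [u' [Pu' ux' n1' n2']] : exists u, [/\ P u, cone_hull u x,
    u <> mulmx g @` [set a; b; c] & u <> mulmx g @` [set a; b; v]].
  case: (new_sub_old tP (translate_quad tr') nx') => ux'.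
  - by exists [set a2; b2; c2]; rewrite {3 4}ec'; split => //; exact/nesym.
  - by exists [set a2; b2; v2]; rewrite {3 4}ev'; split => //; exact/nesym.
have [y [k [k' [hy ty ta ya [k0 k0' ex]]]]] := outer_edge_sub tr Kx nx Pu' ux' n1' n2'.
have [y' [q [q' [hy' ty' ta' ya' [q0 q0' ex']]]]] :=
  outer_edge_sub tr' Kx nx' Pu ux n1 n2.
have cS : cone_hull [set y'; a2] x.
  by apply/cone_hull2; exists q, q'; rewrite !ltW.
have [z vz eu] := triple_with (tr_face tP Pu) ty' ta' ya'.
have Su' : [set y'; a2] `<=` u'.
  have Pu2 := Pu; rewrite eu in Pu2.
  have Pu3 := Pu2; rewrite set3CA in Pu3.
  move=> p [->|->].
  - apply: (carrier_vertex cc tP Pu2 vz Pu' Kx ux' q0 (ltW q0') (lexx 0)).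
    by rewrite scale0r addr0.
  - apply: (carrier_vertex cc tP Pu3 (triple_swap vz) Pu' Kx ux' q0' (ltW q0) (lexx 0)).
    by rewrite scale0r addr0 addrC.
have sub : [set y'; a2] `<=` [set c2; v2; a2] by move=> p [->|->] //; right.
have fu' := tr_face tP Pu'.
apply: (@cone_hull_mono _ [set y; a1]); last first.
  by apply/cone_hull2; exists k, k'; rewrite !ltW.
move=> p [->|->]; split => //; [|by right|]; apply: sub.
- exact: (face_edge_subset fu' ty ta ya Su' cS k0 ex).
- by apply: (face_edge_subset (k := k') (k' := k) fu' ta ty (nesym ya) Su' cS k0');
    rewrite addrC.
Qed.

Lemma old_new_meet t t' x : old_face t -> new_face t' -> K x -> cone_hull t x ->
  cone_hull t' x -> cone_hull (t `&` t') x.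
Proof.
move=> [Pt nt] [h [a2 [b2 [c2 [v2 [tr ->]]]]]] Kx tx nx.
have [n1 n2] := nt h (proj1 tr).
have [y [k [k' [hy ty ta ya [k0 k0' ex]]]]] := outer_edge_sub tr Kx nx Pt tx n1 n2.
apply: (@cone_hull_mono _ [set y; a2]); last first.
  by apply/cone_hull2; exists k, k'; rewrite !ltW.
by move=> p [->|->]; split => //; right.
Qed.

(** A point of [K] is never on a vertex ray, so distinct faces through it are the two faces of one
    edge. *)
Lemma faces_at_point x : K x -> exists t1 t2, forall t, P t -> cone_hull t x ->
  t = t1 \/ t = t2.
Proof.
move=> Kx; have [t1 Pt1 t1x] := tr_cover tP Kx.
have [[t2 [Pt2 t2x t12]]|h] :=
    pselect (exists t2, [/\ P t2, cone_hull t2 x & t1 <> t2]); last first.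
  by exists t1, t1 => t Pt tx; left; apply: contrapT => e; apply: h; exists t;
    split => //; exact: nesym.
exists t1, t2 => t Pt tx; have [->|tt1] := pselect (t = t1); [by left|right].
have [a1 [b1 [c1 [v1 [r [s [[e1 e2 cv vc vv] [r0 s0 ex]]]]]]]] :=
  common_edge cc tP Pt1 Pt2 t12 Kx t1x t2x.
rewrite e1 e2 in Pt1 Pt2 t12 tt1 *; have [_ [ab _ _]] := vc.
have ta : t a1.
  apply: (carrier_vertex cc tP Pt1 vc Pt Kx tx r0 (ltW s0) (lexx 0)).
  by rewrite scale0r addr0.
have tb : t b1.
  have Pt1' := Pt1; rewrite set3CA in Pt1'.
  apply: (carrier_vertex cc tP Pt1' (triple_swap vc) Pt Kx tx s0 (ltW r0) (lexx 0)).
  by rewrite scale0r addr0 addrC.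
have [w vw ew] := triple_with (tr_face tP Pt) ta tb ab.
rewrite ew in Pt *; rewrite (edge_two_faces cc tP Pt1 Pt2 Pt vc vv vw cv) // => cw.
by apply: tt1; rewrite ew cw.
Qed.

Lemma closed_near0 y z w x v0 : triple y z w -> near0 (fun s =>
  cone_hull [set y; z; w] (x + s *: v0) -> cone_hull [set y; z; w] x).
Proof.
move=> vt; have [h|h] := pselect (cone_hull [set y; z; w] x).
  exact: near0_all.
have [e e0 he] := cone_hull3_closed v0 (triple_det3 cc vt) h.
by exists e => // s /he.
Qed.

Lemma flipped_locfin x v0 : K x -> near0 (fun s => forall t,
  flipped t -> cone_hull t (x + s *: v0) -> cone_hull t x).
Proof.
move=> Kx; have [t1 [t2 H]] := faces_at_point Kx.
(* A new face met near [x] overlaps there an old face [u] through [x]; [Q u] is the claim for the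
   new faces of the translate that owns [u]. Only one translate can own [u], so two closed cones are
   involved for each of [t1] and [t2]. *)
pose Q u s := forall g, Gam g ->
  (mulmx g @` [set a; b; c] = u \/ mulmx g @` [set a; b; v] = u) ->
  (cone_hull [set g *m c; g *m v; g *m a] (x + s *: v0) ->
   cone_hull [set g *m c; g *m v; g *m a] x) /\
  (cone_hull [set g *m c; g *m v; g *m b] (x + s *: v0) ->
   cone_hull [set g *m c; g *m v; g *m b] x).
have nQ u : near0 (Q u).
  have [[h [Gh hu]]|nh] := pselect (exists h, Gam h /\
      (mulmx h @` [set a; b; c] = u \/ mulmx h @` [set a; b; v] = u)).
    have qh := quad_mul tP Gh qd.
    have := near0_and (closed_near0 x v0 (quad_new qh))
      (closed_near0 x v0 (quad_new (quad_ab qh))).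
    apply: near0_imp => s hs g Gg hg; suff -> : g = h by [].
    apply: contrapT => gh; have [dd1 dd2 dd3 dd4] := olds_distinct Gg Gh gh.
    by case: hu hg => <- [].
  by apply: near0_all => s g Gg hg; case: nh; exists g.
have [e e0 he] := tr_locfin tP v0 Kx.
have nP : near0 (fun s => forall t, P t -> cone_hull t (x + s *: v0) -> cone_hull t x).
  by exists e => // s hs t Pt; exact: he.
have := near0_and nP (near0_and (nQ t1) (nQ t2)).
apply: near0_imp => s [hP [h1 h2]] t /flippedP[[Pt _]|]; first exact: hP.
move=> [g [a1 [b1 [c1 [v1 [tr et]]]]]]; rewrite {}et => tx.
have qd1 := translate_quad tr; have [ec ev] := translate_olds tr.
have [u [Pu ux hu]] : exists u, [/\ P u, cone_hull u (x + s *: v0) &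
    mulmx g @` [set a; b; c] = u \/ mulmx g @` [set a; b; v] = u].
  case: (new_sub_old tP qd1 tx) => h.
  - by exists [set a1; b1; c1]; split => //; [exact: qd_c qd1|left].
  - by exists [set a1; b1; v1]; split => //; [exact: qd_v qd1|right].
have Qu : Q u s by case: (H u Pu (hP u Pu ux)) => ->.
have [Gg hg] := tr; have [q1 q2] := Qu g Gg hu.
by case: hg tx => -[-> _ -> ->].
Qed.

Lemma flipped_triangulation : triangulation flipped.
Proof.
split.
- move=> t /flippedP[[Pt _]|]; first exact: (tr_face tP).
  move=> [g [a1 [b1 [c1 [v1 [tr ->]]]]]].
  by exists c1, v1, a1; split => //; exact: quad_new (translate_quad tr).
- move=> y By; have [t Pt ty] := tr_vertex tP By.
  have [ot|nt] := pselect (old_face t); first by exists t => //; apply/flippedP; left.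
  have [g [a1 [b1 [c1 [v1 [tr et]]]]]] := removedP Pt nt.
  have tr' : translate g b1 a1 c1 v1.
    by have [Gg hg] := tr; split => //; case: hg => -[-> -> -> ->]; [right|left].
  have n1 : flipped [set c1; v1; a1].
    by apply/flippedP; right; exists g, a1, b1, c1, v1.
  have n2 : flipped [set c1; v1; b1].
    by apply/flippedP; right; exists g, b1, a1, c1, v1.
  case: et => et; move: ty; rewrite et => -[[]|] ->.
  + by exists [set c1; v1; a1] => //; right.
  + by exists [set c1; v1; b1] => //; right.
  + by exists [set c1; v1; b1] => //; left; left.
  + by exists [set c1; v1; a1] => //; right.
  + by exists [set c1; v1; b1] => //; right.
  + by exists [set c1; v1; b1] => //; left; right.
- move=> g t Gg /flippedP[[Pt nt]|].
    apply/flippedP; left; split; first exact: (tr_inv tP).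
    move=> h Gh; have Gk : Gam (invmx g *m h).
      by apply: (GamM cg) => //; exact: (GamV cg).
    have [n1 n2] := nt _ Gk.
    by split=> e; [apply: n1|apply: n2];
      rewrite -(Gam_image_mul _ h) -e (Gam_image_inv cc).
  move=> [h [a1 [b1 [c1 [v1 [[Gh hh] ->]]]]]]; apply/flippedP; right.
  exists (g *m h), (g *m a1), (g *m b1), (g *m c1), (g *m v1).
  rewrite image_set3; split => //; split; first exact: (GamM cg).
  by case: hh => -[-> -> -> ->]; [left|right]; rewrite !mulmxA.
- move=> x Kx; have [t Pt tx] := tr_cover tP Kx.
  have [ot|nt] := pselect (old_face t); first by exists t => //; apply/flippedP; left.
  have [g [a1 [b1 [c1 [v1 [tr et]]]]]] := removedP Pt nt.
  have tr' : translate g b1 a1 c1 v1.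
    by have [Gg hg] := tr; split => //; case: hg => -[-> -> -> ->]; [right|left].
  have n1 : flipped [set c1; v1; a1].
    by apply/flippedP; right; exists g, a1, b1, c1, v1.
  have n2 : flipped [set c1; v1; b1].
    by apply/flippedP; right; exists g, b1, a1, c1, v1.
  have qd1 := translate_quad tr.
  case: et => et; rewrite et in tx.
  + by case: (old_sub_new tP qd1 tx) => h; [exists [set c1; v1; a1]|exists [set c1; v1; b1]].
  + by case: (old_sub_new tP (quad_cv qd1) tx); rewrite set3CA => h;
      [exists [set c1; v1; a1]|exists [set c1; v1; b1]].
- move=> t t' x /flippedP ft /flippedP ft' Kx tx t'x.
  case: ft ft' => [ot|nt] [ot'|nt'].
  + by case: ot ot' => Pt _ [Pt' _]; exact: (tr_meet tP).
  + exact: old_new_meet.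
  + by rewrite setIC; exact: old_new_meet.
  + exact: new_new_meet.
- by move=> x v0 Kx; have [e e0 he] := flipped_locfin v0 Kx; exists e => // s t hs;
    exact: he.
Qed.

End FlipStep.

Lemma edge_flip_triangulation P P' : triangulation P -> edge_flip Gam P P' ->
  triangulation P'.
Proof.
move=> tP [a [b [c [v [Pc Pv vc bel ->]]]]].
have [x [y [z [vt et]]]] := tr_face tP Pc; have tc := triple_of_eq vt et.
have [x' [y' [z' [vt' et']]]] := tr_face tP Pv; have tv := triple_of_eq vt' et'.
have cv : c <> v by move=> e; rewrite e eqxx in vc.
have qd : quad P a b c v by split.
have [r [s [q [r0 s0 q0 ev]]]] := quad_coord tP qd.
have d0 := triple_det3 cc tc.
have [f [fa fb fc]] := form_exists 1 1 1 d0.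
have fv : lform f v < 1 by apply/(belowP v d0 fa fb fc).
have low : r + s - q < 1 by move: fv; rewrite ev !lformE fa fb fc !mulr1.
apply: (flipped_triangulation tP qd).
exact: (flip_not_folded cc tc tv r0 s0 q0 ev low).
Qed.

End FlipTriangulation.

(** * Convexity *)

Section RealInduction.
Context (R : realType).

(** At the supremum of the initial segments on which [H] holds, the left clause carries [H] to the
    supremum and the right clause beyond it. *)
Lemma real_induction (H : R -> Prop) : H 0 ->
  (forall s, 0 <= s <= 1 -> exists2 e : R, 0 < e &
    (H s -> forall s', s <= s' < s + e -> s' <= 1 -> H s') /\
    (forall s', 0 <= s' -> s - e < s' < s -> H s' -> H s)) ->
  H 1.
Proof.
move=> H0 step.
pose A := [set s : R | 0 <= s <= 1 /\ forall s', 0 <= s' <= s -> H s'].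
have A0 : A 0.
  split; first by rewrite lexx ler01.
  by move=> s' /andP[h1 h2]; have -> : s' = 0 by lra.
have supA : has_sup A by split; [exists 0|exists 1 => s [/andP[]]].
have u0 : 0 <= sup A by apply: ub_le_sup => //; case: supA.
have u1 : sup A <= 1 by apply: sup_le_ub; [exists 0|move=> s [/andP[]]].
have [|e e0 [hr hl]] := step (sup A); first by rewrite u0 u1.
have below_sup s : 0 <= s -> s < sup A -> H s.
  move=> s0 su; have [|s' [_ As'] hs'] := @sup_adherent _ A (sup A - s) _ supA.
    by rewrite subr_gt0.
  by apply: As'; rewrite s0 /=; lra.
have Hu : H (sup A).
  have [s' Am hs'] := @sup_adherent _ A e e0 supA.
  have s'u : s' <= sup A by apply: ub_le_sup => //; case: supA.
  have [/andP[s'0 _] As'] := Am.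
  have Hs' : H s' by apply: As'; rewrite s'0 lexx.
  move: s'u; rewrite le_eqVlt => /orP[/eqP <- //|lt].
  by apply: (hl s') => //; rewrite hs'.
have Hbelow s : 0 <= s <= sup A -> H s.
  move=> /andP[s0]; rewrite le_eqVlt => /orP[/eqP -> //|]; exact: below_sup.
pose w := Num.min 1 (sup A + e / 2).
have Aw : A w.
  have w1 : w <= 1 by rewrite ge_min lexx.
  have we : w <= sup A + e / 2 by rewrite ge_min lexx orbT.
  split; first by rewrite w1 andbT le_min ler01 /=; lra.
  move=> s /andP[s0 sw]; have [su|us] := leP s (sup A).
    by apply: Hbelow; rewrite s0.
  by apply: hr => //; [rewrite ltW //=; lra|lra].
have wu : w <= sup A by apply: ub_le_sup => //; case: supA.
have [|] := leP 1 (sup A + e / 2).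
  move=> h; have w1 : w = 1 by apply/min_idPl.
  by case: Aw => _; apply; rewrite w1 ler01 lexx.
by move=> h; have : w = sup A + e / 2; [apply/min_idPr/ltW|lra].
Qed.

End RealInduction.

(** * Convex hulls by convex combinations *)

Section ConvexHull.
Context (R : realType).
Local Notation V := 'cV[R]_3.
Implicit Types (x y a b c p : V) (A S : set V).

Lemma convex_setE S : @convex_set R V S <->
  forall x y (s : R), 0 <= s <= 1 -> S x -> S y -> S (s *: x + (1 - s) *: y).
Proof.
split => [h x y s s01 Sx Sy|h x y s /set_mem Sx /set_mem Sy].
  have := h x y (Itv01 (proj1 (andP s01)) (proj2 (andP s01))).
  by rewrite !inE => /(_ Sx Sy).
by apply/mem_set; apply: (h x y s%:num) => //; rewrite ge0 le1.
Qed.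

Lemma convex_hull_convex A x y (s : R) : 0 <= s <= 1 ->
  convex_hull A x -> convex_hull A y -> convex_hull A (s *: x + (1 - s) *: y).
Proof.
move=> s01 hx hy S [cS AS]; move/convex_setE: (cS); apply => //.
- exact: hx.
- exact: hy.
Qed.

Lemma sub_convex_hull A : A `<=` convex_hull A.
Proof. by move=> x Ax S [_]; apply. Qed.

Lemma convex_hull_sub A S : @convex_set R V S -> A `<=` S -> convex_hull A `<=` S.
Proof. exact: smallest_sub. Qed.

Lemma convex_hull_mono A S : A `<=` S -> convex_hull A `<=` convex_hull S.
Proof.
move=> AS; apply: convex_hull_sub; last exact: subset_trans AS (@sub_convex_hull S).
by apply/convex_setE => x y s; exact: convex_hull_convex.
Qed.

Lemma convex_halfspace (f : 'rV[R]_3) (d : R) :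
  @convex_set R V [set x | d <= lform f x].
Proof.
apply/convex_setE => x y s /andP[s0 s1] /= hx hy.
by rewrite lformD !lformZ; nra.
Qed.

Lemma convex_hull3 a b c x : convex_hull [set a; b; c] x <->
  exists r s t : R, [/\ 0 <= r, 0 <= s, 0 <= t & r + s + t = 1 /\
    x = r *: a + s *: b + t *: c].
Proof.
split.
  apply: (@convex_hull_sub [set a; b; c] [set x | exists r s t : R,
    [/\ 0 <= r, 0 <= s, 0 <= t & r + s + t = 1 /\ x = r *: a + s *: b + t *: c]]).
    apply/convex_setE => y z q /andP[q0 q1]
      [r [s [t [r0 s0 t0 [e ->]]]]] [r' [s' [t' [r0' s0' t0' [e' ->]]]]].
    exists (q * r + (1 - q) * r'), (q * s + (1 - q) * s'), (q * t + (1 - q) * t').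
    split; [nra..|split].
      have -> : t = 1 - r - s by lra.
      have -> : t' = 1 - r' - s' by lra.
      by ring.
    by vring.
  move=> y [[]|] ->.
  - by exists 1, 0, 0; rewrite scale1r !scale0r !addr0; split.
  - by exists 0, 1, 0; rewrite scale1r !scale0r addr0 !add0r !addr0; split.
  - by exists 0, 0, 1; rewrite scale1r !scale0r !add0r; split.
move=> [r [s [t [r0 s0 t0 [e ->]]]]].
have ha : convex_hull [set a; b; c] a by apply: sub_convex_hull; left; left.
have hb : convex_hull [set a; b; c] b by apply: sub_convex_hull; left; right.
have hc : convex_hull [set a; b; c] c by apply: sub_convex_hull; right.
have [t1|t1] := eqVneq t 1.
  have [-> ->] : r = 0 /\ s = 0 by split; lra.
  by rewrite t1 !scale0r !add0r scale1r.
have t1' : 0 < 1 - t by move/eqP: t1 => t1; have := r0; have := s0; case: (ltgtP t 1); lra.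
have -> : r *: a + s *: b + t *: c = t *: c +
    (1 - t) *: ((r / (1 - t)) *: a + (1 - r / (1 - t)) *: b).
  have -> : s = 1 - t - r by lra.
  by apply/colP => i; rewrite !mxE; field; rewrite gt_eqF.
apply: convex_hull_convex => //; first by rewrite t0; lra.
apply: convex_hull_convex => //.
by apply/andP; split; [apply: divr_ge0 => //; exact: ltW|rewrite ler_pdivrMr //; lra].
Qed.

End ConvexHull.

(** * Heights of a polyhedron without admissible flips *)

Section Height.
Context (R : realType).
Local Notation V := 'cV[R]_3.
Implicit Types (a b c p x y z v w : V) (t : set V) (m g h : 'M[R]_3).
Variables (K D : set V) (l : 'rV[R]_3) (Gam : set 'M[R]_3) (B : set V).
Hypothesis cc : cusped_cone K D l Gam B.
Let sc := cc_cone cc.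
Let cg := cc_group cc.
Local Notation triple := (vertex_triple B).
Variable P : set (set V).
Hypothesis tP : triangulation K Gam B P.

(* The plane of a face [t] is where [height t] takes the value 1; [height t] is
   junk when no form is constantly 1 on [t]. *)
Definition height t : 'rV[R]_3 :=
  xget 0 [set f : 'rV[R]_3 | forall p, t p -> lform f p = 1].

Lemma height1 t p : P t -> t p -> lform (height t) p = 1.
Proof.
move=> Pt; have [a [b [c [vt et]]]] := tr_face tP Pt.
have [f [fa fb fc]] := form_exists 1 1 1 (triple_det3 cc vt).
have ft : [set f : 'rV[R]_3 | forall p, t p -> lform f p = 1] f.
  by move=> q; rewrite et => -[[]|] ->.
by have := xgetPex 0 (ex_intro _ f ft); apply.
Qed.

Lemma height_unique t f : P t -> (forall p, t p -> lform f p = 1) -> f = height t.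
Proof.
move=> Pt hf; have [a [b [c [vt et]]]] := tr_face tP Pt.
have [ta tb tc] : [/\ t a, t b & t c].
  by rewrite et; split; [left; left|left; right|right].
by apply: (form_basis_ext (triple_det3 cc vt)); rewrite hf // height1.
Qed.

Lemma height_mul g t : P t -> Gam g ->
  height (mulmx g @` t) = height t *m invmx g.
Proof.
move=> Pt Gg; apply/esym/height_unique; first exact: (tr_inv tP).
by move=> _ [p tp <-]; rewrite -lformM (mulVx cg) // height1.
Qed.

Lemma hull_cone t x : P t -> convex_hull t x <->
  cone_hull t x /\ lform (height t) x = 1.
Proof.
move=> Pt; have [a [b [c [vt et]]]] := tr_face tP Pt.
have [ha hb hc] : [/\ lform (height t) a = 1, lform (height t) b = 1 &
    lform (height t) c = 1].
  by split; apply: height1 => //; rewrite et; [left; left|left; right|right].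
move: ha hb hc; set f := height t => ha hb hc; rewrite et convex_hull3 cone_hull3.
split.
- move=> [r [s [q [r0 s0 q0 [e ->]]]]]; split; first by exists r, s, q.
  by rewrite !lformE ha hb hc !mulr1.
- move=> [[r [s [q [r0 s0 q0 ->]]]]]; rewrite !lformE ha hb hc !mulr1 => e.
  by exists r, s, q.
Qed.

Lemma face_sub_B t : P t -> t `<=` B.
Proof.
move=> Pt p; have [a [b [c [[[Ba Bb Bc] _] ->]]]] := tr_face tP Pt.
by case=> [[]|] ->.
Qed.

Lemma segment_K x y (s : R) : K x -> K y \/ D y -> 0 <= s < 1 -> K (x + s *: (y - x)).
Proof.
move=> Kx Ky /andP[s0 s1]; have -> : x + s *: (y - x) = (1 - s) *: x + s *: y by vring.
have K1 : K ((1 - s) *: x) by apply: (sc_scale sc) => //; lra.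
case: Ky => h; last exact: (KD_addZ sc).
move: s0; rewrite le0r => /orP[/eqP e|s0].
  by move: K1; rewrite e scale0r addr0.
by apply: (sc_add sc) => //; exact: (sc_scale sc).
Qed.

Section LocallyConvex.
Hypothesis no_flip : forall P', ~ edge_flip Gam P P'.

Lemma neighbour_above a b c v : P [set a; b; c] -> P [set a; b; v] -> triple a b c ->
  c <> v -> 1 <= lform (height [set a; b; c]) v.
Proof.
move=> Pc Pv vt cv; rewrite leNgt; apply/negP => low.
apply: (no_flip (P' := flipped Gam P a b c v)); exists a, b, c, v; split => //.
  by apply/eqP/nesym.
have h p : [set a; b; c] p -> lform (height [set a; b; c]) p = 1 by exact: height1.
have [ha hb hc] : [/\ lform (height [set a; b; c]) a = 1,
   lform (height [set a; b; c]) b = 1 & lform (height [set a; b; c]) c = 1].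
  by split; apply: h; [left; left|left; right|right].
exact/(belowP v (triple_det3 cc vt) ha hb hc).
Qed.

(** The two forms agree on the common edge, and the third vertex of [t'] is not below [t], as no
    flip is admissible. *)
Lemma touching_faces t t' x : P t -> P t' -> K x -> cone_hull t x -> cone_hull t' x ->
  lform (height t) x = lform (height t') x /\
  forall z, cone_hull t' z -> lform (height t') z <= lform (height t) z.
Proof.
move=> Pt Pt' Kx tx t'x; have [->|tt'] := pselect (t = t'); first by split.
have [a [b [c [v [r [s [[e1 e2 cv vc vv] [r0 s0 ex]]]]]]]] :=
  common_edge cc tP Pt Pt' tt' Kx tx t'x.
rewrite e1 e2 in Pt Pt' *.
have h1 p := height1 (p := p) Pt; have h2 p := height1 (p := p) Pt'.
split.
  by rewrite ex !lformE (h1 a) ?(h1 b) ?(h2 a) ?(h2 b) //; left; by [left|right].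
move=> z; apply: cone_hull_form_le => p hp; rewrite h2 //.
case: hp => [[]|] ->; [rewrite h1 //; left; by left|rewrite h1 //; left; by right|].
exact: neighbour_above.
Qed.

(** While a point moves from the centre of [f] to [y], the form of the face containing it, evaluated
    at the fixed point [y], can only drop. This is concavity, checked at the points where the face
    changes. *)
Lemma height_min f t y : P f -> P t -> K y -> cone_hull t y ->
  lform (height t) y <= lform (height f) y.
Proof.
move=> Pf Pt Ky ty; have [a [b [c [vf ef]]]] := tr_face tP Pf.
pose x : V := 1 *: a + 1 *: b + 1 *: c.
have Kx : K x by exact: (triple_inK cc vf).
pose X s := x + s *: (y - x).
have KX s : 0 <= s <= 1 -> K (X s).
  move=> /andP[s0]; rewrite le_eqVlt => /orP[/eqP ->|s1].
    by rewrite /X scale1r addrC subrK.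
  by apply: segment_K; [|left|rewrite s0].
have XX s s' : X s' = X s + (s' - s) *: (y - x) by rewrite /X; vring.
pose H s := forall t, P t -> cone_hull t (X s) ->
  lform (height t) y <= lform (height f) y.
suff H1 : H 1 by apply: H1 => //; rewrite /X scale1r addrC subrK.
apply: real_induction.
- move=> t' Pt'; rewrite /X scale0r addr0 => t'x.
  have Pf1 := Pf; rewrite ef in Pf1.
  have Pf2 := Pf1; rewrite set3_rot in Pf2; have Pf3 := Pf2; rewrite set3_rot in Pf3.
  have vf2 := triple_rot vf; have vf3 := triple_rot vf2.
  have -> // : t' = f.
  rewrite ef; apply: (triple_sub (tr_face tP Pt') vf).
  + by apply: (carrier_vertex cc tP Pf1 vf Pt' Kx t'x (q := 1) (r := 1) (s := 1)).
  + apply: (carrier_vertex cc tP Pf2 vf2 Pt' Kx t'x (q := 1) (r := 1) (s := 1)) => //.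
    by rewrite /x; vring.
  + apply: (carrier_vertex cc tP Pf3 vf3 Pt' Kx t'x (q := 1) (r := 1) (s := 1)) => //.
    by rewrite /x; vring.
move=> s s01; have [e e0 he] := tr_locfin tP (y - x) (KX s s01).
exists e => //; split.
- move=> Hs s' /andP[h1 h2] s'1 t' Pt' t'x; apply: (Hs _ Pt').
  apply: (he (s' - s) t') => //; last by rewrite -XX.
  by rewrite ger0_norm; lra.
- move=> s' s'0 /andP[h1 h2] Hs' t' Pt' t'x.
  have s'01 : 0 <= s' <= 1 by rewrite s'0 /=; move: s01 => /andP[]; lra.
  have [t'' Pt'' t''x] := tr_cover tP (KX s' s'01).
  apply: le_trans (Hs' _ Pt'' t''x).
  have t''s : cone_hull t'' (X s).
    apply: (he (s' - s) t'') => //; last by rewrite -XX.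
    by rewrite ltr0_norm; lra.
  have [e1 /(_ _ t''x)] := touching_faces Pt' Pt'' (KX s s01) t'x t''s.
  have q1 f0 : lform f0 (X s') = lform f0 (X s) + (s' - s) * lform f0 (y - x).
    by rewrite {1}(XX s s') lformD lformZ.
  have q2 f0 : lform f0 y = lform f0 (X s) + (1 - s) * lform f0 (y - x).
    by rewrite -lformZ -lformD -XX /X scale1r addrC subrK.
  rewrite !q1 !q2 e1 !lerD2l => h.
  (* As [s' < s], the comparison of values at [X s'] turns into the reverse comparison of slopes. *)
  have : lform (height t'') (y - x) >= lform (height t') (y - x) by nra.
  by apply: ler_wpM2l; move: s01 => /andP[]; lra.
Qed.

Lemma height_vertex t w : P t -> B w -> 1 <= lform (height t) w.
Proof.
move=> Pt Bw; have [t' Pt' t'w] := tr_vertex tP Bw.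
have [a [b [c [vt et]]]] := tr_face tP Pt'.
have [p [q [vw ew]]] : exists p q, triple w p q /\ t' = [set w; p; q].
  move: t'w; rewrite et => -[[]|] ->.
  - by exists b, c.
  - by exists c, a; split; [exact: (triple_rot vt)|exact: set3_rot].
  - by exists a, b; split; [exact: (triple_rot (triple_rot vt))|exact/esym/set3_rot].
rewrite leNgt; apply/negP => low.
(* [height_min] does not apply at [w], which is outside [K]. At [w + (e / 2) (p + q)] the form of
   [t'] equals [1 + e], and if [height t] were below 1 at [w], it would be below [1 + e] there for
   small [e]. *)
have [|e e0 he] := @affine_neg _ (lform (height t) w - 1)
  (lform (height t) p + lform (height t) q - 2); first lra.
have := he (e / 2); rewrite gtr0_norm; last lra.
have -> : e / 2 < e by lra.
move=> /(_ isT); pose y := 1 *: w + (e / 2) *: p + (e / 2) *: q.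
have Ky : K y by apply: (triple_inK cc vw) => //; lra.
have t'y : cone_hull t' y.
  by rewrite ew; apply/cone_hull3; exists 1, (e / 2), (e / 2); split => //; lra.
have := height_min Pt Pt' Ky t'y.
have hp r : t' r -> lform (height t') r = 1 by exact: height1.
rewrite /y !lformE !hp; first lra.
- by rewrite ew; right.
- by rewrite ew; left; right.
- by rewrite ew; left; left.
Qed.

Local Notation C := (convex_hull B).

Lemma height_hull t x : P t -> C x -> 1 <= lform (height t) x.
Proof.
move=> Pt; apply: (convex_hull_sub (@convex_halfspace _ _ _)) => w.
exact: height_vertex.
Qed.

Lemma K_or_B_add x y : K x \/ B x -> K y \/ B y -> x <> y -> K (x + y).
Proof.
move=> [Kx|Bx] [Ky|By] xy.
- exact: (sc_add sc).
- by apply: (sc_addD sc) => //; exact: (cc_BD cc).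
- by rewrite addrC; apply: (sc_addD sc) => //; exact: (cc_BD cc).
- by rewrite -[x]scale1r -[y]scale1r; apply: (edge_inK cc).
Qed.

Lemma hull_K_or_B x : C x -> K x \/ B x.
Proof.
apply: (@convex_hull_sub _ _ [set x | K x \/ B x]); last by move=> y; right.
apply/convex_setE => y z s /andP[s0 s1] /= hy hz.
have [->|yz] := pselect (y = z).
  by rewrite -scalerDl addrC subrK scale1r.
move: s0 s1; rewrite le0r => /orP[/eqP -> _|s0].
  by rewrite scale0r add0r subr0 scale1r.
rewrite le_eqVlt => /orP[/eqP ->|s1].
  by rewrite subrr scale0r addr0 scale1r.
left; case: hy hz => [Ky|By] [Kz|Bz].
- by apply: (sc_add sc); apply: (sc_scale sc) => //; lra.
- apply: (KD_addZ sc); [lra|exact: (sc_scale sc)|exact: (cc_BD cc)].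
- rewrite addrC; apply: (KD_addZ sc); [lra|apply: (sc_scale sc) => //; lra|].
  exact: (cc_BD cc).
- by apply: (edge_inK cc) => //; lra.
Qed.

Lemma contact_vertex t a b c (r s q : R) : P t -> B a -> B b -> B c ->
  0 <= r -> 0 <= s -> 0 <= q -> r + s + q = 1 ->
  lform (height t) (r *: a + s *: b + q *: c) = 1 -> 0 < r ->
  lform (height t) a = 1.
Proof.
move=> Pt Ba Bb Bc r0 s0 q0 e; rewrite !lformE => h rp.
have ha := height_vertex Pt Ba; have hb := height_vertex Pt Bb.
have hc := height_vertex Pt Bc.
apply/eqP; rewrite eq_le ha andbT leNgt; apply/negP => lt.
have h1 : 0 < r * (lform (height t) a - 1) by apply: mulr_gt0 => //; lra.
have h2 : 0 <= s * (lform (height t) b - 1) by apply: mulr_ge0 => //; lra.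
have h3 : 0 <= q * (lform (height t) c - 1) by apply: mulr_ge0 => //; lra.
lra.
Qed.

Lemma contact_height t t' x : P t -> P t' -> K x -> C x ->
  lform (height t) x = 1 -> cone_hull t' x -> lform (height t') x = 1.
Proof.
move=> Pt Pt' Kx Cx hx t'x; apply/eqP.
by rewrite eq_le height_hull // -[X in _ <= X]hx height_min.
Qed.

(** If [x] is interior to a face, the three vertices of that face are contact points. On an edge the
    chosen face may bend away from the plane of [t], so [x] is moved slightly towards a vertex of
    [t] off the plane through the edge and the origin; the face reached there still contains [x]. *)
Lemma contact_face_K t x : P t -> K x -> C x -> lform (height t) x = 1 ->
  exists t', [/\ P t', cone_hull t' x & height t' = height t].
Proof.
move=> Pt Kx Cx hx; have [t0 Pt0 t0x] := tr_cover tP Kx.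
have h0x := contact_height Pt Pt0 Kx Cx hx t0x.
have on_edge a b c r s : P [set a; b; c] -> triple a b c -> 0 < r -> 0 < s ->
    x = r *: a + s *: b ->
    exists t', [/\ P t', cone_hull t' x & height t' = height t].
  move=> Pabc vt r0 s0 ex; have [[Ba Bb Bc] [ab bc ac]] := vt.
  have ex' : x = r *: a + s *: b + 0 *: c by rewrite scale0r addr0.
  have cx : cone_hull [set a; b; c] x.
    by apply/cone_hull3; exists r, s, 0; split => //; exact: ltW.
  have hc := contact_height Pt Pabc Kx Cx hx cx.
  have hp p := height1 (p := p) Pabc.
  have [la lb] : lform (height [set a; b; c]) a = 1 /\
      lform (height [set a; b; c]) b = 1.
    by split; apply: hp; [left; left|left; right].
  have rs : r + s = 1 by move: hc; rewrite ex !lformE la lb !mulr1.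
  have ha : lform (height t) a = 1.
    apply: (@contact_vertex t a b c r s 0) => //; try exact: ltW.
    - by rewrite addr0.
    - by rewrite -ex'.
  have hb : lform (height t) b = 1.
    apply: (@contact_vertex t b a c s r 0) => //; try exact: ltW.
    - by rewrite addr0 addrC.
    - by rewrite [s *: b + _]addrC -ex'.
  have [f [fa fb fc]] := form_exists 0 0 1 (triple_det3 cc vt).
  have [w tw fw] : exists2 w, t w & lform f w != 0.
    apply: contrapT => nw; have [p [q [u [vtt ett]]]] := tr_face tP Pt.
    have f0 z : t z -> lform f z = lform 0 z.
      move=> tz; rewrite [RHS]/lform mul0mx mxE.
      by apply: contrapT => /eqP fz; apply: nw; exists z.
    have : f = 0.
      apply: (form_basis_ext (triple_det3 cc vtt)); apply: f0; rewrite ett.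
      + by left; left.
      + by left; right.
      + by right.
    by move=> f00; move: fc; rewrite f00 /lform mul0mx mxE; lra.
  have Bw := face_sub_B Pt tw.
  have [e e0 he] := tr_locfin tP (w - x) Kx.
  pose sg := Num.min e 1 / 2.
  have sg0 : 0 < sg by rewrite divr_gt0 // lt_min e0 ltr01.
  have sge : sg < e.
    have : Num.min e 1 <= e by rewrite ge_min lexx.
    by rewrite /sg; lra.
  have sg1 : sg < 1.
    have : Num.min e 1 <= 1 by rewrite ge_min lexx orbT.
    by rewrite /sg; lra.
  pose y := x + sg *: (w - x).
  have yE : y = sg *: w + (1 - sg) *: x by rewrite /y; vring.
  have Ky : K y.
    by apply: segment_K; [|right; exact: (cc_BD cc)|rewrite ltW].
  have Cy : C y.
    rewrite yE; apply: convex_hull_convex => //; first by rewrite !ltW.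
    exact: sub_convex_hull.
  have hy : lform (height t) y = 1.
    by rewrite yE !lformE hx (height1 Pt tw); ring.
  have [t1 Pt1 t1y] := tr_cover tP Ky.
  have h1y := contact_height Pt Pt1 Ky Cy hy t1y.
  have t1x : cone_hull t1 x.
    by apply: (he sg t1) => //; rewrite gtr0_norm.
  exists t1; split => //; apply/esym.
  have t1a : t1 a.
    exact: (carrier_vertex cc tP Pabc vt Pt1 Kx t1x r0 (ltW s0) (lexx 0) ex').
  have t1b : t1 b.
    have Pbac := Pabc; rewrite set3CA in Pbac.
    apply: (carrier_vertex cc tP Pbac (triple_swap vt) Pt1 Kx t1x s0 (ltW r0) (lexx 0)).
    by rewrite scale0r addr0 addrC.
  have [d vd ed] := triple_with (tr_face tP Pt1) t1a t1b ab.
  have [[_ _ Bd] _] := vd.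
  move: t1y; rewrite ed => /cone_hull3 [r' [s' [q' [r0' s0' q0' ey]]]].
  have h1 p := height1 (p := p) Pt1; rewrite ed in h1.
  have sum1 : r' + s' + q' = 1.
    move: h1y; rewrite ed ey !lformE !h1 ?mulr1 //.
    - by right.
    - by left; right.
    - by left; left.
  (* [f] vanishes on the edge but not at [y], so the third vertex has positive weight in the contact
     point [y] and is a contact point itself. *)
  have q0 : 0 < q'.
    rewrite lt_neqAle q0' andbT eq_sym; apply/eqP => q'0.
    move: fw; apply/negP; rewrite negbK.
    have : lform f y = 0 by rewrite ey q'0 !lformE fa fb !mulr0 mul0r !addr0.
    rewrite yE ex !lformE fa fb !mulr0 addr0 mulr0 addr0 => /eqP.
    by rewrite mulf_eq0 (gt_eqF sg0).
  have hd : lform (height t) d = 1.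
    apply: (@contact_vertex t d a b q' r' s') => //; first by rewrite -addrA addrC.
    by rewrite -addrA addrC -ey.
  by apply: height_unique; rewrite -?ed // => p; rewrite ed => -[[]|] ->.
have [a [b [c [vt et]]]] := tr_face tP Pt0.
have := t0x; rewrite {1}et => /cone_hull3 [r [s [q [r0 s0 q0 ex]]]].
have [[Ba Bb Bc] _] := vt.
case: (triple_coord_pos cc vt Kx r0 s0 q0 ex) => -[h1 h2 h3].
- have hp p := height1 (p := p) Pt0.
  have sum1 : r + s + q = 1.
    by move: h0x; rewrite ex !lformE !hp ?mulr1 // et; [right|left; right|left; left].
  exists t0; split => //; apply/esym/height_unique => // p; rewrite et => -[[]|] ->.
  + by apply: (@contact_vertex t a b c r s q) => //; rewrite -ex.
  + apply: (@contact_vertex t b a c s r q) => //; first by rewrite [s + r]addrC.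
    by rewrite [s *: b + _]addrC -ex.
  + apply: (@contact_vertex t c a b q r s) => //; first by rewrite -addrA addrC.
    by rewrite -addrA addrC -ex.
- apply: (on_edge a b c r s) => //; first by rewrite -et.
  by rewrite ex h3 scale0r addr0.
- apply: (on_edge b c a s q) => //; first by rewrite -set3_rot -et.
    exact: (triple_rot vt).
  by rewrite ex h3 scale0r add0r.
- apply: (on_edge c a b q r) => //; first by rewrite set3_rot -et.
    exact: (triple_rot (triple_rot vt)).
  by rewrite ex h3 scale0r addr0 addrC.
Qed.

End LocallyConvex.
End Height.

(** * Faces of the convex hull *)

Section PolygonalFaces.
Context (R : realType).
Local Notation V := 'cV[R]_3.
Implicit Types (a b c d p x y z v w : V) (t : set V) (m g h : 'M[R]_3).
Variables (K D : set V) (l : 'rV[R]_3) (Gam : set 'M[R]_3) (B : set V).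
Hypothesis cc : cusped_cone K D l Gam B.
Let sc := cc_cone cc.
Let cg := cc_group cc.
Local Notation triple := (vertex_triple B).
Variable P : set (set V).
Hypothesis tP : triangulation K Gam B P.

(* [f = 0] is the plane spanned by the edge [b d], which a face not incident to
   [b] cannot cross. *)
Lemma edge_barrier b d e t x w (f : 'rV[R]_3) : P [set b; d; e] -> triple b d e ->
  lform f b = 0 -> lform f d = 0 -> P t -> ~ t b -> K x -> cone_hull t x ->
  0 < lform f x -> t w -> 0 <= lform f w.
Proof.
move=> Pe vt fb fd Pt ntb Kx tx fx tw; rewrite leNgt; apply/negP => fw.
have [[Bb Bd _] _] := vt; have Dw := cc_BD cc (face_sub_B tP Pt tw).
pose ta := lform f x / (lform f x - lform f w).
have den : 0 < lform f x - lform f w by lra.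
have ta0 : 0 < ta by apply: divr_gt0.
have ta1 : ta < 1 by rewrite ltr_pdivrMr //; lra.
pose z := x + ta *: (w - x).
have Kz : K z.
  by apply: (segment_K cc) => //; [right|rewrite ltW].
have tz : cone_hull t z.
  have -> : z = (1 - ta) *: x + ta *: w by rewrite /z; vring.
  have [_ hD hZ] := cone_hull_cone t.
  by apply: (hD); apply: (hZ); rewrite ?subr_ge0 ?ltW //; exact: sub_cone_hull.
have fz : lform f z = 0.
  by rewrite /z !lformE /ta; field; rewrite gt_eqF.
have [al [be [ga ez]]] := basis_coord z (triple_det3 cc vt).
have [rr [ss [qq ex]]] := basis_coord x (triple_det3 cc vt).
have fe : lform f e != 0.
  by apply/eqP => fe; move: fx; rewrite ex !lformE fb fd fe !mulr0 !addr0 ltxx.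
have ga0 : ga = 0.
  apply/eqP; move: fz; rewrite ez !lformE fb fd !mulr0 !add0r => /eqP.
  by rewrite mulf_eq0 (negPf fe) orbF.
have [al0 be0] : 0 < al /\ 0 < be.
  apply: (K_span2 sc (cc_BD cc Bb) (cc_BD cc Bd) Kz).
  by rewrite ez ga0 scale0r addr0.
apply: ntb; apply: (carrier_vertex cc tP Pe vt Pt Kz tz al0 (ltW be0) (lexx 0)).
by rewrite ez ga0.
Qed.

Section LocallyConvex.
Hypothesis no_flip : forall P', ~ edge_flip Gam P P'.
Local Notation C := (convex_hull B).
Local Notation ht := (height).

(* Near the cusp [b] the surface is trapped between two edges at [b] given by a
   parabolic, so a face meeting the segment towards [b] close enough to [b] has
   [b] as a vertex. *)
Lemma contact_face_B t b : P t -> B b -> lform (ht t) b = 1 ->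
  exists t', [/\ P t', t' b & ht t' = ht t].
Proof.
move=> Pt Bb hb; have [t1 Pt1 t1b] := tr_vertex tP Bb.
have [c [e [vt et1]]] : exists c e, triple b c e /\ t1 = [set b; c; e].
  have [x [y [z [vt et]]]] := tr_face tP Pt1; move: t1b; rewrite et => -[[]|] ->.
  - by exists y, z.
  - by exists z, x; split; [exact: (triple_rot vt)|exact: set3_rot].
  - by exists x, y; split; [exact: (triple_rot (triple_rot vt))|exact/esym/set3_rot].
have [[_ Bc Be] [bc _ _]] := vt.
have [m [e2 [e3 [Gm pf]]]] := cc_parabolic cc Bb.
have [p1 [p2 [p3 [vp ep]]]] := tr_face tP Pt.
have [[Bp1 Bp2 Bp3] _] := vp.
pose y := 3^-1 *: p1 + 3^-1 *: p2 + 3^-1 *: p3.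
have i3 : (0 : R) < 3^-1 by lra.
have Ky : K y by apply: (triple_inK cc vp) => //; exact: ltW.
have ty : convex_hull t y.
  rewrite ep; apply/convex_hull3; exists 3^-1, 3^-1, 3^-1.
  by split; [exact: ltW..|split => //; lra].
have Cy : C y by apply: convex_hull_mono ty; exact: (face_sub_B tP).
have [_ hy] := (hull_cone cc tP y Pt).1 ty.
clearbody y.
have [g [g' [al [be [de [[Gg Gg' gb g'b] [d0 be0 de0 ey]]]]]]] :=
  cusp_sector sc cg Gm (cc_BD cc Bb) pf (cc_BD cc Bc) (B_nonprop cc Bb Bc bc) Ky.
have [f0 [f0b f0g f0g']] := form_exists 1 0 0 d0.
have [f1 [f1b f1g f1g']] := form_exists 0 1 0 d0.
have [f2 [f2b f2g f2g']] := form_exists 0 0 1 d0.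
(* The [b] coordinate of [y] may have any sign; close enough to [b] on the segment from [y] it is
   positive, and the point is inside the sector of [b] and the two translates of [c]. *)
have [ee ee0 hee] := affine_pos (lform f0 (y - b)) (ltr01 : (0 : R) < 1).
pose s := Num.min ee 1 / 2.
have s0 : 0 < s by rewrite divr_gt0 // lt_min ee0 ltr01.
have se : s < ee.
  have : Num.min ee 1 <= ee by rewrite ge_min lexx.
  by rewrite /s; lra.
have s1 : s < 1.
  have : Num.min ee 1 <= 1 by rewrite ge_min lexx orbT.
  by rewrite /s; lra.
pose x := s *: y + (1 - s) *: b.
have Kx : K x.
  by apply: (KD_addZ sc); [lra|exact: (sc_scale sc)|exact: (cc_BD cc)].
have Cx : C x.
  by apply: convex_hull_convex => //; [rewrite !ltW|exact: sub_convex_hull].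
have hx : lform (ht t) x = 1 by rewrite /x !lformE hy hb; ring.
have f0x : 0 < lform f0 x.
  have := hee s; rewrite gtr0_norm // => /(_ se).
  by rewrite /x !lformE f0b; lra.
have f1x : 0 < lform f1 x.
  by rewrite /x ey !lformE f1b f1g f1g' !mulr0 !add0r !addr0 mulr1 mulr_gt0.
have f2x : 0 < lform f2 x.
  by rewrite /x ey !lformE f2b f2g f2g' !mulr0 !add0r !addr0 mulr1 mulr_gt0.
have [t' [Pt' t'x et']] := contact_face_K cc tP no_flip Pt Kx Cx hx.
exists t'; split => //; apply: contrapT => nb.
have Pg : P [set b; g *m c; g *m e].
  by rewrite -{1}gb -image_set3 -et1; exact: (tr_inv tP).
have Pg' : P [set b; g' *m c; g' *m e].
  by rewrite -{1}g'b -image_set3 -et1; exact: (tr_inv tP).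
have vg : triple b (g *m c) (g *m e) by rewrite -{1}gb; exact: (triple_mul cc).
have vg' : triple b (g' *m c) (g' *m e) by rewrite -{1}g'b; exact: (triple_mul cc).
(* The two barriers give [f1, f2 >= 0] at every vertex [w] of [t']. With [f0 w > 0] as well, [w]
   would lie in [K] or on the ray of [b]; so [f0] is nonpositive on [t'], although it is positive at
   [x]. *)
have : lform f0 x <= lform 0 x; last by rewrite [X in _ <= X]/lform mul0mx mxE; lra.
apply: (cone_hull_form_le _ t'x) => w tw.
rewrite [X in _ <= X]/lform mul0mx mxE leNgt; apply/negP => f0w.
have f2w := edge_barrier Pg vg f2b f2g Pt' nb Kx t'x f2x tw.
have f1w := edge_barrier Pg' vg' f1b f1g' Pt' nb Kx t'x f1x tw.
have Bw := face_sub_B tP Pt' tw.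
have ew : w = lform f0 w *: b + lform f1 w *: (g *m c) + lform f2 w *: (g' *m c).
  have [q0 [q1 [q2 ->]]] := basis_coord w d0.
  rewrite !lformE f0b f0g f0g' f1b f1g f1g' f2b f2g f2g'.
  by rewrite !mulr0 !mulr1 !addr0 !add0r.
have Bgc : B (g *m c) by exact: (cc_inv cc).
have Bgc' : B (g' *m c) by exact: (cc_inv cc).
have [_ [bgc _ _]] := vg; have [_ [bgc' _ _]] := vg'.
have notK : ~ K w by apply: (sc_disjoint sc); exact: (cc_BD cc).
move: f1w; rewrite le0r => /orP[/eqP f1w|f1w]; last first.
  apply: notK; rewrite ew; apply: (KD_addZ sc) => //; last exact: (cc_BD cc).
  exact: (edge_inK cc).
move: f2w; rewrite le0r => /orP[/eqP f2w|f2w]; last first.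
  by apply: notK; rewrite ew f1w scale0r addr0; exact: (edge_inK cc).
have wb : w = lform f0 w *: b by rewrite {1}ew f1w f2w !scale0r !addr0.
by apply: nb; rewrite -(cc_ray cc Bb Bw wb).
Qed.

Lemma hull_height1 t t' x : P t -> P t' -> ht t' = ht t -> convex_hull t' x ->
  lform (ht t) x = 1.
Proof. by move=> Pt Pt' <- /(hull_cone cc tP x Pt')[]. Qed.

Lemma contact_union t : P t -> C `&` affine_plane (ht t) 1 =
  \bigcup_(t' in [set t' | P t' /\ ht t' = ht t]) convex_hull t'.
Proof.
move=> Pt; apply/seteqP; split => x.
- move=> [Cx hx]; case: (hull_K_or_B cc Cx) => h.
  + have [t' [Pt' t'x e]] := contact_face_K cc tP no_flip Pt h Cx hx.
    by exists t' => //; apply/(hull_cone cc tP x Pt'); rewrite e.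
  + have [t' [Pt' t'x e]] := contact_face_B Pt h hx.
    by exists t' => //; exact: sub_convex_hull.
- move=> [t' [Pt' e] t'x]; split.
  + by apply: convex_hull_mono t'x; exact: (face_sub_B tP).
  + exact: hull_height1 t'x.
Qed.

Lemma height_neq0 t : P t -> ht t != 0.
Proof.
move=> Pt; apply/eqP => h0; have [a [b [c [vt et]]]] := tr_face tP Pt.
have ta : t a by rewrite et; left; left.
have := height1 cc tP Pt ta; rewrite h0 /lform mul0mx mxE; lra.
Qed.

Lemma contact_polygonal t : P t -> polygonal_faces C (C `&` affine_plane (ht t) 1).
Proof.
move=> Pt; exists (ht t), 1; split => //; first exact: height_neq0.
- by move=> x; exact: (height_hull cc tP no_flip).
- move=> [p [u hl]]; have [a [b [c [vt et]]]] := tr_face tP Pt.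
  have on z : t z -> exists s : R, z = p + s *: u.
    move=> tz; have [|s _ <-] := hl z; last by exists s.
    split; last exact: (height1 cc tP).
    by apply: sub_convex_hull; exact: (face_sub_B tP Pt).
  have [q1 e1] : exists s : R, a = p + s *: u by apply: on; rewrite et; left; left.
  have [q2 e2] : exists s : R, b = p + s *: u by apply: on; rewrite et; left; right.
  have [q3 e3] : exists s : R, c = p + s *: u by apply: on; rewrite et; right.
  have := triple_det3 cc vt; rewrite e1 e2 e3 /det3 !mxE.
  by set X := (X in X != 0); have -> : X = 0; [rewrite /X; ring|rewrite eqxx].
Qed.

Lemma noncollinear_points (S : set V) : ~ collinear S -> exists a b c,
  [/\ S a, S b, S c & a <> b] /\ forall s : R, c <> a + s *: (b - a).
Proof.
move=> nc.
have [a Sa] : exists a, S a.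
  apply: contrapT => h; apply: nc; exists 0, 0 => x Sx; exfalso; apply: h.
  by exists x.
have [b Sb ab] : exists2 b, S b & a <> b.
  apply: contrapT => h; apply: nc; exists a, 0 => x Sx.
  exists 0 => //; rewrite scaler0 addr0; apply: contrapT => ax.
  by apply: h; exists x.
have [c Sc hc] : exists2 c, S c & forall s : R, c <> a + s *: (b - a).
  apply: contrapT => h; apply: nc; exists a, (b - a) => x Sx.
  apply: contrapT => hx; apply: h; exists x => // s e; apply: hx.
  by exists s.
by exists a, b, c.
Qed.

(** With [d <= 0] the form is negative somewhere in [K], hence at a vertex of some face, and a
    parabolic fixing that vertex makes [f] unbounded below on [B]. *)
Lemma support_level_pos (f : 'rV[R]_3) (d : R) x : f != 0 ->
  (forall y, C y -> d <= lform f y) -> K x -> lform f x = d -> 0 < d.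
Proof.
move=> fn0 hd Kx fx; rewrite ltNge; apply/negP => d0.
have [x' Kx' fx'] : exists2 x', K x' & lform f x' < 0.
  have [dn|dp] := ltP d 0; first by exists x; rewrite ?fx.
  have dz : d = 0 by lra.
  have [v fv] := lform_neq0 fn0.
  have [e e0 he] := sc_open sc v Kx.
  case: (ltgtP (lform f v) 0) => fv0; last by rewrite fv0 eqxx in fv.
  - exists (x + (e / 2) *: v); first by apply: he; rewrite gtr0_norm; lra.
    rewrite !lformE fx dz add0r nmulr_llt0 //; lra.
  - exists (x + (- (e / 2)) *: v); first by apply: he; rewrite ltr0_norm; lra.
    by rewrite !lformE fx dz add0r mulNr oppr_lt0 mulr_gt0 //; lra.
have [t Pt tx'] := tr_cover tP Kx'.
have [w tw fw] : exists2 w, t w & lform f w < 0.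
  apply: contrapT => h; have : 0 <= lform f x'.
    apply: (cone_hull_form_ge0 _ tx') => p tp; rewrite leNgt; apply/negP => fp.
    by apply: h; exists p.
  by rewrite leNgt fx'.
have Bw := face_sub_B tP Pt tw; have [c Bc cw] := cc_two cc Bw.
have [m [e2 [e3 [Gm pf]]]] := cc_parabolic cc Bw.
have [g Gg] := cusp_growth sc cg Gm (cc_BD cc Bw) pf (cc_BD cc Bc)
  (B_nonprop cc Bw Bc (nesym cw)) d fw.
by rewrite ltNge hd //; apply: sub_convex_hull; exact: (cc_inv cc).
Qed.

(** The barycentre [x] of three noncollinear contact points lies in [K]. Rescaled onto the face [t]
    of its cone it is a point of [C], so the support inequality bounds the height of [t] at [x] by
    1. As this height is at least 1 at the three points, it is 1 there, and [f] is [d] times it. *)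
Lemma polygonal_contact F : polygonal_faces C F ->
  exists2 t, P t & F = C `&` affine_plane (ht t) 1.
Proof.
move=> [f [d [fn0 hd -> nc]]].
have [a [b [c [[[Ca fa] [Cb fb] [Cc fc] ab] hc]]]] := noncollinear_points nc.
rewrite /affine_plane /= in fa fb fc.
pose x := 3^-1 *: ((a + b) + c).
have Kx : K x.
  apply: (sc_scale sc); first lra.
  have Kab : K (a + b) by apply: (K_or_B_add cc) => //; exact: (hull_K_or_B cc).
  by case: (hull_K_or_B cc Cc) => h; [exact: (sc_add sc)|
    apply: (sc_addD sc) => //; exact: (cc_BD cc)].
have lx f' : lform f' x = 3^-1 * (lform f' a + lform f' b + lform f' c).
  by rewrite /x !lformE.
clearbody x.
have fx : lform f x = d by rewrite lx fa fb fc; field.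
have d0 := support_level_pos fn0 hd Kx fx.
have [t Pt tx] := tr_cover tP Kx.
have ha := height_hull cc tP no_flip Pt Ca.
have hb := height_hull cc tP no_flip Pt Cb.
have hcc := height_hull cc tP no_flip Pt Cc.
have hx1 : 1 <= lform (ht t) x by rewrite lx; lra.
pose r := (lform (ht t) x)^-1.
have r0 : 0 < r by rewrite invr_gt0; lra.
have Cx' : C (r *: x).
  apply: (convex_hull_mono (face_sub_B tP Pt)).
  apply/(hull_cone cc tP _ Pt); split.
    by have [_ _ hZ] := cone_hull_cone t; apply: (hZ) => //; exact: ltW.
  by rewrite lformZ /r mulVf // gt_eqF //; lra.
have hxle : lform (ht t) x <= 1.
  have := hd _ Cx'; rewrite lformZ fx -{1}[d]mul1r ler_pM2r //.
  by rewrite /r -{1}invr1 lef_pV2 ?posrE //; lra.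
have [ha1 hb1 hc1] : [/\ lform (ht t) a = 1, lform (ht t) b = 1 & lform (ht t) c = 1].
  by split; rewrite lx in hx1 hxle; lra.
have a0 : a != 0.
  by apply/eqP => a0; move: ha1; rewrite a0 /lform mulmx0 mxE; lra.
have ba s : b != s *: a.
  apply/eqP => e; apply: ab; move: hb1; rewrite e lformZ ha1 mulr1 => ->.
  by rewrite scale1r.
have det0 : det3 a b c != 0.
  apply/eqP => /(dependent_span a0 ba) [r1 [s1 e]].
  apply: (hc s1); move: hc1; rewrite e !lformE ha1 hb1 !mulr1 => h.
  have -> : r1 = 1 - s1 by lra.
  by vring.
have fE : f = d *: ht t.
  by apply: (form_basis_ext det0); rewrite lform_scalel ?ha1 ?hb1 ?hc1 mulr1.
exists t => //; congr (_ `&` _); apply/seteqP; split => y; rewrite /affine_plane /=.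
- rewrite fE lform_scalel => h; apply: (mulfI (lt0r_neq0 d0)).
  by rewrite h mulr1.
- by move=> h; rewrite fE lform_scalel h mulr1.
Qed.

Lemma polygonal_facesE : polygonal_faces C =
  [set C `&` affine_plane (ht t) 1 | t in P].
Proof.
apply/seteqP; split => F.
- by move=> /polygonal_contact [t Pt ->]; exists t.
- by move=> [t Pt <-]; exact: contact_polygonal.
Qed.

End LocallyConvex.
End PolygonalFaces.

(** * Cleanup *)

Section Cleanup.
Context (R : realType).
Local Notation V := 'cV[R]_3.
Implicit Types (a b c d p x y z v w : V) (t G : set V) (m g h : 'M[R]_3).
Variables (K D : set V) (l : 'rV[R]_3) (Gam : set 'M[R]_3) (B : set V).
Hypothesis cc : cusped_cone K D l Gam B.
Let sc := cc_cone cc.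
Let cg := cc_group cc.
Local Notation triple := (vertex_triple B).
Variable P : set (set V).
Hypothesis tP : triangulation K Gam B P.
Hypothesis no_flip : forall P', ~ edge_flip Gam P P'.
Local Notation C := (convex_hull B).
Local Notation ht := (height).

Lemma face_center t : P t -> exists x, [/\ K x, convex_hull t x &
  forall t', P t' -> cone_hull t' x -> t' = t].
Proof.
move=> Pt; have [a [b [c [vt et]]]] := tr_face tP Pt.
have i3 : (0 : R) < 3^-1 by lra.
exists (3^-1 *: a + 3^-1 *: b + 3^-1 *: c).
have Kx : K (3^-1 *: a + 3^-1 *: b + 3^-1 *: c).
  by apply: (triple_inK cc vt) => //; exact: ltW.
split => // [|t' Pt' t'x].
  rewrite et; apply/convex_hull3; exists 3^-1, 3^-1, 3^-1.
  by split; [exact: ltW..|split => //; lra].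
have P1 := Pt; rewrite et in P1.
have P2 := P1; rewrite set3_rot in P2; have P3 := P2; rewrite set3_rot in P3.
have vt2 := triple_rot vt; have vt3 := triple_rot vt2.
have j3 := ltW i3.
rewrite et; apply: (triple_sub (tr_face tP Pt') vt).
- exact: (carrier_vertex cc tP P1 vt Pt' Kx t'x i3 j3 j3 erefl).
- by apply: (carrier_vertex cc tP P2 vt2 Pt' Kx t'x i3 j3 j3); vring.
- by apply: (carrier_vertex cc tP P3 vt3 Pt' Kx t'x i3 j3 j3); vring.
Qed.

Lemma edge_center a b t : P t -> a <> b -> t a -> t b -> exists x,
  [/\ K x, convex_hull [set a; b] x &
  forall t', P t' -> convex_hull t' x -> [set a; b] `<=` t'].
Proof.
move=> Pt ab ta tb; have [c vt et] := triple_with (tr_face tP Pt) ta tb ab.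
have i2 : (0 : R) < 2^-1 by lra.
have [[Ba Bb _] _] := vt.
have Kx : K (2^-1 *: a + 2^-1 *: b) by exact: (edge_inK cc).
exists (2^-1 *: a + 2^-1 *: b); split => // [|t' Pt' /(hull_cone cc tP _ Pt')[t'x _]].
  have {2}-> : 2^-1 = 1 - 2^-1 :> R by lra.
  apply: convex_hull_convex; first by apply/andP; split; lra.
  - by apply: sub_convex_hull; left.
  - by apply: sub_convex_hull; right.
have P1 := Pt; rewrite et in P1; have P2 := P1; rewrite set3CA in P2.
move=> p [->|->].
- apply: (carrier_vertex cc tP P1 vt Pt' Kx t'x i2 (ltW i2) (lexx 0)).
  by rewrite scale0r addr0.
- apply: (carrier_vertex cc tP P2 (triple_swap vt) Pt' Kx t'x i2 (ltW i2) (lexx 0)).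
  by rewrite scale0r addr0 addrC.
Qed.

Lemma faces_at_edge a b t1 t2 t3 : a <> b -> P t1 -> P t2 -> P t3 -> t1 <> t2 ->
  [set a; b] `<=` t1 -> [set a; b] `<=` t2 -> [set a; b] `<=` t3 ->
  t3 = t1 \/ t3 = t2.
Proof.
move=> ab P1 P2 P3 t12 s1 s2 s3.
have [c1 v1 e1] := triple_with (tr_face tP P1) (s1 a (or_introl erefl))
  (s1 b (or_intror erefl)) ab.
have [c2 v2 e2] := triple_with (tr_face tP P2) (s2 a (or_introl erefl))
  (s2 b (or_intror erefl)) ab.
have [c3 v3 e3] := triple_with (tr_face tP P3) (s3 a (or_introl erefl))
  (s3 b (or_intror erefl)) ab.
have [c31|c31] := pselect (c1 = c3); first by left; rewrite e3 -c31 -e1.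
right; rewrite e1 e2 e3 in P1 P2 P3 *.
rewrite (edge_two_faces cc tP P1 P2 P3 v1 v2 v3) // => c12.
by apply: t12; rewrite e1 e2 c12.
Qed.

(** [E] stands for the edges treated so far by the cleanup; an intermediate face is a union of
    triangles linked through edges of [E] without bending. *)
Definition flat_adjacent (E : set (set V)) t t' : Prop :=
  [/\ P t, P t', ht t = ht t' & exists2 e, E e & e `<=` t /\ e `<=` t'].

Definition flat_class E := clos_refl_sym_trans _ (flat_adjacent E).

Definition flat_union E t : set V :=
  \bigcup_(t' in [set t' | flat_class E t t']) convex_hull t'.

Definition flat_faces E : set (set V) := [set flat_union E t | t in P].

Definition Gam_stable (E : set (set V)) : Prop :=
  forall g e, Gam g -> E e -> E (mulmx g @` e).

Lemma flat_class_P E t t' : flat_class E t t' -> (P t <-> P t').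
Proof. by elim=> // [x y []|x y _ ->|x y z _ -> _ ->]. Qed.

Lemma flat_class_height E t t' : flat_class E t t' -> ht t = ht t'.
Proof. by elim=> // [x y []|x y z _ -> _ ->]. Qed.

Lemma flat_class_mono E E' t t' : E `<=` E' -> flat_class E t t' -> flat_class E' t t'.
Proof.
move=> EE'; elim=> [x y [Px Py h [e Ee he]]|x|x y _ IH|x y z _ IH1 _ IH2].
- by apply: rst_step; split => //; exists e => //; exact: EE'.
- exact: rst_refl.
- exact: rst_sym.
- exact: rst_trans IH2.
Qed.

Lemma flat_class_mul E g t t' : Gam_stable E -> Gam g -> flat_class E t t' ->
  flat_class E (mulmx g @` t) (mulmx g @` t').
Proof.
move=> gE Gg; elim=> [x y [Px Py h [e Ee [ex ey]]]|x|x y _ IH|x y z _ IH1 _ IH2].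
- apply: rst_step; split; [exact: (tr_inv tP)..| |].
    by rewrite !(height_mul cc tP) // h.
  exists (mulmx g @` e); first exact: gE.
  by split; exact: image_subset.
- exact: rst_refl.
- exact: rst_sym.
- exact: rst_trans IH2.
Qed.

Lemma flat_union_eq E t t' : flat_class E t t' -> flat_union E t = flat_union E t'.
Proof.
move=> h; apply/seteqP; split => x [s hs sx]; exists s => //.
- by apply: rst_trans hs; exact: rst_sym.
- exact: rst_trans hs.
Qed.

(** The centre of [t] lies in no other triangle, so a union determines its class. *)
Lemma flat_union_inj E t t' : P t -> P t' -> flat_union E t = flat_union E t' ->
  flat_class E t t'.
Proof.
move=> Pt Pt' e; have [x [Kx tx hx]] := face_center Pt.
have : flat_union E t' x by rewrite -e; exists t => //; exact: rst_refl.
move=> [s hs sx]; have Ps : P s by rewrite -(flat_class_P hs).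
have <- : s = t by apply: hx => //; case/(hull_cone cc tP x Ps): sx.
exact: rst_sym.
Qed.

Lemma flat_union_sub E t : P t -> flat_union E t `<=` affine_plane (ht t) 1.
Proof.
move=> Pt x [s hs]; have Ps : P s by rewrite -(flat_class_P hs).
by move=> /(hull_cone cc tP x Ps)[_]; rewrite -(flat_class_height hs).
Qed.

Lemma coplanar_height t t' (S : set V) : P t -> P t' -> coplanar S ->
  t `<=` S -> t' `<=` S -> ht t = ht t'.
Proof.
move=> Pt Pt' [f [d [f0 hS]]] tS t'S.
have fE s : P s -> s `<=` S -> f = d *: ht s.
  move=> Ps sS; have [a [b [c [vs es]]]] := tr_face tP Ps.
  have [sa sb scc] : [/\ s a, s b & s c].
    by rewrite es; split; [left; left|left; right|right].
  by apply: (form_basis_ext (triple_det3 cc vs));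
    rewrite lform_scalel (height1 cc tP) // mulr1; apply: hS; exact: sS.
have d0 : d != 0.
  by apply/eqP => d0; move/eqP: f0; apply; rewrite (fE t) // d0 scale0r.
by apply: (scalerI d0); rewrite -fE // -fE.
Qed.

Lemma flat_union_edge E t e : P t -> edges P e -> convex_hull e `<=` flat_union E t ->
  exists t', [/\ P t', flat_class E t t' & e `<=` t'].
Proof.
move=> Pt [a [b [f [Pf /eqP ab fa fb ->]]]] h.
have [x [Kx ex hx]] := edge_center Pf ab fa fb.
have [s hs sx] := h _ ex; have Ps : P s by rewrite -(flat_class_P hs).
by exists s; split => //; exact: hx.
Qed.

Lemma edges_mul g e : Gam g -> edges P e -> edges P (mulmx g @` e).
Proof.
move=> Gg [a [b [f [Pf ab fa fb ->]]]].
exists (g *m a), (g *m b), (mulmx g @` f); split.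
- exact: (tr_inv tP).
- by apply: contra_neq ab => e'; rewrite -(mulVx cg a Gg) e' (mulVx cg).
- by exists a.
- by exists b.
- by rewrite image_setU !image_set1.
Qed.

Lemma gamma_class_edges e e' : edges P e -> gamma_class Gam e e' -> edges P e'.
Proof. by move=> he [g Gg <-]; exact: edges_mul. Qed.

Lemma image_inv_sub g e t : Gam g -> mulmx g @` e `<=` t ->
  e `<=` mulmx (invmx g) @` t.
Proof.
by move=> Gg h p ep; exists (g *m p); [apply: h; exists p|rewrite (mulVx cg)].
Qed.

Lemma image_invK g t : Gam g -> mulmx g @` (mulmx (invmx g) @` t) = t.
Proof.
by move=> Gg; have := Gam_image_inv cc t (GamV cg Gg); rewrite invmxK.
Qed.

Lemma sub_flat_union E t : convex_hull t `<=` flat_union E t.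
Proof. by move=> x tx; exists t => //; exact: rst_refl. Qed.

Section Step.
Variables (E : set (set V)) (e : set V).
Hypothesis gE : Gam_stable E.
Hypothesis he : edges P e.
Let E' := E `|` gamma_class Gam e.

(** The test inspects the representative [e] only, whereas merging uses all its translates.
    Equivariance of the heights and the bound of two faces per edge make every translate of [e]
    flat. *)
Lemma merge_true :
  (exists G G', [/\ flat_faces E G, flat_faces E G', G <> G', shares_edge e G G' &
            coplanar (G `|` G')]) ->
  forall t, P t -> merged_face Gam (flat_faces E) e (flat_union E t) = flat_union E' t.
Proof.
move=> [_ [_ [[u1 Pu1 <-] [u2 Pu2 <-] dG sh cop]]].
have [t1 [Pt1 h1 et1]] := flat_union_edge Pu1 he (fun x hx => (sh x hx).1).
have [t2 [Pt2 h2 et2]] := flat_union_edge Pu2 he (fun x hx => (sh x hx).2).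
have t12 : t1 <> t2.
  by move=> t12; apply: dG; rewrite (flat_union_eq h1) t12 -(flat_union_eq h2).
have ht12 : ht t1 = ht t2.
  apply: (coplanar_height Pt1 Pt2 cop) => p hp; [left|right].
  - by exists t1 => //; exact: sub_convex_hull.
  - by exists t2 => //; exact: sub_convex_hull.
have flat s s' e' : P s -> P s' -> gamma_class Gam e e' -> e' `<=` s ->
    e' `<=` s' -> ht s = ht s'.
  have key u : P u -> e `<=` u -> ht u = ht t1.
    have [a [b [f [_ /eqP ab _ _ ee]]]] := he.
    move=> Pu eu; rewrite ee in et1 et2 eu.
    by case: (faces_at_edge ab Pt1 Pt2 Pu t12 et1 et2 eu) => -> //.
  move=> Ps Ps' [g Gg <-] es es'.
  have hu u : P u -> mulmx g @` e `<=` u -> ht u = ht t1 *m invmx g.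
    move=> Pu eu; have Pv : P (mulmx (invmx g) @` u).
      by apply: (tr_inv tP) => //; exact: (GamV cg).
    rewrite -{1}(image_invK u Gg) (height_mul cc tP Pv Gg) key //.
    exact: image_inv_sub.
  by rewrite (hu s) ?(hu s').
(* Both directions are carried along because the closure is symmetric, and an arbitrary related set
   is not known in advance to be a face. *)
have to_class G1 G2 : clos_refl_sym_trans _ (merge_relation Gam (flat_faces E) e) G1 G2 ->
    (forall t, P t -> G1 = flat_union E t ->
       exists t', [/\ P t', G2 = flat_union E t' & flat_class E' t t']) /\
    (forall t', P t' -> G2 = flat_union E t' ->
       exists t, [/\ P t, G1 = flat_union E t & flat_class E' t t']).
  have step s s' : P s -> P s' ->
      (exists2 e', gamma_class Gam e e' & shares_edge e' (flat_union E s) (flat_union E s')) ->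
      flat_class E' s s'.
    move=> Ps Ps' [e' ce' sh'].
    have he' := gamma_class_edges he ce'.
    have [r1 [Pr1 k1 er1]] := flat_union_edge Ps he' (fun x hx => (sh' x hx).1).
    have [r2 [Pr2 k2 er2]] := flat_union_edge Ps' he' (fun x hx => (sh' x hx).2).
    have sE : E `<=` E' by move=> ?; left.
    apply: rst_trans (flat_class_mono sE k1) _.
    apply: rst_trans (rst_sym _ _ _ _ (flat_class_mono sE k2)).
    apply: rst_step; split => //; first exact: flat ce' er1 er2.
    by exists e' => //; right.
  elim=> {G1 G2} [G1 G2 [QG1 QG2 hsh]|G|G1 G2 _ [IH1 IH2]|G1 G2 G3 _ [A1 A2] _ [B1 B2]].
  - split=> t Pt eG.
    + case: QG2 => t' Pt' eG'; exists t'; split => //.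
      by apply: step => //; rewrite eG' -eG.
    + case: QG1 => t' Pt' eG'; exists t'; split => //.
      by apply: step => //; rewrite eG' -eG.
  - by split=> t Pt eG; exists t; split => //; exact: rst_refl.
  - split=> t Pt eG.
    + by have [t' [Pt' eG' h]] := IH2 t Pt eG; exists t'; split => //; exact: rst_sym.
    + by have [t' [Pt' eG' h]] := IH1 t Pt eG; exists t'; split => //; exact: rst_sym.
  - split=> t Pt eG.
    + have [t' [Pt' eG' h]] := A1 t Pt eG; have [t'' [Pt'' eG'' h']] := B1 t' Pt' eG'.
      by exists t''; split => //; exact: rst_trans h h'.
    + have [t' [Pt' eG' h]] := B2 t Pt eG; have [t'' [Pt'' eG'' h']] := A2 t' Pt' eG'.
      by exists t''; split => //; exact: rst_trans h' h.
have of_class t t' : flat_class E' t t' ->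
    clos_refl_sym_trans _ (merge_relation Gam (flat_faces E) e)
      (flat_union E t) (flat_union E t').
  elim=> {t t'} [t t' [Pt Pt' ett' [e' [Ee'|ce'] [es es']]]|t|t t' _ IH|t t' t'' _ IH1 _ IH2].
  - have -> : flat_union E t = flat_union E t'.
      by apply: flat_union_eq; apply: rst_step; split => //; exists e'.
    exact: rst_refl.
  - apply: rst_step; split; [by exists t|by exists t'|].
    exists e' => // x ex; split; apply: sub_flat_union.
    + exact: convex_hull_mono ex.
    + exact: convex_hull_mono ex.
  - exact: rst_refl.
  - exact: rst_sym.
  - exact: rst_trans IH2.
move=> t Pt; apply/seteqP; split => x.
- move=> [G hG Gx]; have [A _] := to_class _ _ hG.
  have [t' [Pt' eG h]] := A t Pt erefl; move: Gx; rewrite eG => -[s hs sx].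
  exists s => //; apply: rst_trans h _; apply: flat_class_mono hs.
  by move=> ?; left.
- move=> [s hs sx]; exists (flat_union E s); first exact: of_class.
  exact: sub_flat_union.
Qed.

(** Two coplanar triangles at a translate of [e], pulled back to [e], must already lie in one union,
    or the test would succeed; so the class of [e] links nothing new. *)
Lemma merge_false :
  ~ (exists G G', [/\ flat_faces E G, flat_faces E G', G <> G', shares_edge e G G' &
            coplanar (G `|` G')]) ->
  forall t, flat_union E t = flat_union E' t.
Proof.
move=> nt.
have sub t t' : flat_class E' t t' -> flat_class E t t'.
  elim=> {t t'} [t t' [Pt Pt' ett' [e' [Ee'|ce'] [es es']]]|t|t t' _ IH|t t' t'' _ IH1 _ IH2].
  - by apply: rst_step; split => //; exists e'.
  - case: ce' es es' => g Gg <- es es'.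
    have GV := GamV cg Gg.
    have Ps : P (mulmx (invmx g) @` t) by exact: (tr_inv tP).
    have Ps' : P (mulmx (invmx g) @` t') by exact: (tr_inv tP).
    rewrite -(image_invK t Gg) -(image_invK t' Gg); apply: flat_class_mul => //.
    apply: flat_union_inj => //; apply: contrapT => dG; apply: nt.
    exists (flat_union E (mulmx (invmx g) @` t)), (flat_union E (mulmx (invmx g) @` t')).
    split => //.
    + by exists (mulmx (invmx g) @` t).
    + by exists (mulmx (invmx g) @` t').
    + by move=> x ex; split; apply: sub_flat_union; apply: convex_hull_mono ex;
        exact: image_inv_sub.
    + exists (ht (mulmx (invmx g) @` t)), 1; split; first exact: (height_neq0 cc tP).
      move=> x [|]; first exact: flat_union_sub.
      by move/(flat_union_sub Ps'); rewrite !(height_mul cc tP) // ett'.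
  - exact: rst_refl.
  - exact: rst_sym.
  - exact: rst_trans IH2.
move=> t; apply/seteqP; split => x [s hs sx]; exists s => //; last exact: sub.
by apply: flat_class_mono hs => ?; left.
Qed.

Lemma cleanup_step_flat : cleanup_step Gam (flat_faces E) e = flat_faces E'.
Proof.
rewrite /cleanup_step; case: asboolP => h.
- apply/seteqP; split => F.
  + move=> [_ [t Pt <-] <-]; exists t => //; exact/esym/merge_true.
  + move=> [t Pt <-]; exists (flat_union E t); first by exists t.
    exact: merge_true.
- by apply/seteqP; split => F [t Pt <-]; exists t => //; rewrite (merge_false h).
Qed.

End Step.

Lemma solid_faces_flat : solid_faces P = flat_faces set0.
Proof.
have U t : flat_union set0 t = convex_hull t.
  apply/seteqP; split => x; last exact: sub_flat_union.
  move=> [s hs sx]; suff -> : t = s by [].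
  by elim: hs {sx} => // [? ? [_ _ _ [? []]]|? ? ? _ -> _ ->].
by apply/seteqP; split => F [t Pt <-]; exists t; rewrite ?U.
Qed.

Lemma gamma_class_stable (e : set V) : Gam_stable (gamma_class Gam e).
Proof.
move=> g _ Gg [h Gh <-]; exists (g *m h); first exact: (GamM cg).
by rewrite Gam_image_mul.
Qed.

Lemma cleanup_fold n (e : 'I_n -> set V) (s : seq 'I_n) E :
  (forall i, edges P (e i)) -> Gam_stable E ->
  exists2 E', foldl (cleanup_step Gam) (flat_faces E) [seq e i | i <- s] = flat_faces E' &
    forall i, i \in s -> gamma_class Gam (e i) `<=` E'.
Proof.
move=> he; suff : Gam_stable E -> exists2 E',
    foldl (cleanup_step Gam) (flat_faces E) [seq e i | i <- s] = flat_faces E' &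
    E `<=` E' /\ forall i, i \in s -> gamma_class Gam (e i) `<=` E'.
  by move=> h /h [E' ? []]; exists E'.
elim: s E => [|i s IH] E gE /=.
  by exists E => //; split.
rewrite cleanup_step_flat //.
have [|E' eq [sub subs]] := IH (E `|` gamma_class Gam (e i)).
  move=> g u Gg [Eu|cu]; first by left; exact: gE.
  by right; exact: gamma_class_stable.
exists E' => //; split=> [u Eu|j]; first by apply: sub; left.
by rewrite inE => /orP[/eqP -> u cu|/subs //]; apply: sub; right.
Qed.

(* Two faces in the same plane are linked along the segment joining their
   centres, which stays in the contact set of that plane. *)
Lemma same_height_class E t t' : edges P `<=` E -> P t -> P t' -> ht t = ht t' ->
  flat_class E t t'.
Proof.
move=> EE Pt Pt' ett'.
have [x [Kx tx xonly]] := face_center Pt; have [y [Ky t'y yonly]] := face_center Pt'.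
pose X s := x + s *: (y - x).
have XE s : X s = s *: y + (1 - s) *: x by rewrite /X; vring.
have KX s : 0 <= s <= 1 -> K (X s).
  move=> /andP[s0]; rewrite le_eqVlt => /orP[/eqP ->|s1].
    by rewrite /X scale1r addrC subrK.
  by apply: (segment_K cc); [|left|rewrite s0].
have Cx : C x by apply: convex_hull_mono tx; exact: (face_sub_B tP).
have Cy : C y by apply: convex_hull_mono t'y; exact: (face_sub_B tP).
have CX s : 0 <= s <= 1 -> C (X s).
  by move=> s01; rewrite XE; exact: convex_hull_convex.
have hX s : lform (ht t) (X s) = 1.
  have hx := ((hull_cone cc tP x Pt).1 tx).2.
  have hy := ((hull_cone cc tP y Pt').1 t'y).2; rewrite -ett' in hy.
  by rewrite XE lformD !lformZ hx hy; ring.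
have XX s s' : X s' = X s + (s' - s) *: (y - x) by rewrite /X; vring.
pose H s := forall u, P u -> cone_hull u (X s) -> ht u = ht t -> flat_class E t u.
suff H1 : H 1.
  apply: H1 => //; rewrite /X scale1r addrC subrK.
  exact: ((hull_cone cc tP y Pt').1 t'y).1.
apply: real_induction.
  move=> u Pu; rewrite /X scale0r addr0 => ux _.
  by rewrite (xonly u Pu ux); exact: rst_refl.
move=> s s01; have [e e0 near] := tr_locfin tP (y - x) (KX s s01).
exists e => //; split.
- move=> Hs s' /andP[h1 h2] s'1 u Pu ux; apply: Hs => //.
  apply: (near (s' - s) u) => //; last by rewrite -XX.
  by rewrite ger0_norm; lra.
- move=> s' s'0 /andP[h1 h2] Hs' u Pu ux hu.
  have s'01 : 0 <= s' <= 1 by rewrite s'0 /=; move: s01 => /andP[]; lra.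
  have [w [Pw wx hw]] :=
    contact_face_K cc tP no_flip Pt (KX s' s'01) (CX s' s'01) (hX s').
  apply: rst_trans (Hs' w Pw wx hw) _.
  have ws : cone_hull w (X s).
    apply: (near (s' - s) w) => //; last by rewrite -XX.
    by rewrite ltr0_norm; lra.
  have [->|wu] := pselect (w = u); first exact: rst_refl.
  have [a [b [c [v [r [q [[e1 e2 cv vc vv] _]]]]]]] :=
    common_edge cc tP Pw Pu wu (KX s s01) ws ux.
  have [_ [ab _ _]] := vc.
  apply: rst_step; split => //; first by rewrite hw hu.
  exists [set a; b].
  + apply: EE; exists a, b, w; split => //; first exact/eqP.
    * by rewrite e1; left; left.
    * by rewrite e1; left; right.
  + by rewrite e1 e2; split=> p hp; left.
Qed.

(** Every edge is in the class of some representative, so the final [E'] contains all edges and each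
    union fills the contact set of its plane. *)
Lemma cleanup_polygonal Q : cleanup Gam P Q -> Q = polygonal_faces C.
Proof.
move=> [n [e [[he hall] ->]]]; rewrite solid_faces_flat.
have [|E' -> sub] := cleanup_fold (enum 'I_n) (E := set0) he; first by move=> g u _ [].
have EE : edges P `<=` E'.
  by move=> u /hall [i [ci _]]; apply: (sub i) => //; rewrite mem_enum.
rewrite (polygonal_facesE cc tP no_flip).
have U t : P t -> flat_union E' t = C `&` affine_plane (ht t) 1.
  move=> Pt; rewrite (contact_union cc tP no_flip Pt).
  apply/seteqP; split => x [s hs sx]; exists s => //.
  - by split; [rewrite -(flat_class_P hs)|rewrite (flat_class_height hs)].
  - by case: hs => Ps es; exact: same_height_class.
by apply/seteqP; split => F [t Pt <-]; exists t; rewrite ?U.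
Qed.

End Cleanup.

(** * From the projective domain to the cone *)

Section DomainCone.
Context (R : realType).
Local Notation V := 'cV[R]_3.
Implicit Types (a b c p q x y z v w : V) (t : set V) (m g h : 'M[R]_3).

Lemma mulmx_continuous m : continuous (fun x : V => m *m x).
Proof.
have -> : (fun x : V => m *m x) = (fun x : V =>
    x 0 0 *: col 0 m + x 1 0 *: col 1 m + x ord_max 0 *: col ord_max m).
  by apply/funext => x; apply/colP => i; rewrite !mxE sum_I3; ring.
have h i : continuous (fun y : V => y i 0 *: col i m).
  by move=> x; exact: cvgZr_tmp (@coord_continuous R 3 1 i 0 x).
by move=> x; exact: cvgD (cvgD (h _ x) (h _ x)) (h _ x).
Qed.

Lemma euclid_normE x :
  euclid_norm x = Num.sqrt (x 0 0 ^+ 2 + x 1 0 ^+ 2 + x ord_max 0 ^+ 2).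
Proof. by rewrite /euclid_norm sum_I3. Qed.

Lemma euclid_norm_continuous : continuous (@euclid_norm R).
Proof.
have -> : @euclid_norm R = (fun x : V =>
    Num.sqrt (x 0 0 * x 0 0 + x 1 0 * x 1 0 + x ord_max 0 * x ord_max 0)).
  by apply/funext => x; rewrite euclid_normE !expr2.
have h i : continuous (fun y : V => y i 0 * y i 0).
  by move=> x; exact: cvgM (@coord_continuous R 3 1 i 0 x) (@coord_continuous R 3 1 i 0 x).
move=> x; apply: (@continuous_comp _ _ _
  (fun x : V => x 0 0 * x 0 0 + x 1 0 * x 1 0 + x ord_max 0 * x ord_max 0)).
  exact: cvgD (cvgD (h _ x) (h _ x)) (h _ x).
exact: sqrt_continuous.
Qed.

Lemma euclid_norm_ge0 x : 0 <= euclid_norm x.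
Proof. exact: sqrtr_ge0. Qed.

Lemma euclid_norm_gt0 x : x != 0 -> 0 < euclid_norm x.
Proof.
move=> x0; rewrite euclid_normE sqrtr_gt0 lt_neqAle eq_sym.
rewrite !addr_ge0 ?sqr_ge0 // andbT; apply: contra_neq x0 => e.
have h0 := sqr_ge0 (x 0 0); have h1 := sqr_ge0 (x 1 0).
have h2 := sqr_ge0 (x ord_max 0).
have z i : x i 0 ^+ 2 = 0 -> x i 0 = 0 by move/eqP; rewrite sqrf_eq0 => /eqP.
by apply/colP; apply: I3_cases; rewrite mxE; apply: z; lra.
Qed.

Lemma euclid_normZ (s : R) x : 0 <= s -> euclid_norm (s *: x) = s * euclid_norm x.
Proof.
move=> s0; rewrite !euclid_normE !mxE !exprMn -!mulrDr sqrtrM ?sqr_ge0 //.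
by rewrite sqrtr_sqr ger0_norm.
Qed.

Lemma normalizeZ (s : R) x : 0 < s -> normalize (s *: x) = normalize x.
Proof.
move=> s0; rewrite /normalize euclid_normZ ?ltW // scalerA invfM mulrAC.
by rewrite mulVf ?gt_eqF // mul1r.
Qed.

Lemma normalizeE x : x != 0 -> x = euclid_norm x *: normalize x.
Proof.
by move=> x0; rewrite /normalize scalerA divff ?scale1r // gt_eqF // euclid_norm_gt0.
Qed.

Lemma normalize_unit x : euclid_norm x = 1 -> normalize x = x.
Proof. by move=> e; rewrite /normalize e invr1 scale1r. Qed.

Lemma euclid_norm_normalize x : x != 0 -> euclid_norm (normalize x) = 1.
Proof.
move=> x0; have n0 := euclid_norm_gt0 x0.
by rewrite /normalize euclid_normZ ?invr_ge0 ?ltW // mulVf // gt_eqF.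
Qed.

Lemma normalize_continuous x : x != 0 -> {for x, continuous (@normalize R)}.
Proof.
move=> x0; have n0 := lt0r_neq0 (euclid_norm_gt0 x0).
have c : (euclid_norm y)^-1 @[y --> x] --> (euclid_norm x)^-1.
  by have h := @euclid_norm_continuous x; exact: (cvgV n0 h).
have id : (y : V) @[y --> x] --> x by exact: cvg_id.
exact: cvgZ c id.
Qed.

Lemma closure_map (A A' : set V) (f : V -> V) x : {for x, continuous f} ->
  (forall y, A y -> A' (f y)) -> closure A x -> closure A' (f x).
Proof.
move=> cf fA Ax U nU; have [y [Ay Uy]] := Ax _ (cf _ nU).
by exists (f y); split => //; exact: fA.
Qed.

Lemma closure_form_ge0 (f : 'rV[R]_3) (A : set V) x :
  (forall y, A y -> 0 <= lform f y) -> closure A x -> 0 <= lform f x.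
Proof.
move=> h Ax; rewrite leNgt; apply/negP => fx.
have : nbhs x (lform f @^-1` [set s | s < 0]).
  by apply: lform_continuous; apply: open_nbhs_nbhs; split => //; exact: open_lt.
by move/Ax => [y [/h hy]] /=; rewrite ltNge hy.
Qed.

Lemma near0_nbhs x v (U : set V) : nbhs x U -> near0 (fun s : R => U (x + s *: v)).
Proof.
move=> nU; have c : (fun s : R => x + s *: v) @ 0 --> x + 0 *: v.
  by apply: cvgD; [exact: cvg_cst|apply: cvgZr_tmp; exact: cvg_id].
rewrite scale0r addr0 in c; have /nbhs_ballP [e e0 he] := c _ nU.
by exists e => // s hs; apply: he; rewrite /ball /= sub0r normrN.
Qed.

End DomainCone.

(** * Strict convexity of the cone over the projective domain *)

Section DomainToCone.
Context (R : realType).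
Local Notation V := 'cV[R]_3.
Implicit Types (a b c p q x y z v w : V) (t : set V) (m g h : 'M[R]_3).

Lemma open_form_gt0 (l : 'rV[R]_3) (k : R) : open [set x : V | 0 < k * lform l x].
Proof.
have := @lform_continuous R (k *: l) => /continuousP /(_ [set s | 0 < s]).
rewrite (_ : _ @^-1` _ = [set x : V | 0 < k * lform l x]); last first.
  by apply/seteqP; split => x /=; rewrite lform_scalel.
by apply; exact: open_gt.
Qed.

(** [Omega] is stable under negation; the sign of [l] selects one of its two opposite halves. *)
Definition domain_cone (Omega : set V) (l : 'rV[R]_3) : set V :=
  [set x | Omega x /\ 0 < lform l x].

Definition boundary_cone (Omega : set V) (l : 'rV[R]_3) : set V :=
  [set x | [/\ closure Omega x, ~ Omega x & 0 < lform l x]].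

Section Domain.
Variables (Omega Omega_p : set V).
Hypothesis dom : strictly_convex_domain Omega.
Hypothesis lift : is_lift Omega Omega_p.

Lemma Omega_neq0 x : Omega x -> x != 0.
Proof. by have [[h _] _ _] := dom; exact: h. Qed.

Lemma Omega_scale (s : R) x : s != 0 -> Omega x -> Omega (s *: x).
Proof. by have [[_ h] _ _] := dom; exact: h. Qed.

Lemma closure_Omega_scale (s : R) x : s != 0 -> closure Omega x ->
  closure Omega (s *: x).
Proof.
move=> s0; apply: (@closure_map _ Omega Omega (fun y => s *: y)).
  by have h : (y : V) @[y --> x] --> x; [exact: cvg_id|exact: cvgZl_tmp h].
by move=> y; exact: Omega_scale.
Qed.

Section Patch.
Variable l : 'rV[R]_3.
Hypothesis patch : closure_in_patch l Omega.
Hypothesis add : forall x y, Omega x -> Omega y -> 0 < lform l x -> 0 < lform l y ->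
  Omega (x + y).
Hypothesis strict : forall x y, closure Omega x -> closure Omega y ->
  ~ Omega x -> ~ Omega y -> 0 < lform l x -> 0 < lform l y ->
  (forall s, y != s *: x) -> exists r s : R, [/\ 0 < r, 0 < s & Omega (r *: x + s *: y)].
Hypothesis pos : forall y, Omega_p y -> 0 < lform l y.

Let K := domain_cone Omega l.
Let D := boundary_cone Omega l.

Lemma K_open : open K.
Proof.
have [_ oO _] := dom; apply: openI => //.
have := @lform_continuous R l; move/continuousP => /(_ [set s | 0 < s]); apply.
exact: open_gt.
Qed.

(** For [z] in [Omega] close to [y] the sum is [(x + (y - z)) + z], whose first summand is still in
    the open cone. *)
Lemma K_add_closure x y : K x -> closure Omega y -> 0 < lform l y -> K (x + y).
Proof.
move=> Kx cy ly; have [Ox lx] := Kx; split; last by rewrite lformD addr_gt0.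
have c : (fun z : V => x + (y - z)) @ y --> x + (y - y).
  have id : (z : V) @[z --> y] --> y by exact: cvg_id.
  have cst (q : V) : (fun _ : V => q) @ y --> q by exact: (@cvg_cst V q V (nbhs y) (nbhs_filter y)).
  exact: cvgD (cst x) (cvgB (cst y) id).
rewrite subrr addr0 in c.
have nK : nbhs x K.
  apply: open_nbhs_nbhs; split; last exact: Kx.
  exact: K_open.
have nL : nbhs y [set z | 0 < lform l z].
  have := @lform_continuous R l y [set s | 0 < s]; apply.
  by apply: open_nbhs_nbhs; split => //; exact: open_gt.
have cK : nbhs y [set z | K (x + (y - z))] by exact: (c K nK).
have [z [Oz [[Oxz lxz] lz]]] := cy _ (filterI cK nL).
have -> : x + y = (x + (y - z)) + z by rewrite -addrA subrK.
exact: add.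
Qed.

Lemma domain_strict_cone : strict_cone K D l.
Proof.
split.
- move=> s x s0 [Ox lx]; split; first by apply: Omega_scale => //; rewrite gt_eqF.
  by rewrite lformZ mulr_gt0.
- by move=> x y [Ox lx] [Oy ly]; split; [exact: add|rewrite lformD addr_gt0].
- move=> x v Kx; apply: near0_nbhs; apply: open_nbhs_nbhs; split => //; exact: K_open.
- by move=> x y Kx [cy _ ly]; exact: K_add_closure.
- move=> x y [cx nx lx] [cy ny ly] xy.
  have [r [s [r0 s0 Orsxy]]] := strict cx cy nx ny lx ly xy.
  have Krs : K (r *: x + s *: y).
    by split => //; rewrite lformD !lformZ addr_gt0 // mulr_gt0.
  have scl (q : R) z : 0 < q -> K z -> K (q *: z).
    move=> q0 [Oz lz]; split; first by apply: Omega_scale => //; rewrite gt_eqF.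
    by rewrite lformZ mulr_gt0.
  have [rs|sr] := leP r s.
    have -> : x + y = s^-1 *: ((r *: x + s *: y) + (s - r) *: x).
      by apply/colP => i; rewrite !mxE; field; rewrite gt_eqF.
    apply: scl; first by rewrite invr_gt0.
    move: rs; rewrite le_eqVlt => /orP[/eqP rs|rs].
      by rewrite -rs subrr scale0r addr0 {2}rs.
    apply: K_add_closure => //.
      by apply: closure_Omega_scale => //; rewrite gt_eqF // subr_gt0.
    by rewrite lformZ mulr_gt0 // subr_gt0.
  have -> : x + y = r^-1 *: ((r *: x + s *: y) + (r - s) *: y).
    by apply/colP => i; rewrite !mxE; field; rewrite gt_eqF.
  apply: scl; first by rewrite invr_gt0.
  apply: K_add_closure => //; first by apply: closure_Omega_scale => //; rewrite gt_eqF // subr_gt0.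
  by rewrite lformZ mulr_gt0 // subr_gt0.
- by move=> x [_ nx _] [].
- by move=> x [].
- by move=> x [].
Qed.

End Patch.

(** Both vectors are scaled to the slice [l = 1], where [Omega] is convex. The condition on the
    product admits both signs, since [l] may be negative on the lift. *)
Lemma domain_add (l : 'rV[R]_3) x y :
  @convex_set R V (Omega `&` affine_plane l 1) ->
  Omega x -> Omega y -> 0 < lform l x * lform l y -> Omega (x + y).
Proof.
move=> /convex_setE conv Ox Oy xy.
have lx0 : lform l x != 0 by apply/eqP => h; rewrite h mul0r ltxx in xy.
have ly0 : lform l y != 0 by apply/eqP => h; rewrite h mulr0 ltxx in xy.
have s0 : lform l x + lform l y != 0.
  apply/eqP => h; have e : lform l x = - lform l y by lra.
  by move: xy; rewrite e mulNr oppr_gt0 ltNge -expr2 sqr_ge0.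
have P z : Omega z -> lform l z != 0 ->
    (Omega `&` affine_plane l 1) ((lform l z)^-1 *: z).
  move=> Oz lz; split; first by apply: Omega_scale => //; rewrite invr_eq0.
  by rewrite /affine_plane /= lformZ mulVf.
pose s := lform l x / (lform l x + lform l y).
have s01 : 0 <= s <= 1.
  have -> : s = (lform l x) ^+ 2 / ((lform l x) ^+ 2 + lform l x * lform l y).
    by rewrite /s; field; rewrite s0 -mulrDr mulf_neq0.
  have sq := sqr_ge0 (lform l x).
  apply/andP; split; first by apply: divr_ge0 => //; lra.
  by rewrite ler_pdivrMr; lra.
have [+ _] := conv _ _ s s01 (P x Ox lx0) (P y Oy ly0).
move=> /(Omega_scale s0).
rewrite scalerDr !scalerA.
have -> : (lform l x + lform l y) * s / lform l x = 1 by rewrite /s; field; rewrite lx0.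
have -> : (lform l x + lform l y) * (1 - s) / lform l y = 1.
  by rewrite /s; field; rewrite ly0.
by rewrite !scale1r.
Qed.

Lemma closure_inter_open (A U : set V) x : open U -> U x -> closure A x ->
  closure (A `&` U) x.
Proof.
move=> oU Ux cA W nW; have nU : nbhs x U by exact: open_nbhs_nbhs.
by have [y [Ay [Wy Uy]]] := cA _ (filterI nW nU); exists y.
Qed.

Lemma domain_closure_add (l : 'rV[R]_3) x y :
  @convex_set R V (Omega `&` affine_plane l 1) ->
  closure Omega x -> closure Omega y -> 0 < lform l x * lform l y ->
  closure Omega (x + y).
Proof.
move=> conv cx cy xy.
have tr (u v : V) : (fun z : V => z + v) @ u --> u + v.
  have id : (z : V) @[z --> u] --> u by exact: cvg_id.
  have cst : (fun _ : V => v) @ u --> v by exact: (@cvg_cst V v V (nbhs u) (nbhs_filter u)).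
  exact: cvgD id cst.
have step a b : Omega a -> closure Omega b -> 0 < lform l a * lform l b ->
    closure Omega (b + a).
  move=> Oa cb ab.
  have := closure_inter_open (@open_form_gt0 l (lform l a)) ab cb.
  apply: (@closure_map _ _ _ (fun z => z + a)); first exact: tr.
  by move=> z [Oz az]; apply: (domain_add conv) => //; rewrite mulrC.
apply: closed_closure.
have yx : 0 < lform l y * lform l x by rewrite mulrC.
have := closure_inter_open (@open_form_gt0 l (lform l y)) yx cx.
apply: (@closure_map _ _ _ (fun z => z + y)); first exact: tr.
move=> z [Oz yz]; rewrite addrC; apply: step => //; by rewrite mulrC.
Qed.

(** Otherwise the segment between the two vectors scaled to the slice [l = 1] would consist of
    boundary points only. *)
Lemma domain_strict (l : 'rV[R]_3) x y :
  @convex_set R V (Omega `&` affine_plane l 1) ->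
  (forall x y, x != y -> ~ convex_hull [set x; y] `<=`
            (closure Omega `\` Omega) `&` affine_plane l 1) ->
  closure Omega x -> closure Omega y -> ~ Omega x -> ~ Omega y ->
  0 < lform l x * lform l y -> (forall s, y != s *: x) ->
  exists r s : R, 0 < r * s /\ Omega (r *: x + s *: y).
Proof.
move=> conv str cx cy nx ny xy nxy.
have lx0 : lform l x != 0 by apply/eqP => h; rewrite h mul0r ltxx in xy.
have ly0 : lform l y != 0 by apply/eqP => h; rewrite h mulr0 ltxx in xy.
pose r := (lform l x)^-1; pose s := (lform l y)^-1.
have r0 : r != 0 by rewrite invr_eq0.
have s0 : s != 0 by rewrite invr_eq0.
have rs : 0 < r * s by rewrite /r /s -invfM invr_gt0.
have lr : r * lform l x = 1 by rewrite mulVf.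
have ls : s * lform l y = 1 by rewrite mulVf.
have d : s *: y != r *: x.
  apply/eqP => e; have := nxy (s^-1 * r); apply/negP; rewrite negbK.
  by rewrite -scalerA -e scalerA mulVf // scale1r.
apply: contrapT => h; apply: (str _ _ d) => z.
have -> : [set s *: y; r *: x] = [set s *: y; r *: x; r *: x].
  by rewrite -setUA setUid.
move=> /convex_hull3 [k1 [k2 [k3 [k10 k20 k30 [e ->]]]]].
have -> : k1 *: (s *: y) + k2 *: (r *: x) + k3 *: (r *: x) =
    ((k2 + k3) * r) *: x + (k1 * s) *: y by vring.
have k230 : 0 <= k2 + k3 by rewrite addr_ge0.
have on : lform l (((k2 + k3) * r) *: x + (k1 * s) *: y) = 1.
  by rewrite lformD !lformZ -!mulrA lr ls; lra.
split; last exact: on.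
have [k1z|k1n] := eqVneq k1 0.
  have -> : k2 + k3 = 1 by lra.
  rewrite k1z mul0r scale0r addr0 mul1r; split; first exact: closure_Omega_scale.
  by move/(Omega_scale (s := r^-1)); rewrite scalerA mulVf // scale1r invr_eq0 => /(_ r0).
have [k23z|k23n] := eqVneq (k2 + k3) 0.
  have -> : k1 = 1 by lra.
  rewrite k23z mul0r scale0r add0r mul1r; split; first exact: closure_Omega_scale.
  by move/(Omega_scale (s := s^-1)); rewrite scalerA mulVf // scale1r invr_eq0 => /(_ s0).
have k1p : 0 < k1 by rewrite lt_neqAle eq_sym k1n.
have k23p : 0 < k2 + k3 by rewrite lt_neqAle eq_sym k23n.
have prod : 0 < (k2 + k3) * r * (k1 * s).
  by rewrite mulrACA mulr_gt0 // mulr_gt0.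
split; last by move=> Oz; apply: h; exists ((k2 + k3) * r), (k1 * s).
apply: (domain_closure_add conv).
- by apply: closure_Omega_scale => //; rewrite mulf_neq0.
- by apply: closure_Omega_scale => //; rewrite mulf_neq0.
- by rewrite !lformZ -![_ * _ * lform _ _]mulrA lr ls !mulr1 mulr_gt0.
Qed.

Lemma lift_sub : Omega_p `<=` Omega.
Proof.
have [_ _ _ h] := lift; move=> y Oy; apply/h; exists 1, y.
by rewrite scale1r oner_neq0.
Qed.

Lemma lift_sign (l : 'rV[R]_3) : closure_in_patch l Omega ->
  (forall y, Omega_p y -> 0 < lform l y) \/ (forall y, Omega_p y -> 0 < lform (- l) y).
Proof.
move=> patch; have [_ conn _ _] := lift.
have n0 y : Omega_p y -> lform l y != 0.
  by move/lift_sub => Oy; apply: patch; [exact: subset_closure|exact: Omega_neq0].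
have : connected (lform l @` Omega_p).
  apply: connected_continuous_connected => //.
  exact/continuous_subspaceT/lform_continuous.
move/connected_intervalP => Ci.
have neg y : lform (- l) y = - lform l y by rewrite -scaleN1r lform_scalel mulN1r.
have [[y Oy ly]|h] := pselect (exists2 y, Omega_p y & 0 < lform l y).
  left => z Oz; rewrite lt_neqAle eq_sym n0 //= leNgt; apply/negP => lz.
  have Ez : (lform l @` Omega_p) (lform l z) by exists z.
  have Ey : (lform l @` Omega_p) (lform l y) by exists y.
  have [|w Ow lw] := Ci _ _ Ez Ey 0; first by rewrite !ltW.
  by move: (n0 w Ow); rewrite lw eqxx.
right => z Oz; rewrite neg oppr_gt0 lt_neqAle n0 //= leNgt; apply/negP => lz.
by apply: h; exists z.
Qed.

Lemma domain_strict_cone_exists : exists l, [/\ closure_in_patch l Omega,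
  forall y, Omega_p y -> 0 < lform l y &
  strict_cone (domain_cone Omega l) (boundary_cone Omega l) l].
Proof.
have [_ _ [l [patch conv str]]] := dom.
have neg y : lform (- l) y = - lform l y by rewrite -scaleN1r lform_scalel mulN1r.
have same (r s : R) x y : 0 < r * s -> Omega (r *: x + s *: y) ->
    exists r s : R, [/\ 0 < r, 0 < s & Omega (r *: x + s *: y)].
  move=> rs O; case: (ltgtP r 0) => r0; last by rewrite r0 mul0r ltxx in rs.
  - exists (- r), (- s); split; [lra|nra|].
    have -> : (- r) *: x + (- s) *: y = (-1) *: (r *: x + s *: y) by vring.
    by apply: Omega_scale => //; rewrite oppr_eq0 oner_neq0.
  - by exists r, s; split => //; nra.
have [pos|pos] := lift_sign patch; [exists l|exists (- l)]; split => //.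
- apply: domain_strict_cone => // [x y Ox Oy lx ly|x y cx cy nx ny lx ly xy].
    by apply: (domain_add conv) => //; rewrite mulr_gt0.
  have [|r [s [rs O]]] := domain_strict conv str cx cy nx ny _ xy.
    by rewrite mulr_gt0.
  exact: same rs O.
- by move=> x cx x0; rewrite neg oppr_eq0; exact: patch.
- apply: domain_strict_cone => // [x y Ox Oy|x y cx cy nx ny]; rewrite !neg => lx ly.
    by apply: (domain_add conv) => //; nra.
  move=> xy; have [|r [s [rs O]]] := domain_strict conv str cx cy nx ny _ xy; first nra.
  exact: same rs O.
Qed.

End Domain.
End DomainToCone.

Lemma set3_distinct (T : eqType) (a b c x y z : T) : [set a; b; c] = [set x; y; z] ->
  [/\ x != y, y != z & x != z] -> [/\ a <> b, b <> c & a <> c].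
Proof.
move=> e [/eqP xy /eqP yz /eqP xz].
have hx : [set a; b; c] x by rewrite e; left; left.
have hy : [set a; b; c] y by rewrite e; left; right.
have hz : [set a; b; c] z by rewrite e; right.
by split=> q; case: hx => [[]|] /= ?; case: hy => [[]|] /= ?;
  case: hz => [[]|] /= ?; congruence.
Qed.

(** * Cusps, vertex set and initial polyhedron of the surface *)

Section Surface.
Context (R : realType).
Local Notation V := 'cV[R]_3.
Implicit Types (a b c p q x y z w : V) (t f : set V) (m g h : 'M[R]_3).

(** The columns of [U] form a Jordan chain. The only eigenline of a single Jordan block is that of
    the first column, so [p] is a multiple of it, and the whole chain is rescaled accordingly. *)
Lemma parabolic_frame_exists m p (s : R) : parabolic m -> p != 0 -> m *m p = s *: p ->
  exists e2 e3, parabolic_frame m p e2 e3.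
Proof.
move=> [U Uu em] p0 mp.
pose u i := col i U.
have mU : m *m U = U *m jordan_block R by rewrite em mulmxKV.
have col_m i : m *m u i = U *m col i (jordan_block R).
  by rewrite /u !colE mulmxA mU -mulmxA.
have J i : U *m col i (jordan_block R) = (jordan_block R) 0 i *: u 0 +
    (jordan_block R) 1 i *: u 1 + (jordan_block R) ord_max i *: u ord_max.
  by rewrite (mulmx_cols U) !mxE.
have m0 : m *m u 0 = u 0 by rewrite col_m J !mxE /=; vring.
have m1 : m *m u 1 = u 1 + u 0 by rewrite col_m J !mxE /=; vring.
have m2 : m *m u ord_max = u ord_max + u 1 by rewrite col_m J !mxE /=; vring.
have d0 : det3 (u 0) (u 1) (u ord_max) != 0.
  by rewrite -det_mx3; move: Uu; rewrite unitmxE unitfE.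
have [al [be [ga ep]]] := basis_coord p d0.
have : (al + be) *: u 0 + (be + ga) *: u 1 + ga *: u ord_max =
    (s * al) *: u 0 + (s * be) *: u 1 + (s * ga) *: u ord_max.
  transitivity (m *m p); last by rewrite mp ep; vring.
  by rewrite ep mul_comb m0 m1 m2; vring.
case/(coord_inj d0) => e1 e2 e3.
have ga0 : ga = 0.
  apply: contrapT => /eqP gn; have s1 : s = 1 by apply: (mulIf gn); lra.
  by rewrite s1 in e2; move/eqP: gn; apply; lra.
have be0 : be = 0.
  apply: contrapT => /eqP bn; have s1 : s = 1 by apply: (mulIf bn); lra.
  by rewrite s1 in e1; move/eqP: bn; apply; lra.
have {}ep : p = al *: u 0 by rewrite ep be0 ga0 !scale0r !addr0.
have al0 : al != 0 by apply/eqP => h; rewrite ep h scale0r eqxx in p0.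
exists (al *: u 1), (al *: u ord_max); split.
- have -> : det3 p (al *: u 1) (al *: u ord_max) =
    al * al * al * det3 (u 0) (u 1) (u ord_max) by rewrite ep /det3 !mxE; ring.
  by rewrite !mulf_neq0.
- by rewrite ep -scalemxAr m0.
- by rewrite ep -scalemxAr m1 scalerDr.
- by rewrite -scalemxAr m2 scalerDr.
Qed.

Lemma parabolic_frame_scale m p e2 e3 (s : R) : s != 0 -> parabolic_frame m p e2 e3 ->
  parabolic_frame m (s *: p) (s *: e2) (s *: e3).
Proof.
move=> s0 [d m1 m2 m3]; split.
- have -> : det3 (s *: p) (s *: e2) (s *: e3) = s * s * s * det3 p e2 e3.
    by rewrite /det3 !mxE; ring.
  by rewrite !mulf_neq0.
- by rewrite -scalemxAr m1.
- by rewrite -scalemxAr m2 scalerDr.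
- by rewrite -scalemxAr m3 scalerDr.
Qed.

Variables (Omega Omega_p : set V) (Gam : set 'M[R]_3) (k : nat) (v : 'I_k -> V).
Variable (T : set (set V)).
Hypothesis dom : strictly_convex_domain Omega.
Hypothesis grp : discrete_fg_subgroup_SL3 Gam.
Hypothesis presO : preserves Omega Gam.
Hypothesis freeO : acts_freely Omega Gam.
Hypothesis lift : is_lift Omega Omega_p.
Hypothesis presL : preserves_lift Gam Omega_p.
Hypothesis reps : light_cone_representatives Gam Omega_p v.
Hypothesis sit : straight_ideal_triangulation Gam Omega_p T.

Variable l : 'rV[R]_3.
Hypothesis patch : closure_in_patch l Omega.
Hypothesis pos : forall y, Omega_p y -> 0 < lform l y.
Let K := domain_cone Omega l.
Let D := boundary_cone Omega l.
Hypothesis sc : strict_cone K D l.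
Let B := light_cone_orbits Gam v.
Let pfp := parabolic_fixed_point Gam Omega_p.

Lemma lift_unit y : Omega_p y -> euclid_norm y = 1.
Proof. by have [h _ _ _] := lift; move/h. Qed.

Lemma K_liftP x : K x <-> x != 0 /\ Omega_p (normalize x).
Proof.
have [_ _ _ hO] := lift; split.
- move=> [/[dup] Ox /hO [t [y [t0 Oy ex]]] lx]; split; first exact: (Omega_neq0 dom).
  have tp : 0 < t by move: lx; rewrite ex lformZ pmulr_lgt0 // pos.
  by rewrite ex normalizeZ // normalize_unit // lift_unit.
- move=> [x0 On]; have n0 := euclid_norm_gt0 x0; split.
  + by apply/hO; exists (euclid_norm x), (normalize x); rewrite gt_eqF // -normalizeE.
  + by rewrite (normalizeE x0) lformZ mulr_gt0 // pos.
Qed.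

Lemma Gam_neq0 g x : Gam g -> x != 0 -> g *m x != 0.
Proof.
move=> Gg; apply: contra_neq => e; have [[_ _ H] _ _ _] := grp.
have [gu _] := H g Gg.
by rewrite -[x]mul1mx -(mulVmx gu) -mulmxA e mulmx0.
Qed.

Lemma normalize_mul g x : Gam g -> x != 0 ->
  sphere_act g (normalize x) = normalize (g *m x).
Proof.
move=> Gg x0; rewrite /sphere_act [X in g *m X]/normalize -scalemxAr normalizeZ //.
by rewrite invr_gt0 euclid_norm_gt0.
Qed.

Lemma domain_cone_group : cone_group K D Gam.
Proof.
have [gr dt _ _] := grp; have [G1 GM GV'] := gr.
have gK g x : Gam g -> K x -> K (g *m x).
  move=> Gg /K_liftP [x0 On]; apply/K_liftP; split; first exact: Gam_neq0.
  by rewrite -normalize_mul //; exact: presL.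
split => // g x Gg [cx nx lx].
have x0 : x != 0 by apply/eqP => h; rewrite h /lform mulmx0 mxE ltxx in lx.
have cgx : closure Omega (g *m x).
  apply: (@closure_map _ Omega Omega (mulmx g)) cx; first exact: mulmx_continuous.
  by move=> y; exact: presO.
split => //.
- move=> Ogx; apply: nx; have [gu GVg] := GV' g Gg.
  by rewrite -[x]mul1mx -(mulVmx gu) -mulmxA; exact: presO.
(* [x] is a limit of points of [K], whose images stay in [K], so [l] is nonnegative at [g *m x]; the
   affine patch excludes zero. *)
- rewrite lt_neqAle eq_sym patch //=; last exact: Gam_neq0.
  have cA : closure (Omega `&` [set y | 0 < 1 * lform l y]) x.
    by apply: closure_inter_open => //; [exact: open_form_gt0|rewrite /= mul1r].
  have cK : closure K (g *m x).
    apply: (@closure_map _ _ K (mulmx g) x _ _ cA); first exact: mulmx_continuous.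
    by move=> y [Oy]; rewrite /= mul1r => ly; apply: gK.
  by apply: closure_form_ge0 cK => y [_ /ltW].
Qed.
Let cg := domain_cone_group.

Lemma sphere_boundaryP y : sphere_boundary Omega_p y <-> D y /\ euclid_norm y = 1.
Proof.
split.
- move=> [cy ny].
  have y1 : euclid_norm y = 1.
    have : closed (@unit_sphere R).
      rewrite /unit_sphere; apply: (@preimage_closed _ _ (@euclid_norm R) [set s | s = 1]).
        by move=> x _; exact: euclid_norm_continuous.
      exact: closed_eq.
    apply; apply: closureS cy => z; exact: lift_unit.
  have y0 : y != 0.
    apply/eqP => h; have := euclid_normZ y (lexx 0).
    by rewrite scale0r mul0r -h y1; lra.
  have cO : closure Omega y by apply: closureS cy; exact: lift_sub lift.
  have ly : 0 < lform l y.
    rewrite lt_neqAle eq_sym patch //=.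
    by apply: closure_form_ge0 cy => z /pos /ltW.
  split => //; split => // Oy; apply: ny.
  have [_ h] := (K_liftP y).1 (conj Oy ly).
  by rewrite normalize_unit in h.
- move=> [[cy nO ly] y1]; split; last by move/(lift_sub lift).
  have y0 : y != 0 by apply/eqP => h; rewrite h /lform mulmx0 mxE ltxx in ly.
  have : closure (Omega `&` [set y | 0 < 1 * lform l y]) y.
    by apply: closure_inter_open => //; [exact: open_form_gt0|rewrite /= mul1r].
  rewrite -{2}(normalize_unit y1); apply: closure_map.
    exact: normalize_continuous.
  move=> z [Oz]; rewrite /= mul1r => lz.
  by have [_] := (K_liftP z).1 (conj Oz lz).
Qed.

Lemma D_scale (s : R) x : 0 < s -> D x -> D (s *: x).
Proof.
move=> s0 [cx nx lx]; have s1 := lt0r_neq0 s0; split.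
- exact: (closure_Omega_scale dom).
- move=> Os; apply: nx; rewrite -[x]scale1r -(mulVf s1) -scalerA.
  by apply: (Omega_scale dom) => //; rewrite invr_eq0.
- by rewrite lformZ mulr_gt0.
Qed.

Lemma pfp_act g p : Gam g -> pfp p -> pfp (sphere_act g p).
Proof.
move=> Gg [/sphere_boundaryP [Dp p1] [m [Gm pm mp]]].
have p0 := D_neq0 sc Dp; have gp0 := Gam_neq0 Gg p0.
have gu := Gam_unit cg Gg.
split.
  apply/sphere_boundaryP; split; last exact: euclid_norm_normalize.
  apply: D_scale; first by rewrite invr_gt0 euclid_norm_gt0.
  exact: (cg_D cg).
exists (g *m m *m invmx g); split.
- by apply: (GamM cg); [exact: (GamM cg)|exact: (GamV cg)].
- have [U Uu em] := pm; exists (g *m U); first by rewrite unitmx_mul gu.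
  have gUu : g *m U \in unitmx by rewrite unitmx_mul gu.
  apply: (can_inj (mulmxK gUu)); rewrite [RHS]mulmxKV // em -!mulmxA.
  by rewrite mulKmx // mulVmx // mulmx1.
- rewrite normalize_mul //; last first.
    by apply: (GamM cg); [exact: (GamM cg)|exact: (GamV cg)].
  rewrite -!mulmxA (mulVx cg) // [in RHS]/sphere_act.
  have e := normalizeE (Gam_neq0 Gm p0); rewrite -/(sphere_act m p) mp in e.
  by rewrite e -scalemxAr normalizeZ // euclid_norm_gt0 // Gam_neq0.
Qed.

Lemma rep_D (c : 'I_k) : D (v c).
Proof.
have [[t [y [t0 /sphere_boundaryP [Dy _] ->]]] _] := reps.1 c.
exact: D_scale.
Qed.

Lemma B_D : B `<=` D.
Proof. by move=> _ [m [c [Gm ->]]]; apply: (cg_D cg) => //; exact: rep_D. Qed.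

Lemma B_mul g b : Gam g -> B b -> B (g *m b).
Proof.
move=> Gg [m [c [Gm ->]]]; exists (g *m m), c; split; first exact: (GamM cg).
by rewrite mulmxA.
Qed.

Lemma B_neq0 b : B b -> b != 0.
Proof. by move/B_D; exact: (D_neq0 sc). Qed.

Lemma B_orbit m (c : 'I_k) : Gam m -> normalize (m *m v c) = sphere_act m (normalize (v c)).
Proof. by move=> Gm; rewrite normalize_mul //; exact: (D_neq0 sc (rep_D c)). Qed.

Lemma B_pfp b : B b -> pfp (normalize b).
Proof.
move=> [m [c [Gm ->]]]; rewrite B_orbit //; apply: pfp_act => //.
exact: (reps.1 c).2.
Qed.

Lemma pfp_B p : pfp p -> exists2 b, B b & normalize b = p.
Proof.
move=> /(reps.2) [c [[m Gm ->] _]].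
by exists (m *m v c); [exists m, c|rewrite B_orbit].
Qed.

Lemma pfp_frame b : B b -> exists m e2 e3, Gam m /\ parabolic_frame m b e2 e3.
Proof.
move=> Bb; have b0 := B_neq0 Bb; have n0 := euclid_norm_gt0 b0.
have [/sphere_boundaryP [Dp p1] [m [Gm pm mp]]] := B_pfp Bb.
have p0 := D_neq0 sc Dp.
have [e2 [e3 pf]] : exists e2 e3, parabolic_frame m (normalize b) e2 e3.
  apply: (@parabolic_frame_exists _ _ (euclid_norm (m *m normalize b))) => //.
  by rewrite [LHS](normalizeE (Gam_neq0 Gm p0)) -/(sphere_act m (normalize b)) mp.
exists m, (euclid_norm b *: e2), (euclid_norm b *: e3); split => //.
rewrite [X in parabolic_frame _ X](normalizeE b0).
by apply: parabolic_frame_scale => //; rewrite gt_eqF.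
Qed.

Lemma B_other b : B b -> exists2 c, B c & normalize c <> normalize b.
Proof.
move=> /B_pfp pb; have [t Tt tb] := sit_vertices sit pb.
have [p [q [r [[/eqP pq /eqP qr /eqP pr] et sub]]]] := sit_triangle sit Tt.
have key z : t z -> z <> normalize b ->
    exists2 c, B c & normalize c <> normalize b.
  by move=> /sub /pfp_B [c Bc <-] h; exists c.
have [tp tq] : t p /\ t q by rewrite et; split; left; [left|right].
have [e|n] := pselect (p = normalize b); last exact: key n.
by apply: (key q) => //; rewrite -e; exact/nesym.
Qed.

(** Both vectors are translates of the same [v c], so an element of [Gam] maps [v c] to a multiple
    of itself, and [stabilizer_eigenvalue] makes the factor 1. *)
Lemma B_normalize_inj b b' : B b -> B b' -> normalize b = normalize b' -> b = b'.
Proof.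
move=> Bb Bb' e.
have [c [_ uc]] := reps.2 _ (B_pfp Bb).
have [m [c1 [Gm eb]]] := Bb; have [m' [c2 [Gm' eb']]] := Bb'.
have e1 : c = c1 by apply: uc; exists m; rewrite // eb B_orbit.
have e2 : c = c2 by apply: uc; exists m'; rewrite // e eb' B_orbit.
rewrite -e1 in eb; rewrite -e2 in eb'.
have b0 := B_neq0 Bb; have b'0 := B_neq0 Bb'.
have nb := euclid_norm_gt0 b0; have nb' := euclid_norm_gt0 b'0.
have Dv := rep_D c.
pose s := euclid_norm b' / euclid_norm b.
have b'E : b' = s *: b.
  by rewrite [LHS](normalizeE b'0) -e /s /normalize scalerA.
have gv : (invmx m *m m') *m v c = s *: v c.
  rewrite -mulmxA -eb' b'E eb -scalemxAr; congr (_ *: _).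
  exact: (mulVx cg).
have Gg : Gam (invmx m *m m') by apply: (GamM cg) => //; exact: (GamV cg).
have Bv : B (v c).
  by exists 1%:M, c; rewrite mul1mx; split => //; exact: (Gam1 cg).
have [m0 [f2 [f3 [Gm0 pf]]]] := pfp_frame Bv.
have [w Bw nw] := B_other Bv.
have wv (q : R) : w != q *: v c.
  apply/eqP => ew; apply: nw; rewrite ew normalizeZ //.
  have := sc_posD sc (B_D Bw); rewrite ew lformZ pmulr_lgt0 //.
  exact: (sc_posD sc).
have [_ _ iso _] := grp.
have s1 := stabilizer_eigenvalue sc cg Gm0 Dv pf (B_D Bw) wv iso Gg gv.
by rewrite b'E s1 scale1r.
Qed.

Lemma surface_cusped_cone : cusped_cone K D l Gam B.
Proof.
split => //.
- move=> g x Gg [Ox _] gx; apply: (freeO Gg Ox (t := 1)); by rewrite scale1r.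
- exact: B_D.
- exact: B_mul.
- move=> b b' s Bb Bb' e; apply/esym/B_normalize_inj => //.
  rewrite e normalizeZ //.
  have := sc_posD sc (B_D Bb'); rewrite e lformZ pmulr_lgt0 //.
  exact: (sc_posD sc (B_D Bb)).
- exact: pfp_frame.
- by move=> b /B_other [c Bc n]; exists c => // e; apply: n; rewrite e.
Qed.
Let cc := surface_cusped_cone.

Let P0 := induced_polyhedron B T.

Lemma ideal_simplex_cone a b c x : B a -> B b -> B c -> K x ->
  ideal_simplex Omega_p [set normalize a; normalize b; normalize c] (normalize x) <->
  cone_hull [set a; b; c] x.
Proof.
move=> Ba Bb Bc Kx; have [x0 On] := (K_liftP x).1 Kx.
have nx := euclid_norm_gt0 x0.
have na := euclid_norm_gt0 (B_neq0 Ba); have nb := euclid_norm_gt0 (B_neq0 Bb).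
have nc := euclid_norm_gt0 (B_neq0 Bc).
split.
- move=> [_ [s s0 /convex_hull3 [r1 [r2 [r3 [r10 r20 r30 [_ e]]]]]]].
  apply/cone_hull3.
  have s' : 0 < s / euclid_norm x by apply: divr_gt0.
  pose q := (s / euclid_norm x)^-1.
  have q0 : 0 < q by rewrite invr_gt0.
  exists (q * (r1 / euclid_norm a)), (q * (r2 / euclid_norm b)),
    (q * (r3 / euclid_norm c)).
  have q1 := ltW q0.
  split; [by apply: mulr_ge0 => //; apply: divr_ge0 => //; exact: ltW..|].
  move: e; rewrite /normalize !scalerA => e.
  transitivity (q *: ((s / euclid_norm x) *: x)).
    by rewrite scalerA mulVf ?scale1r // gt_eqF.
  by rewrite e !scalerDr !scalerA.
- move=> /cone_hull3 [r1 [r2 [r3 [r10 r20 r30 e]]]]; split=> //.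
  (* Total weight of [x] over the unit vertices; dividing by it turns cone coordinates into convex
     ones. *)
  pose S := r1 * euclid_norm a + r2 * euclid_norm b + r3 * euclid_norm c.
  have h1 : 0 <= r1 * euclid_norm a by rewrite mulr_ge0 // ltW.
  have h2 : 0 <= r2 * euclid_norm b by rewrite mulr_ge0 // ltW.
  have h3 : 0 <= r3 * euclid_norm c by rewrite mulr_ge0 // ltW.
  have S0 : 0 < S.
    rewrite lt_neqAle eq_sym !addr_ge0 // andbT; apply/eqP => SE.
    have zero (r n : R) : 0 < n -> r * n = 0 -> r = 0.
      by move=> n0 /eqP; rewrite mulf_eq0 (gt_eqF n0) orbF => /eqP.
    have z1 : r1 = 0 by apply: (zero _ _ na); rewrite /S in SE; lra.
    have z2 : r2 = 0 by apply: (zero _ _ nb); rewrite /S in SE; lra.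
    have z3 : r3 = 0 by apply: (zero _ _ nc); rewrite /S in SE; lra.
    by move/eqP: x0; apply; rewrite e z1 z2 z3 !scale0r !addr0.
  exists (euclid_norm x / S); first exact: divr_gt0.
  apply/convex_hull3; exists (r1 * euclid_norm a / S), (r2 * euclid_norm b / S),
    (r3 * euclid_norm c / S).
  have S1 := ltW S0.
  split; [by rewrite divr_ge0..|split].
    by rewrite -!mulrDl divff // gt_eqF.
  have nE (r : R) z : B z -> (r * euclid_norm z / S) *: normalize z = S^-1 *: (r *: z).
    move=> Bz; rewrite [in RHS](normalizeE (B_neq0 Bz)) !scalerA.
    by congr (_ *: _); ring.
  rewrite !nE // -!scalerDr -e /normalize scalerA; congr (_ *: _).
  by rewrite mulrAC divff ?mul1r // gt_eqF.
Qed.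

Lemma polyhedron_triple f : P0 f -> exists a b c, [/\ vertex_triple B a b c,
  f = [set a; b; c] & T [set normalize a; normalize b; normalize c]].
Proof.
move=> [a [b [c [Ba Bb Bc -> Tn]]]]; exists a, b, c; split => //.
have [p [q [r [d e _]]]] := sit_triangle sit Tn.
have [h1 h2 h3] := set3_distinct e d.
by split; split => // h; [apply: h1|apply: h2|apply: h3]; rewrite h.
Qed.

Lemma polyhedron_of_triangle t : T t -> exists a b c, [/\ B a, B b, B c &
  t = [set normalize a; normalize b; normalize c]].
Proof.
move=> Tt; have [p [q [r [_ et sub]]]] := sit_triangle sit Tt.
have [a Ba ea] : exists2 b, B b & normalize b = p.
  by apply: pfp_B; apply: sub; rewrite et; left; left.
have [b Bb eb] : exists2 b, B b & normalize b = q.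
  by apply: pfp_B; apply: sub; rewrite et; left; right.
have [c Bc ec] : exists2 b, B b & normalize b = r.
  by apply: pfp_B; apply: sub; rewrite et; right.
by exists a, b, c; rewrite ea eb ec.
Qed.

Lemma polyhedron_normalize_inj f f' : P0 f -> P0 f' ->
  @normalize R @` f = @normalize R @` f' -> f = f'.
Proof.
have sub (g g' : set V) : P0 g -> P0 g' -> @normalize R @` g = @normalize R @` g' -> g `<=` g'.
  move=> [a [b [c [Ba Bb Bc -> _]]]] [a' [b' [c' [Ba' Bb' Bc' -> _]]]] e x gx.
  have [y gy exy] : ((@normalize R) @` [set a'; b'; c']) (normalize x).
    by rewrite -e; exists x.
  suff <- : y = x by [].
  apply: B_normalize_inj => //.
  - by case: gy => [[]|] ->.
  - by case: gx => [[]|] ->.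
by move=> h h' e; apply/seteqP; split; exact: sub.
Qed.

(** Only the finitely many triangles meeting a neighbourhood of the direction of [x] matter, and the
    cone over each of them is closed. *)
Lemma polyhedron_locfin x y : K x -> near0 (fun s => forall f,
  P0 f -> cone_hull f (x + s *: y) -> cone_hull f x).
Proof.
move=> Kx; have [x0 On] := (K_liftP x).1 Kx.
have [U nU /finite_seqP [ts ets]] := sit_locally_finite sit On.
have nW : nbhs x (@normalize R @^-1` U) by exact: (normalize_continuous x0).
have inU := near0_nbhs y nW.
have inK : near0 (fun s => K (x + s *: y)).
  by have [e e0 he] := sc_open sc y Kx; exists e.
have each t : near0 (fun s => forall f, P0 f -> @normalize R @` f = t ->
    cone_hull f (x + s *: y) -> cone_hull f x).
  have [[f [Pf ef]]|nf] := pselect (exists f, P0 f /\ @normalize R @` f = t); last first.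
    by apply: near0_all => s f Pf ef; case: nf; exists f.
  have [a [b [c [vt e _]]]] := polyhedron_triple Pf.
  have := @closed_near0 R K D l Gam B cc a b c x y vt.
  apply: near0_imp => s hs f' Pf' ef'.
  have -> : f' = f by apply: polyhedron_normalize_inj => //; rewrite ef ef'.
  by rewrite e.
have all : near0 (fun s => forall t, t \in ts -> forall f, P0 f ->
    @normalize R @` f = t -> cone_hull f (x + s *: y) -> cone_hull f x).
  elim: ts {ets} => [|t ts IH]; first exact: near0_all.
  have := near0_and (each t) IH; apply: near0_imp => s [h1 h2] t'.
  by rewrite inE => /orP[/eqP ->|/h2].
have := near0_and all (near0_and inU inK); apply: near0_imp.
move=> s [hall [hU hK]] f Pf fs.
apply: (hall (@normalize R @` f)) => //.
have [a [b [c [[[Ba Bb Bc] _] e Tn]]]] := polyhedron_triple Pf.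
have : [set` ts] (@normalize R @` f).
  rewrite -ets e image_set3; split => //; exists (normalize (x + s *: y)); split => //.
  by apply/ideal_simplex_cone => //; rewrite -e.
by [].
Qed.

Lemma polyhedron_triangulation : triangulation K Gam B P0.
Proof.
split.
- by move=> f /polyhedron_triple [a [b [c [vt ef _]]]]; exists a, b, c.
- move=> b Bb; have [t Tt tb] := sit_vertices sit (B_pfp Bb).
  have [a1 [a2 [a3 [B1 B2 B3 et]]]] := polyhedron_of_triangle Tt.
  exists [set a1; a2; a3]; first by exists a1, a2, a3; split; rewrite -?et.
  by move: tb; rewrite et => -[[]|] /B_normalize_inj -> //; [left; left|left; right|right].
- move=> g f Gg [a [b [c [Ba Bb Bc -> Tn]]]].
  exists (g *m a), (g *m b), (g *m c); rewrite image_set3.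
  split => //; [exact: B_mul..|].
  have := sit_invariant sit Gg Tn; rewrite image_set3 !normalize_mul //; exact: B_neq0.
- move=> x Kx; have [x0 On] := (K_liftP x).1 Kx.
  have [t Tt tx] := sit_cover sit On.
  have [a [b [c [Ba Bb Bc et]]]] := polyhedron_of_triangle Tt.
  exists [set a; b; c]; first by exists a, b, c; split; rewrite -?et.
  by apply/ideal_simplex_cone; rewrite -?et.
- move=> f f' x [a [b [c [Ba Bb Bc ef Tn]]]] [a' [b' [c' [Ba' Bb' Bc' ef' Tn']]]] Kx fx f'x.
  have [x0 On] := (K_liftP x).1 Kx.
  have ix : ideal_simplex Omega_p [set normalize a; normalize b; normalize c] (normalize x).
    by apply/ideal_simplex_cone; rewrite -?ef.
  have ix' : ideal_simplex Omega_p [set normalize a'; normalize b'; normalize c']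
      (normalize x).
    by apply/ideal_simplex_cone; rewrite -?ef'.
  (* A multiple of [x] lies in the hull of the common unit vertices; each of these is the direction
     of a single element of [B], hence of a common vertex of [f] and [f']. *)
  have [_ [s s0 hs]] := sit_edge_to_edge sit Tn Tn' (conj ix ix').
  have [_ hD hZ] := cone_hull_cone (f `&` f').
  have cs : cone_hull (f `&` f') (s *: normalize x).
    move: hs; apply: convex_hull_sub.
      apply/convex_setE => y z r /andP[r0 r1] hy hz.
      by apply: (hD); apply: (hZ) => //; lra.
    move=> z [hz hz'].
    have [u fu eu] : exists2 u, f u & z = normalize u.
      rewrite ef; case: hz => [[]|] ->; [exists a|exists b|exists c] => //.
      - by left; left.
      - by left; right.
      - by right.
    have [u' fu' eu'] : exists2 u, f' u & z = normalize u.
      rewrite ef'; case: hz' => [[]|] ->; [exists a'|exists b'|exists c'] => //.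
      - by left; left.
      - by left; right.
      - by right.
    have Bu : B u by move: fu; rewrite ef => -[[]|] ->.
    have Bu' : B u' by move: fu'; rewrite ef' => -[[]|] ->.
    have uu' : u = u' by apply: B_normalize_inj; rewrite // -eu.
    rewrite eu /normalize; apply: (hZ); first by rewrite invr_ge0 euclid_norm_ge0.
    by apply: sub_cone_hull; split => //; rewrite uu'.
  have -> : x = (euclid_norm x / s) *: (s *: normalize x).
    by rewrite scalerA divfK ?gt_eqF // -normalizeE.
  by apply: (hZ) => //; rewrite divr_ge0 ?euclid_norm_ge0 // ltW.
- move=> x y Kx; have [e e0 he] := polyhedron_locfin y Kx.
  by exists e => // s f hs; exact: he.
Qed.

Lemma edge_flips_triangulation P P' : clos_refl_trans _ (edge_flip Gam) P P' ->
  triangulation K Gam B P -> triangulation K Gam B P'.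
Proof.
elim=> {P P'} [P P' fl tP|//|P P' P'' _ IH1 _ IH2 /IH1 /IH2 //].
exact: edge_flip_triangulation cc _ _ tP fl.
Qed.

Lemma algorithm_output Q : edge_flipping_output Gam P0 Q ->
  Q = polygonal_faces (convex_hull B).
Proof.
move=> [P [flips stuck cl]].
have tP := edge_flips_triangulation flips polyhedron_triangulation.
exact: cleanup_polygonal cc _ tP stuck _ cl.
Qed.

End Surface.

Theorem theorem7 (R : realType) (g k : nat)
    (Omega : set 'cV[R]_3) (Gamma : set 'M[R]_3) (Omega_p : set 'cV[R]_3)
    (v : 'I_k -> 'cV[R]_3) (T : set (set 'cV[R]_3))
    (P : set (set 'cV[R]_3)) :
  cusped_convex_surface Omega Gamma g k ->
  is_lift Omega Omega_p ->
  preserves_lift Gamma Omega_p ->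
  light_cone_representatives Gamma Omega_p v ->
  straight_ideal_triangulation Gamma Omega_p T ->
  edge_flipping_output Gamma
    (induced_polyhedron (light_cone_orbits Gamma v) T) P ->
  P = polygonal_faces (convex_hull (light_cone_orbits Gamma v)) /\
  [set radial_projection Omega_p f | f in P] =
    epstein_penner_decomposition Omega_p (light_cone_orbits Gamma v).
Proof.
move=> [dom grp presO freeO _ _ _ _] lift presL reps sit out.
have [l [patch pos sc]] := domain_strict_cone_exists dom lift.
have -> := algorithm_output dom grp presO freeO lift presL reps sit patch pos sc out.
by split.
Qed.
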